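(* Let $\alpha,\beta>0$ with $\alpha\beta\le1$, let $g,\tilde g\in L^2(\mathbb{R}^d)$ be such that $\{g_{m,n}\}_{m,n\in\mathbb{Z}^d}$ is a Gabor frame for $L^2(\mathbb{R}^d)$ with dual Gabor frame $\{\tilde g_{m,n}\}_{m,n\in\mathbb{Z}^d}$. Then for every $T\in\mathbf{A}$ the limit $$\gamma(T)=\frac{1}{(\alpha\beta)^d}\lim_{M,N\to\infty}\frac{1}{(2M+1)^d(2N+1)^d}\sum_{|m|\le M}\sum_{|n|\le N}\langle Tg_{m,n},\tilde g_{m,n}\rangle$$ exists and does not depend on the choice of $\alpha,\beta,g,\tilde g$; for $T=\sum_\lambda c_\lambda U_\lambda\in\mathcal{A}$ one has $\gamma(T)=c_0$ (the coefficient at $\lambda=0$); and $\gamma$ is a faithful tracial state on $\mathbf{A}$.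
   Context: For $\lambda=(t,\omega)\in\mathbb{R}^d\times\mathbb{R}^d$, $U_{(t,\omega)}f(x)=e^{i\langle\omega,x\rangle}f(x-t)$ on $L^2(\mathbb{R}^d)$. $\mathcal{A}$ is the algebra of operators $T=\sum_{\lambda\in\mathbb{R}^{2d}}c_\lambda U_\lambda$ with $\sum_\lambda|c_\lambda|<\infty$, and $\mathbf{A}$ is the $C^*$-algebra obtained as the closure of $\mathcal{A}$ in operator norm in $B(L^2(\mathbb{R}^d))$. For $m,n\in\mathbb{Z}^d$, $g_{m,n}=U_{(\beta n,2\pi\alpha m)}g$ and $\tilde g_{m,n}=U_{(\beta n,2\pi\alpha m)}\tilde g$; ''dual frame'' means both systems are frames and $f=\sum_{m,n}\langle f,\tilde g_{m,n}\rangle g_{m,n}$ for all $f\in L^2(\mathbb{R}^d)$. $|m|$ is the max-norm on $\mathbb{Z}^d$. A faithful tracial state on a unital $C^*$-algebra is a linear functional $\gamma$ with $\gamma(1)=1$, $\gamma(T^*T)\ge0$, $\gamma(ST)=\gamma(TS)$, and $\gamma(T^*T)=0$ only if $T=0$. *)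

(* Defs.v *)
From mathcomp Require Import all_boot all_algebra.
From mathcomp Require Import all_classical all_reals all_analysis.
From mathcomp Require Import complex.
Import numFieldNormedType.Exports.
Import GRing.Theory Num.Theory.
Set Implicit Arguments.
Unset Strict Implicit.
Unset Printing Implicit Defensive.
Local Open Scope classical_set_scope.
Local Open Scope ring_scope.
Local Open Scope complex_scope.

Section Gabor.
Variables (R : realType) (d : nat).

(* points of R^d are d-tuples of reals; functions R^d -> C *)
Definition fn := d.-tuple R -> R[i].
(* (not necessarily linear) maps on functions; elements of A are those
   that are bounded operators on L^2 (see inA) *)
Definition Op := fn -> fn.

Variable mu : {measure set (d.-tuple R) -> \bar R}.

(* mu is Lebesgue measure on (the Borel sets of) R^d:
   it gives every half-open box its volume *)
Definition is_lebesgue := forall a b : d.-tuple R,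
  mu [set x | forall i, tnth a i <= tnth x i < tnth b i] =
  (\prod_(i < d) Num.max 0 (tnth b i - tnth a i))%:E.

(* |z|^2 and |z| of a complex number, as reals *)
Definition csq (z : R[i]) : R := complex.Re z ^+ 2 + complex.Im z ^+ 2.
Definition cmod (z : R[i]) : R := Num.sqrt (csq z).

(* f belongs to L^2(R^d) *)
Definition L2 (f : fn) : Prop :=
  [/\ measurable_fun setT (fun x => complex.Re (f x)),
      measurable_fun setT (fun x => complex.Im (f x)) &
      (\int[mu]_x (csq (f x))%:E < +oo)%E].

Definition l2norm (f : fn) : R := Num.sqrt (Rintegral mu setT (fun x => csq (f x))).

(* integral of a complex-valued function: real part + i imaginary part *)
Definition cint (h : fn) : R[i] :=
  (Rintegral mu setT (fun x => complex.Re (h x)) +i* Rintegral mu setT (fun x => complex.Im (h x))).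

(* <f, h> = int f conj(h) *)
Definition inner (f h : fn) : R[i] := cint (fun x => f x * (h x)^*).

Definition expi (t : R) : R[i] := (cos t +i* sin t).

Definition dot (w x : d.-tuple R) : R := \sum_(i < d) tnth w i * tnth x i.

Definition tsub (x t : d.-tuple R) : d.-tuple R := [tuple tnth x i - tnth t i | i < d].

(* time-frequency shift U_(t,w) f (x) = e^{i<w,x>} f(x - t) *)
Definition U (t w : d.-tuple R) : Op := fun f x => expi (dot w x) * f (tsub x t).

(* g_{m,n} = U_(beta n, 2 pi alpha m) g *)
Definition gab (alpha beta : R) (g : fn) (k : d.-tuple int * d.-tuple int) : fn :=
  U [tuple beta * (tnth k.2 i)%:~R | i < d] [tuple 2 * pi * alpha * (tnth k.1 i)%:~R | i < d] g.

(* (unconditional) summability in L^2: s = sum_i F i in L^2 norm,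
   along the net of finite subsets of the index set *)
Definition HasSumL2 (I : choiceType) (F : I -> fn) (s : fn) : Prop :=
  L2 s /\ forall e : R, 0 < e -> exists F0 : set I, finite_set F0 /\
    forall F1 : set I, finite_set F1 -> F0 `<=` F1 ->
      l2norm (fun x => s x - \sum_(i \in F1) F i x) <= e.

(* {g_{m,n}} is a Gabor frame *)
Definition is_gabor_frame (alpha beta : R) (g : fn) : Prop :=
  L2 g /\ exists A B : R, [/\ 0 < A, 0 < B & forall f, L2 f ->
    ((A * l2norm f ^+ 2)%:E <=
       \esum_(k in [set: d.-tuple int * d.-tuple int]) (csq (inner f (gab alpha beta g k)))%:E
     <= (B * l2norm f ^+ 2)%:E)%E].

(* {gt_{m,n}} is a dual frame of {g_{m,n}} *)
Definition dual_gabor_frame (alpha beta : R) (g gt : fn) : Prop :=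
  [/\ is_gabor_frame alpha beta g, is_gabor_frame alpha beta gt &
      forall f, L2 f -> HasSumL2 (fun k x => inner f (gab alpha beta gt k) * gab alpha beta g k x) f].

(* T = sum_lambda c_lambda U_lambda with sum |c_lambda| < oo  (T in script-A) *)
Definition is_Asum (c : d.-tuple R * d.-tuple R -> R[i]) (T : Op) : Prop :=
  (\esum_(l in [set: d.-tuple R * d.-tuple R]) (cmod (c l))%:E < +oo)%E /\
  forall f, L2 f -> HasSumL2 (fun l x => c l * U l.1 l.2 f x) (T f).

(* T in bold-A: the operator-norm closure of script-A in B(L^2) *)
Definition inA (T : Op) : Prop :=
  (forall f, L2 f -> L2 (T f)) /\
  forall e : R, 0 < e -> exists c S, is_Asum c S /\
    forall f, L2 f -> l2norm (fun x => T f x - S f x) <= e * l2norm f.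

(* T' is the Hilbert-space adjoint of T *)
Definition adjoint (T T' : Op) : Prop :=
  forall f h, L2 f -> L2 h -> inner (T f) h = inner f (T' h).

(* the box { m in Z^d : |m|_max <= M } *)
Definition boxZ (M : nat) : set (d.-tuple int) :=
  [set m | forall i, `|tnth m i| <= M%:Z]%R.

Definition gabor_avg (alpha beta : R) (g gt : fn) (T : Op) (M N : nat) : R[i] :=
  (((2 * M + 1) ^ d * (2 * N + 1) ^ d)%N%:R)^-1 *
  \sum_(m \in boxZ M) \sum_(n \in boxZ N)
     inner (T (gab alpha beta g (m, n))) (gab alpha beta gt (m, n)).

(* a M N --> l as M, N --> oo *)
Definition double_lim (a : nat -> nat -> R[i]) (l : R[i]) : Prop :=
  forall e : R, 0 < e -> exists K : nat, forall M N : nat,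
    (K <= M)%N -> (K <= N)%N -> cmod (a M N - l) <= e.

End Gabor.

(* Main.v *)
(* On a finite sum T = sum_j c_j U_{l_j} the commutation relations turn the
   averages into averages of characters of Z^{2d}: only the l_j in the adjoint
   lattice survive, and for them the Wexler-Raz identity
   <U_l g, gt> = (alpha beta)^d [l = 0] leaves exactly c_0. Since averages are
   dominated by the operator norm (test with the indicator of a cube and a
   lattice so fine that its adjoint meets the support of T only in 0), c_0
   extends by continuity to the closure A.

   Wexler-Raz is obtained by testing the frame expansion on the indicators of
   P = [0, beta)^d, modulated, and of a translate of P. As alpha beta <= 1, P
   lies in a period of the characters e^{2 pi i alpha <m, x>}, so Parseval on
   [0, 1/alpha)^d performs the sum over m, and the sum over n reassembles the
   integral over R^d from its pieces on the translates of P.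

   Faithfulness: if T f <> 0, a pigeonhole argument gives a set of lattice
   points, of density bounded below independently of the lattice, at which
   |T U_l f| >= |T f| / 2; hence the mean gamma (T^* T) |f|^2 of |T U_l f|^2
   is positive. *)
Require Import Defs.
From mathcomp Require Import all_boot all_order all_algebra.
From mathcomp Require Import all_classical all_reals all_analysis.
From mathcomp Require Import measurable_realfun complex.
From mathcomp Require Import ring lra zify.
Import numFieldNormedType.Exports.
Import Order.TTheory GRing.Theory Num.Theory.
Set Implicit Arguments.
Unset Strict Implicit.
Unset Printing Implicit Defensive.
Local Open Scope classical_set_scope.
Local Open Scope ring_scope.
Local Open Scope complex_scope.
(* Inside a product, as in [inner], [z^*] is parsed in [ring_scope] and denotes
   [Num.conj z]; the same conjugation is used everywhere. *)
Local Notation "z ^*" := (Num.conj z) : complex_scope.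

(** * Complex numbers *)

(** The measure is given only by its values on boxes, and the analysis is done directly in dimension
    [d], without iterated integrals. Translation invariance comes from uniqueness of measures;
    orthogonality of the exponentials on a cube comes from translation invariance. Their
    completeness is a monotone-class argument: the functions that multiply the L2 closure of the
    trigonometric polynomials into itself include the cosines, hence, by a polynomial iteration
    converging to the sign, the indicators of half-spaces, and then of all measurable sets. The
    trace is built before any frame appears, as the limit of the zero coefficients of finite sums
    approximating [T]; its independence of the frame is thus built in. In the Wexler-Raz identity
    the Fourier error is controlled only for finitely many [n] at a time, so [M] must be chosen
    after [N]; unconditional convergence of the frame expansion leaves this freedom. In the proof of
    faithfulness the lattice has to be refined as the required precision grows, so only a lower
    bound for the means that is uniform in the lattice is of use. *)

Notation cRe := complex.Re.
Notation cIm := complex.Im.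

Section Complex.
Variable R : realType.
Implicit Types (z w : R[i]) (r : R).

Lemma cReD z w : cRe (z + w) = cRe z + cRe w. Proof. by case: z; case: w. Qed.
Lemma cImD z w : cIm (z + w) = cIm z + cIm w. Proof. by case: z; case: w. Qed.
Lemma cReN z : cRe (- z) = - cRe z. Proof. by case: z. Qed.
Lemma cImN z : cIm (- z) = - cIm z. Proof. by case: z. Qed.
Lemma cReM z w : cRe (z * w) = cRe z * cRe w - cIm z * cIm w.
Proof. by case: z; case: w. Qed.
Lemma cImM z w : cIm (z * w) = cRe z * cIm w + cIm z * cRe w.
Proof. by case: z; case: w. Qed.
Lemma cReJ z : cRe z^* = cRe z. Proof. by case: z. Qed.
Lemma cImJ z : cIm z^* = - cIm z. Proof. by case: z. Qed.
Definition cReIm := (cReD, cImD, cReN, cImN, cReM, cImM, cReJ, cImJ).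

Lemma cconjD z w : (z + w)^* = z^* + w^*. Proof. exact: rmorphD. Qed.
Lemma cconjM z w : (z * w)^* = z^* * w^*. Proof. exact: rmorphM. Qed.
Lemma cconjN z : (- z)^* = - z^*. Proof. exact: rmorphN. Qed.
Lemma cconj_sum (I : Type) (s : seq I) (F : I -> R[i]) :
  (\sum_(i <- s) F i)^* = \sum_(i <- s) (F i)^*.
Proof. exact: rmorph_sum. Qed.

Lemma complex_eqP z w : cRe z = cRe w -> cIm z = cIm w -> z = w.
Proof. by case: z => a b; case: w => c d /= -> ->. Qed.

Lemma cmodE z : (cmod z)%:C = `|z|. Proof. by rewrite normc_def. Qed.
Lemma cmod_ge0 z : 0 <= cmod z. Proof. exact: sqrtr_ge0. Qed.
Lemma csq_ge0 z : 0 <= csq z. Proof. by rewrite addr_ge0 ?sqr_ge0. Qed.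
Lemma csqE z : csq z = cmod z ^+ 2. Proof. by rewrite sqr_sqrtr ?csq_ge0. Qed.
Lemma csqJ z : z * z^* = (csq z)%:C.
Proof. by apply: complex_eqP; rewrite !cReIm /csq /=; ring. Qed.
Lemma cmodM z w : cmod (z * w) = cmod z * cmod w.
Proof. by apply: (@complexI R); rewrite rmorphM /= !cmodE normrM. Qed.
Lemma cmodD z w : cmod (z + w) <= cmod z + cmod w.
Proof. by rewrite -lecR rmorphD /= !cmodE ler_normD. Qed.
Lemma cmodN z : cmod (- z) = cmod z.
Proof. by apply: (@complexI R); rewrite !cmodE normrN. Qed.
Lemma cmodBC z w : cmod (z - w) = cmod (w - z).
Proof. by rewrite -cmodN opprB. Qed.
Lemma cmodJ z : cmod z^* = cmod z.
Proof. by rewrite /cmod /csq !cReIm sqrrN. Qed.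
Lemma cmodC r : cmod r%:C = `|r|.
Proof. by rewrite /cmod /csq /= expr0n addr0 sqrtr_sqr. Qed.
Lemma cmod0 : cmod (0 : R[i]) = 0. Proof. by rewrite (cmodC 0) normr0. Qed.
Lemma cmod1 : cmod (1 : R[i]) = 1. Proof. by rewrite (cmodC 1) normr1. Qed.
Lemma cmod_eq0 z : cmod z = 0 -> z = 0.
Proof. by move=> h; apply/eqP; rewrite -normr_eq0 -cmodE h. Qed.
Lemma cmodB z w t : cmod (z - w) <= cmod (z - t) + cmod (t - w).
Proof. by rewrite -[z - w](_ : (z - t) + (t - w) = _) ?cmodD //; ring. Qed.
Lemma cmod_sum (I : Type) (s : seq I) (F : I -> R[i]) :
  cmod (\sum_(i <- s) F i) <= \sum_(i <- s) cmod (F i).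
Proof.
elim/big_ind2: _ => [|x1 x2 y1 y2 h1 h2|//]; first by rewrite cmod0.
exact: le_trans (cmodD _ _) (lerD h1 h2).
Qed.
Lemma cmodX z n : cmod (z ^+ n) = cmod z ^+ n.
Proof. by elim: n => [|n ih]; rewrite ?expr0 ?cmod1 // !exprS cmodM ih. Qed.
Lemma cmod_nat n : cmod (n%:R : R[i]) = n%:R.
Proof. by rewrite -(rmorph_nat (real_complex R)) cmodC normr_nat. Qed.
Lemma cmodV z : cmod z^-1 = (cmod z)^-1.
Proof. by apply: (@complexI R); rewrite fmorphV /= !cmodE normfV. Qed.
Lemma cmod_Re z : `|cRe z| <= cmod z.
Proof. by rewrite -sqrtr_sqr ler_wsqrtr // lerDl sqr_ge0. Qed.
Lemma cmod_Im z : `|cIm z| <= cmod z.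
Proof. by rewrite -sqrtr_sqr ler_wsqrtr // lerDr sqr_ge0. Qed.
Lemma cmod_ReIm z : cmod z <= `|cRe z| + `|cIm z|.
Proof.
rewrite -[leRHS]ger0_norm ?addr_ge0 // -[leRHS]sqrtr_sqr ler_wsqrtr //.
rewrite /csq sqrrD !real_normK ?num_real //.
have := mulr_ge0 (normr_ge0 (cRe z)) (normr_ge0 (cIm z)); lra.
Qed.
Lemma cmod_le_eq0 z : (forall e, 0 < e -> cmod z <= e) -> z = 0.
Proof.
move=> h; apply: cmod_eq0; apply/eqP; rewrite eq_le cmod_ge0 andbT.
by apply/ler_addgt0Pr => e e0; rewrite add0r h.
Qed.

Lemma expiD (x y : R) : expi (x + y) = expi x * expi y.
Proof. by apply: complex_eqP; rewrite !cReIm /= ?cosD ?sinD //; ring. Qed.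
Lemma expi0 : expi 0 = 1 :> R[i]. Proof. by rewrite /expi cos0 sin0. Qed.
Lemma expiJ (x : R) : (expi x)^* = expi (- x).
Proof. by rewrite /expi cosN sinN. Qed.
Lemma csq_expi (x : R) : csq (expi x) = 1.
Proof. by rewrite /csq /= cos2Dsin2. Qed.
Lemma cmod_expi (x : R) : cmod (expi x) = 1.
Proof. by rewrite /cmod csq_expi sqrtr1. Qed.
Lemma expiN1 (x : R) : expi x * expi (- x) = 1.
Proof. by rewrite -expiD subrr expi0. Qed.
Lemma expi_sum (I : Type) (s : seq I) (F : I -> R) :
  expi (\sum_(i <- s) F i) = \prod_(i <- s) expi (F i).
Proof. by elim/big_rec2: _ => [|i x y _ <-]; rewrite ?expi0 ?expiD. Qed.
Lemma expi_nat (x : R) n : expi (x * n%:R) = expi x ^+ n.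
Proof.
elim: n => [|n ih]; first by rewrite mulr0 expi0 expr0.
by rewrite -natr1 mulrDr mulr1 expiD ih exprSr.
Qed.
Lemma expi_int (x : R) (n : int) : expi x = 1 -> expi (x * n%:~R) = 1.
Proof.
move=> h; have e k : expi (x * k%:R) = 1 by rewrite expi_nat h expr1n.
case: n => n; first exact: e.
by rewrite NegzE mulrNz mulrN -[LHS]mul1r -(e n.+1) expiN1.
Qed.
Lemma expi_2pi : expi (2 * pi) = 1 :> R[i].
Proof. by rewrite /expi mulr_natl cos2pi sin2pi. Qed.
(** By the double-angle formula [cos x = 1] forces [sin (x / 2) = 0], while the sine is positive
    strictly between 0 and pi. *)
Lemma expi_eq1 (x : R) : expi x = 1 -> `|x| < 2 * pi -> x = 0.
Proof.
wlog x0 : x / 0 <= x.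
  move=> h; have [/h//|x0] := leP 0 x.
  move=> e xp; apply/eqP; rewrite -oppr_eq0; apply/eqP/h; rewrite ?normrN //.
    by rewrite oppr_ge0 ltW.
  by rewrite -expiJ e rmorph1.
move=> [e _]; rewrite ger0_norm // => xp; apply/eqP/negPn/negP => xn.
have s : 0 < sin (x / 2).
  by apply: sin_gt0_pi; rewrite ?divr_gt0 ?lt_neqAle ?x0 1?eq_sym ?xn //; lra.
have : cos (x / 2 + x / 2) = 1 by rewrite -splitr.
have := cos2Dsin2 (x / 2); rewrite cosD -!expr2 => a b.
have : 0 < sin (x / 2) ^+ 2 by rewrite exprn_gt0.
lra.
Qed.
End Complex.

(** * Integrals of complex-valued functions *)

Section Integrability.
Variables (R : realType) (d : nat).
Implicit Types (f g h k : fn R d) (a b : R[i]).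

Definition cmeas h := measurable_fun setT (fun x => cRe (h x)) /\
  measurable_fun setT (fun x => cIm (h x)).

Lemma cmeas_cst a : cmeas (fun=> a). Proof. by split; exact: measurable_cst. Qed.

Lemma cmeasD h k : cmeas h -> cmeas k -> cmeas (fun x => h x + k x).
Proof.
move=> [h1 h2] [k1 k2]; split.
  by under eq_fun do rewrite cReD; exact: measurable_funD.
by under eq_fun do rewrite cImD; exact: measurable_funD.
Qed.

Lemma cmeasM h k : cmeas h -> cmeas k -> cmeas (fun x => h x * k x).
Proof.
move=> [h1 h2] [k1 k2]; split.
  by under eq_fun do rewrite cReM; apply: measurable_funB; exact: measurable_funM.
by under eq_fun do rewrite cImM; apply: measurable_funD; exact: measurable_funM.
Qed.

Lemma cmeasJ h : cmeas h -> cmeas (fun x => (h x)^*).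
Proof.
move=> [h1 h2]; split; first by under eq_fun do rewrite cReJ.
by under eq_fun do rewrite cImJ; exact: measurableT_comp.
Qed.

Lemma cmeas_real (h : d.-tuple R -> R) : measurable_fun setT h ->
  cmeas (fun x => (h x)%:C).
Proof. by move=> mh; split => //=; exact: measurable_cst. Qed.

Lemma cmeas_comp h (s : d.-tuple R -> d.-tuple R) :
  measurable_fun setT s -> cmeas h -> cmeas (h \o s).
Proof.
move=> ms [h1 h2]; split.
  exact: (measurableT_comp (f := fun x => cRe (h x))).
exact: (measurableT_comp (f := fun x => cIm (h x))).
Qed.

Lemma cmeas_csq h : cmeas h -> measurable_fun setT (fun x => csq (h x)).
Proof. by case=> h1 h2; apply: measurable_funD; exact: measurable_funX. Qed.

Variable mu : {measure set (d.-tuple R) -> \bar R}.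

Definition rintegrable (u : d.-tuple R -> R) := mu.-integrable setT (EFin \o u).

Lemma rint_dom (u v : d.-tuple R -> R) : measurable_fun setT u -> rintegrable v ->
  (forall x, `|u x| <= v x) -> rintegrable u.
Proof.
move=> mu_ iv uv; apply: le_integrable iv => //; first exact/measurable_EFinP.
by move=> x _ /=; rewrite lee_fin (le_trans (uv x)) // ler_norm.
Qed.

Lemma rintZ (u : d.-tuple R -> R) (c : R) : rintegrable u -> rintegrable (fun x => c * u x).
Proof. by move=> iu; apply: (@integrableZl _ _ _ _ _ _ c (EFin \o u)). Qed.

Lemma rintD (u v : d.-tuple R -> R) : rintegrable u -> rintegrable v -> rintegrable (fun x => u x + v x).
Proof. by move=> iu iv; apply: (@integrableD _ _ _ _ _ _ (EFin \o u) (EFin \o v)). Qed.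

Lemma rint_meas u : rintegrable u -> measurable_fun setT u.
Proof. by move=> /integrableP[/measurable_EFinP]. Qed.

Definition cintegrable h := rintegrable (fun x => cRe (h x)) /\ rintegrable (fun x => cIm (h x)).

Lemma cintg_meas h : cintegrable h -> cmeas h.
Proof. by case=> h1 h2; split; exact: rint_meas. Qed.

Lemma cintg_dom h (v : d.-tuple R -> R) : cmeas h -> rintegrable v ->
  (forall x, cmod (h x) <= v x) -> cintegrable h.
Proof.
move=> [h1 h2] iv hv; split; apply: rint_dom iv _ => // x.
  exact: le_trans (cmod_Re _) (hv x).
exact: le_trans (cmod_Im _) (hv x).
Qed.

Lemma cintgD h k : cintegrable h -> cintegrable k -> cintegrable (fun x => h x + k x).
Proof.
move=> [h1 h2] [k1 k2]; split.
  by under eq_fun do rewrite cReD; exact: rintD.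
by under eq_fun do rewrite cImD; exact: rintD.
Qed.

Lemma cintD h k : cintegrable h -> cintegrable k ->
  cint mu (fun x => h x + k x) = cint mu h + cint mu k.
Proof.
move=> [h1 h2] [k1 k2]; apply: complex_eqP; rewrite cReIm /=.
  by under eq_Rintegral do rewrite cReD; rewrite RintegralD.
by under eq_Rintegral do rewrite cImD; rewrite RintegralD.
Qed.

Lemma cintZ a h : cintegrable h -> cint mu (fun x => a * h x) = a * cint mu h.
Proof.
move=> [h1 h2]; apply: complex_eqP; rewrite cReIm /=.
  under eq_Rintegral do rewrite cReM.
  by rewrite RintegralB ?RintegralZl //; apply: rintZ.
under eq_Rintegral do rewrite cImM.
by rewrite RintegralD ?RintegralZl //; apply: rintZ.
Qed.

Lemma cintJ h : cintegrable h -> cint mu (fun x => (h x)^*) = (cint mu h)^*.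
Proof.
move=> [h1 h2]; apply: complex_eqP; rewrite cReIm /=.
  by under eq_Rintegral do rewrite cReJ.
under eq_Rintegral do rewrite cImJ -mulN1r.
by rewrite RintegralZl // mulN1r.
Qed.

Lemma cint_real (u : d.-tuple R -> R) :
  cint mu (fun x => (u x)%:C) = (Rintegral mu setT u)%:C.
Proof. by apply: complex_eqP => //=; rewrite Rintegral_cst // mul0r. Qed.

Lemma cint0 : cint mu (fun=> 0) = 0.
Proof. by rewrite (cint_real (fun=> 0)) Rintegral_cst // mul0r. Qed.

Lemma cintg0 : cintegrable (fun=> 0).
Proof. by split; exact: integrable0. Qed.

Lemma cintg_sum (I : eqType) (s : seq I) (F : I -> fn R d) :
  (forall i, i \in s -> cintegrable (F i)) -> cintegrable (fun x => \sum_(i <- s) F i x).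
Proof.
elim: s => [|i s ih] hF.
  by under eq_fun do rewrite big_nil; exact: cintg0.
under eq_fun do rewrite big_cons.
apply: cintgD; first by apply: hF; rewrite mem_head.
by apply: ih => j js; apply: hF; rewrite inE js orbT.
Qed.

Lemma cint_sum (I : eqType) (s : seq I) (F : I -> fn R d) :
  (forall i, i \in s -> cintegrable (F i)) ->
  cint mu (fun x => \sum_(i <- s) F i x) = \sum_(i <- s) cint mu (F i).
Proof.
elim: s => [|i s ih] hF.
  by under eq_fun do rewrite big_nil; rewrite big_nil cint0.
have hs j : j \in s -> cintegrable (F j) by move=> js; apply: hF; rewrite inE js orbT.
under eq_fun do rewrite big_cons.
rewrite cintD ?big_cons ?ih //; first by apply: hF; rewrite mem_head.
exact: cintg_sum.
Qed.

End Integrability.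

(** * Square-integrable functions *)

Section SquareIntegrable.
Variables (R : realType) (d : nat) (mu : {measure set (d.-tuple R) -> \bar R}).
Implicit Types (f g h k : fn R d) (a b : R[i]).

Lemma L2P f : L2 mu f <-> cmeas f /\ rintegrable mu (fun x => csq (f x)).
Proof.
split=> [[h1 h2 h3]|[[h1 h2] /integrableP[_ h3]]].
  have mf : cmeas f by [].
  split=> //; apply/integrableP; split; first by apply/measurable_EFinP; exact: cmeas_csq.
  by under eq_integral do rewrite /= ger0_norm ?csq_ge0 //.
split=> //; move: h3.
by under eq_integral do rewrite /= ger0_norm ?csq_ge0 //.
Qed.

Lemma L2_meas f : L2 mu f -> cmeas f. Proof. by case/L2P. Qed.

Lemma L2_dom f (v : d.-tuple R -> R) : cmeas f -> rintegrable mu v ->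
  (forall x, csq (f x) <= v x) -> L2 mu f.
Proof.
move=> mf iv fv; apply/L2P; split=> //; apply: rint_dom iv _; first exact: cmeas_csq.
by move=> x; rewrite ger0_norm ?csq_ge0.
Qed.

Lemma csqD (z w : R[i]) : csq (z + w) <= 2 * csq z + 2 * csq w.
Proof.
rewrite /csq !cReIm.
have := sqr_ge0 (cRe z - cRe w); have := sqr_ge0 (cIm z - cIm w); lra.
Qed.

Lemma csqM (z w : R[i]) : csq (z * w) = csq z * csq w.
Proof. by rewrite !csqE cmodM exprMn. Qed.

Lemma L2D f g : L2 mu f -> L2 mu g -> L2 mu (fun x => f x + g x).
Proof.
move=> /L2P[mf if_] /L2P[mg ig].
apply: (@L2_dom _ (fun x => 2 * csq (f x) + 2 * csq (g x))).
- exact: cmeasD.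
- by apply: rintD; exact: rintZ.
- by move=> x; exact: csqD.
Qed.

Lemma L2M f (m : fn R d) (C : R) : cmeas m -> (forall x, cmod (m x) <= C) ->
  L2 mu f -> L2 mu (fun x => m x * f x).
Proof.
move=> mm mC /L2P[mf if_]; apply: (@L2_dom _ (fun x => C ^+ 2 * csq (f x))).
- exact: cmeasM.
- exact: rintZ.
- move=> x; rewrite csqM ler_wpM2r ?csq_ge0 // csqE ler_sqr ?nnegrE ?cmod_ge0 //.
  exact: le_trans (cmod_ge0 _) (mC x).
Qed.

Lemma L2Z a f : L2 mu f -> L2 mu (fun x => a * f x).
Proof. by apply: (L2M (cmeas_cst _ a)) => x; exact: lexx. Qed.

Lemma L20 : L2 mu (fun=> 0).
Proof.
apply: (@L2_dom _ (fun=> 0)); [exact: cmeas_cst|exact: integrable0|].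
by move=> x; rewrite csqE cmod0 expr0n.
Qed.

Lemma L2N f : L2 mu f -> L2 mu (fun x => - f x).
Proof. by move=> /(L2Z (-1)); under eq_fun do rewrite mulN1r. Qed.

Lemma L2B f g : L2 mu f -> L2 mu g -> L2 mu (fun x => f x - g x).
Proof. by move=> hf hg; apply: L2D => //; exact: L2N. Qed.

Lemma L2_sum (I : eqType) (s : seq I) (F : I -> fn R d) :
  (forall i, i \in s -> L2 mu (F i)) -> L2 mu (fun x => \sum_(i <- s) F i x).
Proof.
elim: s => [|i s ih] hF; first by under eq_fun do rewrite big_nil; exact: L20.
under eq_fun do rewrite big_cons.
apply: L2D; first by apply: hF; rewrite mem_head.
by apply: ih => j js; apply: hF; rewrite inE js orbT.
Qed.

Lemma L2_mul f h : L2 mu f -> L2 mu h -> cintegrable mu (fun x => f x * (h x)^*).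
Proof.
move=> /L2P[mf if_] /L2P[mh ih].
apply: (@cintg_dom _ _ _ _ (fun x => csq (f x) + csq (h x))).
- by apply: cmeasM => //; exact: cmeasJ.
- exact: rintD.
- move=> x; rewrite cmodM cmodJ !csqE.
  have := sqr_ge0 (cmod (f x) - cmod (h x)).
  have := mulr_ge0 (cmod_ge0 (f x)) (cmod_ge0 (h x)); lra.
Qed.

Lemma innerDl f g h : L2 mu f -> L2 mu g -> L2 mu h ->
  inner mu (fun x => f x + g x) h = inner mu f h + inner mu g h.
Proof.
move=> hf hg hh; rewrite /inner -cintD; [|exact: L2_mul..].
by under eq_fun do rewrite mulrDl.
Qed.

Lemma innerZl a f h : L2 mu f -> L2 mu h ->
  inner mu (fun x => a * f x) h = a * inner mu f h.
Proof.
move=> hf hh; rewrite /inner -cintZ; last exact: L2_mul.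
by under eq_fun do rewrite -mulrA.
Qed.

Lemma innerJ f h : L2 mu f -> L2 mu h -> (inner mu f h)^* = inner mu h f.
Proof.
move=> hf hh; rewrite /inner -cintJ; last exact: L2_mul.
by under eq_fun do rewrite cconjM conjCK mulrC.
Qed.

Lemma innerDr f g h : L2 mu f -> L2 mu g -> L2 mu h ->
  inner mu h (fun x => f x + g x) = inner mu h f + inner mu h g.
Proof.
move=> hf hg hh; rewrite -innerJ //; last exact: L2D.
by rewrite innerDl // cconjD !innerJ.
Qed.

Lemma innerZr a f h : L2 mu f -> L2 mu h ->
  inner mu h (fun x => a * f x) = a^* * inner mu h f.
Proof.
move=> hf hh; rewrite -innerJ //; last exact: L2Z.
by rewrite innerZl // cconjM innerJ.
Qed.

Lemma innerNl f h : L2 mu f -> L2 mu h ->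
  inner mu (fun x => - f x) h = - inner mu f h.
Proof. by move=> hf hh; rewrite -mulN1r -innerZl //; under eq_fun do rewrite -mulN1r. Qed.

Lemma innerNr f h : L2 mu f -> L2 mu h ->
  inner mu h (fun x => - f x) = - inner mu h f.
Proof.
move=> hf hh; rewrite -innerJ //; last exact: L2N.
by rewrite innerNl // cconjN innerJ.
Qed.

Lemma innerBl f g h : L2 mu f -> L2 mu g -> L2 mu h ->
  inner mu (fun x => f x - g x) h = inner mu f h - inner mu g h.
Proof. by move=> hf hg hh; rewrite innerDl ?innerNl //; exact: L2N. Qed.

Lemma innerBr f g h : L2 mu f -> L2 mu g -> L2 mu h ->
  inner mu h (fun x => f x - g x) = inner mu h f - inner mu h g.
Proof. by move=> hf hg hh; rewrite innerDr ?innerNr //; exact: L2N. Qed.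

Lemma inner_suml (I : eqType) (s : seq I) (F : I -> fn R d) h : L2 mu h ->
  (forall i, i \in s -> L2 mu (F i)) ->
  inner mu (fun x => \sum_(i <- s) F i x) h = \sum_(i <- s) inner mu (F i) h.
Proof.
move=> hh hF; rewrite /inner -cint_sum; last by move=> i /hF hi; exact: L2_mul.
by under eq_fun do rewrite mulr_suml.
Qed.

Lemma inner_sumr (I : eqType) (s : seq I) (F : I -> fn R d) h : L2 mu h ->
  (forall i, i \in s -> L2 mu (F i)) ->
  inner mu h (fun x => \sum_(i <- s) F i x) = \sum_(i <- s) inner mu h (F i).
Proof.
move=> hh hF; rewrite -innerJ //; last exact: L2_sum.
rewrite inner_suml // cconj_sum; apply: eq_big_seq => i /hF hi.
by rewrite innerJ.
Qed.

Definition nsq f := Rintegral mu setT (fun x => csq (f x)).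

Lemma nsq_ge0 f : 0 <= nsq f.
Proof. by apply: Rintegral_ge0 => x _; exact: csq_ge0. Qed.

Lemma l2norm_sqr f : l2norm mu f ^+ 2 = nsq f.
Proof. by rewrite sqr_sqrtr // nsq_ge0. Qed.

Lemma l2norm_ge0 f : 0 <= l2norm mu f. Proof. exact: sqrtr_ge0. Qed.

Lemma inner_self f : inner mu f f = (nsq f)%:C.
Proof. by rewrite /inner /nsq -cint_real; under eq_fun do rewrite csqJ. Qed.

Lemma nsqZ a f : L2 mu f -> nsq (fun x => a * f x) = csq a * nsq f.
Proof.
move=> hf; apply: (@complexI R); rewrite -inner_self innerZl ?innerZr //; last exact: L2Z.
by rewrite mulrA csqJ inner_self rmorphM.
Qed.

Lemma l2normZ a f : L2 mu f -> l2norm mu (fun x => a * f x) = cmod a * l2norm mu f.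
Proof.
move=> hf; rewrite /l2norm -/(nsq _) nsqZ // sqrtrM ?csq_ge0 //.
Qed.

Lemma nsqD f g : L2 mu f -> L2 mu g ->
  nsq (fun x => f x + g x) = nsq f + nsq g + 2 * cRe (inner mu f g).
Proof.
move=> hf hg; apply: (@complexI R); rewrite -inner_self.
rewrite innerDl ?innerDr //; last exact: L2D.
rewrite !inner_self -[inner mu g f]innerJ //.
by apply: complex_eqP; rewrite !cReIm /=; ring.
Qed.

Lemma nsqB f g : L2 mu f -> L2 mu g ->
  nsq (fun x => f x - g x) = nsq f + nsq g - 2 * cRe (inner mu f g).
Proof.
move=> hf hg; rewrite nsqD //; last exact: L2N.
rewrite innerNr // cReN mulrN; congr (_ + _ - _).
by rewrite /nsq; under [in LHS]eq_fun do rewrite csqE cmodN -csqE.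
Qed.

Lemma cauchy_schwarz f g : L2 mu f -> L2 mu g ->
  cmod (inner mu f g) <= l2norm mu f * l2norm mu g.
Proof.
move=> hf hg; set z := inner mu f g.
(* Subtracting the multiple [t z] of [g], with [t] real, makes the cross term real. The choice
   [t = 1 / nsq g] is optimal; if [nsq g = 0], a large [t] forces [z = 0]. *)
have key (t : R) : 2 * t * csq z <= nsq f + t ^+ 2 * csq z * nsq g.
  have := nsq_ge0 (fun x => f x - (t%:C * z) * g x).
  rewrite nsqB //; last exact: L2Z.
  rewrite nsqZ // innerZr // -/z csqM cReM csqE cmodC real_normK ?num_real //.
  rewrite /csq !cReIm /=; lra.
rewrite -ler_sqr ?nnegrE ?cmod_ge0 ?mulr_ge0 ?l2norm_ge0 // exprMn !l2norm_sqr -csqE.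
have [g0|g0] := eqVneq (nsq g) 0.
  rewrite g0 mulr0 leNgt; apply/negP => z0.
  have := key ((nsq f + 1) / csq z); rewrite g0 mulr0 addr0 mulrA -mulrA.
  have := nsq_ge0 f; rewrite -mulrA mulVf ?gt_eqF //; lra.
have g1 : 0 < nsq g by rewrite lt_neqAle eq_sym g0 nsq_ge0.
have := key (nsq g)^-1.
have -> : (nsq g)^-1 ^+ 2 * csq z * nsq g = (nsq g)^-1 * csq z by field.
move=> h; have : (nsq g)^-1 * csq z <= nsq f by lra.
by rewrite mulrC ler_pdivrMr.
Qed.

Lemma l2normD f g : L2 mu f -> L2 mu g ->
  l2norm mu (fun x => f x + g x) <= l2norm mu f + l2norm mu g.
Proof.
move=> hf hg; rewrite -ler_sqr ?nnegrE ?addr_ge0 ?l2norm_ge0 //.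
rewrite sqrrD !l2norm_sqr nsqD //.
have := cauchy_schwarz hf hg; have := cmod_Re (inner mu f g).
have := ler_norm (cRe (inner mu f g)); lra.
Qed.

Lemma l2normN f : l2norm mu (fun x => - f x) = l2norm mu f.
Proof. by rewrite /l2norm; under eq_fun do rewrite csqE cmodN -csqE. Qed.

Lemma l2normB f g h : L2 mu f -> L2 mu g -> L2 mu h ->
  l2norm mu (fun x => f x - h x) <=
  l2norm mu (fun x => f x - g x) + l2norm mu (fun x => g x - h x).
Proof.
move=> hf hg hh; rewrite (_ : (fun x => f x - h x) = fun x => (f x - g x) + (g x - h x)).
  by apply: l2normD; exact: L2B.
by apply/funext => x; rewrite addrA subrK.
Qed.

Lemma l2normBC f g : l2norm mu (fun x => f x - g x) = l2norm mu (fun x => g x - f x).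
Proof. by rewrite -l2normN; under eq_fun do rewrite opprB. Qed.

Lemma l2norm_le_add f g : L2 mu f -> L2 mu g ->
  l2norm mu f <= l2norm mu (fun x => f x - g x) + l2norm mu g.
Proof.
move=> hf hg; have := l2normD (L2B hf hg) hg.
by under eq_fun do rewrite subrK.
Qed.

Lemma l2norm0 : l2norm mu (fun=> 0) = 0.
Proof.
rewrite (_ : (fun=> 0) = (fun x => 0 * (fun=> 0 : R[i]) x) :> fn R d).
  by rewrite l2normZ ?cmod0 ?mul0r //; exact: L20.
by apply/funext => x; rewrite mul0r.
Qed.

Lemma l2norm_sum (I : eqType) (s : seq I) (F : I -> fn R d) :
  (forall i, i \in s -> L2 mu (F i)) ->
  l2norm mu (fun x => \sum_(i <- s) F i x) <= \sum_(i <- s) l2norm mu (F i).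
Proof.
elim: s => [|i s ih] hF.
  by under eq_fun do rewrite big_nil; rewrite big_nil l2norm0.
have hs j : j \in s -> L2 mu (F j) by move=> js; apply: hF; rewrite inE js orbT.
under eq_fun do rewrite big_cons.
rewrite big_cons; apply: le_trans (l2normD _ _) _.
- by apply: hF; rewrite mem_head.
- exact: L2_sum.
- by rewrite lerD2l ih.
Qed.

Lemma l2norm_le_eq0 f : L2 mu f -> (forall e, 0 < e -> l2norm mu f <= e) ->
  {ae mu, forall x, f x = 0}.
Proof.
move=> hf f0; have [mf if_] := (L2P f).1 hf.
have n0 : nsq f = 0.
  rewrite -l2norm_sqr; apply/eqP; rewrite sqrf_eq0 eq_le l2norm_ge0 andbT.
  by apply/ler_addgt0Pr => e e0; rewrite add0r f0.
have i0 : (\int[mu]_x `|(csq (f x))%:E| = 0)%E.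
  under eq_integral do rewrite /= ger0_norm ?csq_ge0 //.
  move: n0; rewrite /nsq /Rintegral => n0.
  by rewrite -[LHS]fineK ?n0 //; apply: (integrable_fin_num _ if_).
have := (ae_eq_integral_abs mu measurableT _).1 i0.
move=> /(_ _); case; first by apply/measurable_EFinP; exact: cmeas_csq.
move=> N [mN N0 sN]; exists N; split=> // x /= fx; apply: sN => /= h; apply: fx.
have := h I; move=> /= [c0]; apply: cmod_eq0; apply/eqP.
by rewrite -sqrf_eq0 -csqE c0.
Qed.

End SquareIntegrable.

(** * Translation invariance and time-frequency shifts *)

Section Boxes.
Variables (R : realType) (d : nat).
Implicit Types (a b x t : d.-tuple R).

(** Coordinates generate the sigma-algebra on tuples and rays generate the Borel sets of the line,
    so half-spaces suffice. *)
Lemma tuple_sigma_ind (S : set (set (d.-tuple R))) : sigma_algebra setT S ->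
  (forall i (c : R), S [set x | c <= tnth x i]) ->
  forall A, measurable A -> S A.
Proof.
move=> sS hS A; apply: smallest_sub => //= {A}.
move=> A; rewrite -bigcup_seq /= => -[i _ [B mB <-]]; rewrite setTI.
pose C := [set B : set R | S ((fun x => tnth x i) @^-1` B)].
suff : @measurable _ R `<=` C by move/(_ _ mB).
rewrite [X in X `<=` _](RGenCInfty.measurableE R); apply: smallest_sub.
  have [s0 sC sU] := sS; split.
  - by rewrite /C /= preimage_set0.
  - by move=> D /sC; rewrite /C /= !setTD preimage_setC.
  - by move=> F hF; rewrite /C /= preimage_bigcup; exact: sU.
move=> _ [c ->]; rewrite /C /=; have := hS i c; congr S.
by apply/seteqP; split => x /=; rewrite in_itv /= andbT.
Qed.

Definition box a b : set (d.-tuple R) :=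
  [set x | forall i, tnth a i <= tnth x i < tnth b i].

Lemma measurable_box a b : measurable (box a b).
Proof.
rewrite (_ : box a b = \bigcap_(i in [set: 'I_d])
    ((fun x => tnth x i) @^-1` [set` `[tnth a i, tnth b i[])).
  apply: fin_bigcap_measurable => // i _; rewrite -[X in measurable X]setTI.
  by apply: measurable_tnth => //; exact: measurable_itv.
apply/seteqP; split => x /=.
  by move=> h i _ /=; rewrite in_itv /= h.
by move=> h i; have := h i I; rewrite /= in_itv.
Qed.

Definition cst_tuple (c : R) : d.-tuple R := [tuple c | _ < d].
Definition tadd x t : d.-tuple R := [tuple tnth x i + tnth t i | i < d].
Definition topp t : d.-tuple R := [tuple - tnth t i | i < d].

Lemma tuple_bounded x : exists n : nat, forall i, - n%:R <= tnth x i < n%:R.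
Proof.
have [n hn] : exists n : nat, \sum_i `|tnth x i| < n%:R.
  by exists (Num.truncn (\sum_i `|tnth x i|)).+1; rewrite truncnS_gt.
exists n => i.
have : `|tnth x i| < n%:R.
  apply: le_lt_trans hn; rewrite (bigD1 i) //= lerDl.
  by apply: sumr_ge0.
by rewrite ltr_norml => /andP[/ltW -> ->].
Qed.

Definition boxes := [set A | exists a b, A = box a b].

Lemma box_generated A : measurable A -> <<s boxes >> A.
Proof.
apply: tuple_sigma_ind; first exact: smallest_sigma_algebra.
move=> i c.
(* Only the [i]-th lower bound is [c]; the other sides grow with [n], and the box is empty while
   [n <= c]. *)
pose lo n : d.-tuple R := [tuple if j == i then c else - n%:R | j < d].
rewrite (_ : [set x | _] = \bigcup_n box (lo n) (cst_tuple n%:R)).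
  apply: sigma_algebra_bigcup => n; apply: sub_sigma_algebra.
  by exists (lo n), (cst_tuple n%:R).
apply/seteqP; split => x /=.
  move=> cx; have [n hn] := tuple_bounded x; exists n => // j.
  rewrite !tnth_mktuple; have := hn j; case: eqP => // -> /andP[_ ->].
  by rewrite cx.
by move=> [n _ /(_ i)]; rewrite tnth_mktuple eqxx => /andP[].
Qed.

Lemma boxesI : setI_closed boxes.
Proof.
move=> _ _ [a [b ->]] [a' [b' ->]].
exists [tuple Num.max (tnth a i) (tnth a' i) | i < d],
  [tuple Num.min (tnth b i) (tnth b' i) | i < d].
apply/seteqP; split => x /=.
  move=> [h h'] i; rewrite !tnth_mktuple ge_max lt_min.
  by have /andP[h1 h2] := h i; have /andP[h3 h4] := h' i; apply/andP; split; apply/andP.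
by move=> h; split => i; have := h i; rewrite !tnth_mktuple ge_max lt_min;
  move=> /andP[/andP[h1 h2] /andP[h3 h4]]; apply/andP.
Qed.

Lemma measurable_tsub t : measurable_fun setT (fun x => tsub x t).
Proof.
apply/measurable_fun_tnthP => i.
rewrite (_ : _ \o _ = fun x => tnth x i - tnth t i); last first.
  by apply/funext => x /=; rewrite tnth_mktuple.
apply: measurable_funB => //; exact: measurable_tnth.
Qed.

Lemma tsub_preimage_box t a b :
  (fun x => tsub x t) @^-1` box a b = box (tadd a t) (tadd b t).
Proof.
apply/seteqP; split => x /= h i; have := h i; rewrite !tnth_mktuple.
  by rewrite lerBrDr ltrBlDr.
by rewrite lerBrDr ltrBlDr.
Qed.

Lemma tsub_tsub x t u : tsub (tsub x t) u = tsub x (tadd t u).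
Proof. by apply: eq_from_tnth => i; rewrite !tnth_mktuple opprD addrA. Qed.

Lemma tsubN x t : tsub x (topp t) = tadd x t.
Proof. by apply: eq_from_tnth => i; rewrite !tnth_mktuple opprK. Qed.

Lemma taddC x t : tadd x t = tadd t x.
Proof. by apply: eq_from_tnth => i; rewrite !tnth_mktuple addrC. Qed.

Lemma tsub0 x : tsub x (cst_tuple 0) = x.
Proof. by apply: eq_from_tnth => i; rewrite !tnth_mktuple subr0. Qed.

Lemma dotC x t : dot x t = dot t x.
Proof. by rewrite /dot; apply: eq_bigr => i _; rewrite mulrC. Qed.

Lemma dotDr t x y : dot t (tadd x y) = dot t x + dot t y.
Proof.
by rewrite /dot -big_split /=; apply: eq_bigr => i _; rewrite tnth_mktuple mulrDr.
Qed.

Lemma dotDl t x y : dot (tadd x y) t = dot x t + dot y t.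
Proof. by rewrite dotC dotDr !(dotC t). Qed.

Lemma dotBr t x y : dot t (tsub x y) = dot t x - dot t y.
Proof.
by rewrite /dot -sumrB; apply: eq_bigr => i _; rewrite tnth_mktuple mulrBr.
Qed.

Lemma dotNl t x : dot (topp x) t = - dot x t.
Proof.
by rewrite /dot -sumrN; apply: eq_bigr => i _; rewrite tnth_mktuple mulNr.
Qed.

Lemma dotNr t x : dot t (topp x) = - dot t x.
Proof. by rewrite dotC dotNl dotC. Qed.

Lemma dot0l x : dot (cst_tuple 0) x = 0.
Proof. by rewrite /dot big1 // => i _; rewrite tnth_mktuple mul0r. Qed.

Lemma measurable_dot (t : d.-tuple R) : measurable_fun setT (dot t).
Proof.
apply: measurable_sum => i; apply: measurable_funM => //; exact: measurable_tnth.
Qed.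

Lemma cmeas_expi (u : d.-tuple R -> R) : measurable_fun setT u ->
  cmeas (fun x => expi (u x)).
Proof.
move=> mu_; split.
  apply: (@measurableT_comp _ _ _ _ _ _ (@cos R) setT u) => //.
  by apply: continuous_measurable_fun; exact: continuous_cos.
apply: (@measurableT_comp _ _ _ _ _ _ (@sin R) setT u) => //.
by apply: continuous_measurable_fun; exact: continuous_sin.
Qed.

End Boxes.

(** * Translation invariance of the measure, unitarity of the shifts *)

Section Translation.
Variables (R : realType) (d : nat) (mu : {measure set (d.-tuple R) -> \bar R}).
Hypothesis leb : is_lebesgue mu.
Implicit Types (a b x t w : d.-tuple R) (f g h : fn R d).

Lemma mu_box a b : mu (box a b) = (\prod_(i < d) Num.max 0 (tnth b i - tnth a i))%:E.
Proof. exact: leb. Qed.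

(** [mu] and its image under the translation agree on boxes, an intersection-stable generating
    family containing the exhausting sequence [[-n, n)^d] of finite measure; uniqueness of measures
    does the rest. *)
Lemma mu_tsub t A : measurable A -> mu ((fun x => tsub x t) @^-1` A) = mu A.
Proof.
move=> mA; pose g n : set (d.-tuple R) := box (cst_tuple d (- n%:R)) (cst_tuple d n%:R).
pose nu : {measure set (d.-tuple R) -> \bar R} :=
  pushforward mu (fun x : d.-tuple R => tsub x t).
pose m2 := nu (measurable_tsub t).
suff -> : mu A = m2 A by [].
apply: (@g_sigma_algebra_measure_unique _ _ _ (@boxes R d) _ g _ _ mu m2) => //.
- by move=> _ [a [b ->]]; exact: measurable_box.
- by move=> n; exists (cst_tuple d (- n%:R)), (cst_tuple d n%:R).
- apply/seteqP; split => // x _; have [n hn] := tuple_bounded x.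
  by exists n => // i; rewrite !tnth_mktuple.
- exact: boxesI.
- move=> _ [a [b ->]]; rewrite /m2 /= /pushforward tsub_preimage_box !mu_box.
  congr _%:E; apply: eq_bigr => i _; rewrite !tnth_mktuple; congr Num.max; ring.
- by move=> n; rewrite mu_box ltry.
- exact: box_generated.
Qed.

Lemma ge0_integral_tsub t (F : d.-tuple R -> \bar R) : measurable_fun setT F ->
  (forall x, 0 <= F x)%E -> (\int[mu]_x F (tsub x t) = \int[mu]_x F x)%E.
Proof.
move=> mF F0; have mtsub := measurable_tsub t.
have := ge0_integral_pushforward mtsub mu measurableT mF _ => <- //.
apply: eq_measure_integral => A mA _; exact: mu_tsub.
Qed.

Lemma integral_tsub t (F : d.-tuple R -> \bar R) : measurable_fun setT F ->
  (\int[mu]_x F (tsub x t) = \int[mu]_x F x)%E.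
Proof.
move=> mF; rewrite integralE [RHS]integralE; congr (_ - _)%E.
  rewrite -[RHS](ge0_integral_tsub t) //; last exact: measurable_funepos.
  by apply: eq_integral => x _; rewrite !funeposE.
rewrite -[RHS](ge0_integral_tsub t) //; last exact: measurable_funeneg.
by apply: eq_integral => x _; rewrite !funenegE.
Qed.

Lemma rint_tsub t (u : d.-tuple R -> R) : rintegrable mu u -> rintegrable mu (fun x => u (tsub x t)).
Proof.
move=> iu; have mu_ := rint_meas iu; move/integrableP: (iu) => [m1 i1].
apply/integrableP; split.
  apply/measurable_EFinP; apply: (@measurableT_comp _ _ _ _ _ _ u) => //.
  exact: measurable_tsub.
rewrite -(ge0_integral_tsub t) // in i1; exact: measurableT_comp.
Qed.

Lemma Rintegral_tsub t (u : d.-tuple R -> R) : measurable_fun setT u ->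
  Rintegral mu setT (fun x => u (tsub x t)) = Rintegral mu setT u.
Proof.
move=> mu_; have mE := (measurable_EFinP setT u).2 mu_.
by congr fine; rewrite (integral_tsub t mE).
Qed.

Lemma cintg_tsub t h : cintegrable mu h -> cintegrable mu (fun x => h (tsub x t)).
Proof. by case=> h1 h2; split; [exact: rint_tsub h1|exact: rint_tsub h2]. Qed.

Lemma cint_tsub t h : cmeas h -> cint mu (fun x => h (tsub x t)) = cint mu h.
Proof.
move=> [h1 h2]; rewrite /cint; congr (_ +i* _).
  exact: (Rintegral_tsub t h1).
exact: (Rintegral_tsub t h2).
Qed.

Lemma L2_tsub t f : L2 mu f -> L2 mu (fun x => f (tsub x t)).
Proof.
move=> /L2P[mf if_]; apply/L2P; split; last exact: rint_tsub if_.
by apply: (cmeas_comp (s := fun x => tsub x t)) => //; exact: measurable_tsub.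
Qed.

Lemma cmeas_char w : cmeas (fun x : d.-tuple R => expi (dot w x)).
Proof. by apply: cmeas_expi; exact: measurable_dot. Qed.

Lemma L2_char w f : L2 mu f -> L2 mu (fun x => expi (dot w x) * f x).
Proof. by apply: (@L2M _ _ _ _ _ 1); [exact: cmeas_char|move=> x; rewrite cmod_expi]. Qed.

Lemma L2_U t w f : L2 mu f -> L2 mu (U t w f).
Proof. by move=> hf; apply: (L2_char w); exact: L2_tsub. Qed.

Lemma inner_U t w f h : L2 mu f -> L2 mu h ->
  inner mu (U t w f) (U t w h) = inner mu f h.
Proof.
move=> hf hh; rewrite /inner -[RHS](cint_tsub t); last exact: cintg_meas (L2_mul hf hh).
congr cint; apply/funext => x; rewrite /U cconjM mulrACA csqJ csq_expi.
by rewrite rmorph1 mul1r.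
Qed.

Lemma l2norm_U t w f : L2 mu f -> l2norm mu (U t w f) = l2norm mu f.
Proof.
move=> hf; rewrite /l2norm -/(nsq mu _) -/(nsq mu f); congr Num.sqrt.
by apply: (@complexI R); rewrite -!inner_self inner_U.
Qed.

End Translation.

(** * Commutation relations of the time-frequency shifts *)

Section TimeFrequency.
Variables (R : realType) (d : nat).
Implicit Types (t w s v : d.-tuple R) (f : fn R d).

Lemma UU t w s v f :
  U t w (U s v f) = fun x => expi (- dot v t) * U (tadd t s) (tadd w v) f x.
Proof.
apply/funext => x; rewrite /U tsub_tsub dotBr dotDl !expiD; ring.
Qed.

(** Both orders give the same shift up to a phase; the quotient of the two phases is the symplectic
    form of [(t, w)] and [(s, v)]. *)
Lemma U_comm t w s v f :
  U t w (U s v f) = fun x => expi (dot w s - dot v t) * U s v (U t w f) x.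
Proof.
apply/funext => x; rewrite !UU mulrA -expiD (taddC s) (taddC v).
by congr (expi _ * _); ring.
Qed.

Lemma U0 f : U (cst_tuple d 0) (cst_tuple d 0) f = f.
Proof. by apply/funext => x; rewrite /U dot0l expi0 mul1r tsub0. Qed.

Lemma UZ t w (a : R[i]) f : U t w (fun x => a * f x) = fun x => a * U t w f x.
Proof. by apply/funext => x; rewrite /U mulrCA. Qed.

Lemma UB t w f g : U t w (fun x => f x - g x) = fun x => U t w f x - U t w g x.
Proof. by apply/funext => x; rewrite /U mulrBr. Qed.

Lemma U_sum t w (I : Type) (r : seq I) (F : I -> fn R d) :
  U t w (fun x => \sum_(i <- r) F i x) = fun x => \sum_(i <- r) U t w (F i) x.
Proof. by apply/funext => x; rewrite /U mulr_sumr. Qed.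

End TimeFrequency.

(** * Averages over boxes of the integer lattice *)

Section Averages.
Variables (R : realType) (d : nat).
Implicit Types (M N : nat) (phi psi : d.-tuple int * d.-tuple int -> R[i]).

(** Coding the box [[-M, M]^d] by finite functions lets sums of products over it factor by
    distributivity. *)
Definition shift_tuple M (f : {ffun 'I_d -> 'I_(2 * M + 1)}) : d.-tuple int :=
  [tuple (f i)%:Z - M%:Z | i < d].

Lemma shift_tuple_inj M : injective (@shift_tuple M).
Proof.
move=> f g h; apply/ffunP => i; apply: val_inj.
have := congr1 (fun t => tnth t i) h; rewrite !tnth_mktuple => /addIr; by case.
Qed.

Definition boxseq M : seq (d.-tuple int) :=
  [seq shift_tuple f | f <- enum {ffun 'I_d -> 'I_(2 * M + 1)}].

Lemma boxseq_uniq M : uniq (boxseq M).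
Proof. by rewrite map_inj_uniq ?enum_uniq //; exact: shift_tuple_inj. Qed.

Lemma size_boxseq M : size (boxseq M) = ((2 * M + 1) ^ d)%N.
Proof. by rewrite size_map -cardE card_ffun !card_ord. Qed.

Lemma mem_boxseq M (m : d.-tuple int) :
  (m \in boxseq M) = [forall i, `|tnth m i| <= M%:Z].
Proof.
apply/idP/forallP => [/mapP[f _ ->] i|h].
  by rewrite tnth_mktuple; have := ltn_ord (f i); move: (nat_of_ord _) => k; lia.
have hk i : (`|(tnth m i + M%:Z)%R| < 2 * M + 1)%N by have := h i; lia.
apply/mapP; exists [ffun i => Ordinal (hk i)]; first by rewrite mem_enum.
apply: eq_from_tnth => i; rewrite tnth_mktuple ffunE /=; have := h i; lia.
Qed.

Lemma boxseqE M : [set` boxseq M] = @boxZ d M.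
Proof.
apply/seteqP; split=> m /=; rewrite /boxZ /= mem_boxseq; first by move/forallP.
by move=> h; apply/forallP.
Qed.

Lemma boxZ_sum M (V : nmodType) (F : d.-tuple int -> V) :
  \sum_(m \in @boxZ d M) F m = \sum_(m <- boxseq M) F m.
Proof. by rewrite -boxseqE -fsbig_seq ?boxseq_uniq. Qed.

Lemma boxseq_prod M (F : 'I_d -> int -> R[i]) :
  \sum_(m <- boxseq M) \prod_i F i (tnth m i) =
  \prod_i \sum_(j < 2 * M + 1) F i (j%:Z - M%:Z).
Proof.
rewrite bigA_distr_bigA big_map big_enum /=; apply: eq_bigr => f _.
by apply: eq_bigr => i _; rewrite tnth_mktuple.
Qed.

Definition avg phi M N : R[i] :=
  (((2 * M + 1) ^ d * (2 * N + 1) ^ d)%N%:R)^-1 *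
  \sum_(m <- boxseq M) \sum_(n <- boxseq N) phi (m, n).

Lemma avg_sum (I : Type) (s : seq I) (a : I -> R[i]) (F : I -> _ -> R[i]) M N :
  avg (fun k => \sum_(i <- s) a i * F i k) M N = \sum_(i <- s) a i * avg (F i) M N.
Proof.
rewrite /avg; under eq_bigr do rewrite exchange_big /=.
rewrite exchange_big /= mulr_sumr; apply: eq_bigr => i _.
rewrite mulrCA; congr (_ * _); rewrite mulr_sumr; apply: eq_bigr => m _.
by rewrite mulr_sumr.
Qed.

Lemma avg_bound phi M N (C : R) : (forall k, cmod (phi k) <= C) ->
  cmod (avg phi M N) <= C.
Proof.
move=> hC; rewrite /avg cmodM cmodV cmod_nat ler_pdivrMl; last first.
  by rewrite ltr0n muln_gt0 !expn_gt0 !addn1.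
apply: le_trans (cmod_sum _ _) _.
apply: le_trans (ler_sum _ (fun m _ => cmod_sum (boxseq N) _)) _.
apply: le_trans (ler_sum _ (fun m _ => ler_sum _ (fun n _ => hC (m, n)))) _.
rewrite !big_const_seq !count_predT !iter_addr_0 !size_boxseq -mulrnA mulr_natl.
by rewrite [X in _ <= _ *+ X]mulnC.
Qed.

Lemma avgB phi psi M N : avg phi M N - avg psi M N = avg (fun k => phi k - psi k) M N.
Proof.
rewrite /avg -mulrBr -sumrB; congr (_ * _); apply: eq_bigr => m _.
by rewrite -sumrB.
Qed.

Lemma dlim_cst (c : R[i]) (a : nat -> nat -> R[i]) :
  (forall M N, a M N = c) -> double_lim a c.
Proof.
by move=> h e e0; exists 0%N => M N _ _; rewrite h subrr cmod0 ltW.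
Qed.

Lemma dlimD (a b : nat -> nat -> R[i]) (l m : R[i]) :
  double_lim a l -> double_lim b m -> double_lim (fun M N => a M N + b M N) (l + m).
Proof.
move=> ha hb e e0; have e2 : 0 < e / 2 by rewrite divr_gt0.
have [K1 h1] := ha _ e2; have [K2 h2] := hb _ e2.
exists (maxn K1 K2) => M N; rewrite !geq_max => /andP[M1 M2] /andP[N1 N2].
rewrite opprD addrACA (splitr e); apply: le_trans (cmodD _ _) _.
by apply: lerD; [exact: h1|exact: h2].
Qed.

Lemma dlimZ (c : R[i]) (a : nat -> nat -> R[i]) (l : R[i]) :
  double_lim a l -> double_lim (fun M N => c * a M N) (c * l).
Proof.
move=> ha e e0; have c0 : 0 < cmod c + 1 by have := cmod_ge0 c; lra.
have [K h] := ha _ (divr_gt0 e0 c0); exists K => M N KM KN.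
rewrite -mulrBr cmodM; apply: le_trans (_ : (cmod c + 1) * (e / (cmod c + 1)) <= _).
  by apply: ler_pM; rewrite ?cmod_ge0 ?lerDl //; exact: h.
by rewrite mulrCA divff ?mulr1 // gt_eqF.
Qed.

Lemma dlim_sum (I : Type) (s : seq I) (c : I -> R[i]) (a : I -> nat -> nat -> R[i])
  (l : I -> R[i]) : (forall i, double_lim (a i) (l i)) ->
  double_lim (fun M N => \sum_(i <- s) c i * a i M N) (\sum_(i <- s) c i * l i).
Proof.
move=> h; elim: s => [|i s ih].
  by rewrite big_nil; apply: dlim_cst => M N; rewrite big_nil.
under eq_fun do under eq_fun do rewrite big_cons.
by rewrite big_cons; apply: dlimD => //; exact: dlimZ.
Qed.

Lemma dlim_eq (a b : nat -> nat -> R[i]) (l : R[i]) :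
  (forall M N, a M N = b M N) -> double_lim a l -> double_lim b l.
Proof. by move=> ab ha e /ha[K hK]; exists K => M N; rewrite -ab; exact: hK. Qed.

(** The limit [l] is known beforehand, so uniform approximation by convergent double sequences
    suffices, with three errors of [e / 3]. *)
Lemma dlim_close (a : nat -> nat -> R[i]) (l : R[i]) :
  (forall e : R, 0 < e -> exists b m, [/\ double_lim b m, cmod (m - l) <= e &
    forall M N, cmod (a M N - b M N) <= e]) -> double_lim a l.
Proof.
move=> h e e0; have e3 : 0 < e / 3 by rewrite divr_gt0.
have [b [m [hb ml hab]]] := h _ e3; have [K hK] := hb _ e3.
exists K => M N KM KN; apply: le_trans (cmodB _ _ (b M N)) _.
apply: le_trans (lerD (hab M N) (cmodB _ _ m)) _.
have := hK _ _ KM KN; lra.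
Qed.

Definition dirichlet (x : R) M : R[i] := \sum_(j < 2 * M + 1) expi (x * (j%:Z - M%:Z)%:~R).

Lemma cmod_dirichlet (x : R) M : cmod (dirichlet x M) <= (2 * M + 1)%:R.
Proof.
apply: le_trans (cmod_sum _ _) _.
by under eq_bigr do rewrite cmod_expi; rewrite sumr_const card_ord.
Qed.

Lemma dirichlet1 (x : R) M : expi x = 1 -> dirichlet x M = (2 * M + 1)%:R.
Proof.
move=> x1; rewrite /dirichlet; under eq_bigr do rewrite expi_int //.
by rewrite sumr_const card_ord.
Qed.

(** After removal of the phase [expi (- (x M))] the sum is geometric; its bound does not depend on
    [M], so its mean tends to 0. *)
Lemma dirichlet_bound (x : R) M : expi x != 1 ->
  cmod (dirichlet x M) <= 2 / cmod (expi x - 1).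
Proof.
move=> x1; have c0 : 0 < cmod (expi x - 1).
  rewrite lt_neqAle cmod_ge0 andbT eq_sym; apply: contra x1 => /eqP/cmod_eq0/eqP.
  by rewrite subr_eq0.
rewrite ler_pdivlMr // -cmodM.
have -> : dirichlet x M = expi (- (x * M%:R)) * \sum_(j < 2 * M + 1) expi x ^+ j.
  rewrite mulr_sumr; apply: eq_bigr => j _.
  by rewrite -expi_nat -expiD intrB; congr expi; ring.
rewrite -mulrA [X in cmod (_ * X)]mulrC -subrX1.
rewrite cmodM cmod_expi mul1r; apply: le_trans (cmodD _ _) _.
by rewrite cmodN cmod1 cmodX cmod_expi expr1n.
Qed.

Lemma dirichlet_avg (x : R) : expi x != 1 -> forall e, 0 < e ->
  exists K, forall M, (K <= M)%N -> cmod (dirichlet x M / (2 * M + 1)%:R) <= e.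
Proof.
move=> x1 e e0; set C := 2 / cmod (expi x - 1).
exists (Num.truncn (C / e)).+1 => M KM.
rewrite cmodM cmodV cmod_nat ler_pdivrMr ?ltr0n ?addn1 //.
apply: le_trans (dirichlet_bound M x1) _; rewrite -/C -ler_pdivrMl // mulrC.
apply: le_trans (ltW (truncnS_gt _)) _; rewrite ler_nat (leq_trans KM) //.
by rewrite mul2n -addnn -addnS leq_addr.
Qed.

Definition lin (a : d.-tuple R) (m : d.-tuple int) : R :=
  \sum_i tnth a i * (tnth m i)%:~R.

Lemma avg_expi (a b : d.-tuple R) M N :
  avg (fun k => expi (lin a k.1 + lin b k.2)) M N =
  (\prod_i (dirichlet (tnth a i) M / (2 * M + 1)%:R)) *
  (\prod_i (dirichlet (tnth b i) N / (2 * N + 1)%:R)).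
Proof.
rewrite /avg /lin /=; under eq_bigr do under eq_bigr do rewrite expiD !expi_sum.
under eq_bigr do rewrite -mulr_sumr.
rewrite -mulr_suml (boxseq_prod M (fun i z => expi (tnth a i * z%:~R))).
rewrite (boxseq_prod N (fun i z => expi (tnth b i * z%:~R))).
rewrite !big_split /= !prodr_const !card_ord natrM !natrX invfM !exprVn.
by rewrite mulrACA; congr (_ * _); rewrite mulrC.
Qed.

(** The mean of a character is a product of one-dimensional means, all of modulus at most 1. One
    nontrivial coordinate drives the product to 0, whatever the others do. *)
Lemma dlim_expi (a b : d.-tuple R) :
  double_lim (avg (fun k => expi (lin a k.1 + lin b k.2)))
  ([forall i, (expi (tnth a i) == 1) && (expi (tnth b i) == 1)]%:R).
Proof.
have le1 x M : cmod (dirichlet x M / (2 * M + 1)%:R) <= 1.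
  rewrite cmodM cmodV cmod_nat ler_pdivrMr ?ltr0n ?addn1 // mul1r -addn1.
  exact: cmod_dirichlet.
have prod1 (c : d.-tuple R) M (P : pred 'I_d) :
    cmod (\prod_(i | P i) (dirichlet (tnth c i) M / (2 * M + 1)%:R)) <= 1.
  elim/big_ind: _ => [|x y hx hy|i _]; rewrite ?cmod1 // cmodM.
  by apply: mulr_ile1; rewrite ?cmod_ge0.
have small (c : d.-tuple R) i : expi (tnth c i) != 1 -> forall e, 0 < e ->
    exists K, forall M, (K <= M)%N ->
    cmod (\prod_i (dirichlet (tnth c i) M / (2 * M + 1)%:R)) <= e.
  move=> ci e e0; have [K hK] := dirichlet_avg ci e0; exists K => M KM.
  rewrite (bigD1 i) //= cmodM -[e]mulr1; apply: ler_pM; rewrite ?cmod_ge0 //.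
  exact: hK.
case: (boolP [forall i, _]) => [/forallP h|].
  apply: dlim_cst => M N; rewrite avg_expi !big1 ?mulr1 // => i _;
    have /andP[/eqP ha /eqP hb] := h i; rewrite dirichlet1 // divff //;
    by rewrite pnatr_eq0 addn1.
rewrite negb_forall; case/existsP => i; rewrite negb_and; case/orP => hi e e0;
  have [K hK] := small _ _ hi _ e0; exists K => M N KM KN;
  rewrite avg_expi subr0 cmodM.
  by rewrite -[e]mulr1; apply: ler_pM; rewrite ?cmod_ge0 ?prod1 // hK.
by rewrite -[e]mul1r; apply: ler_pM; rewrite ?cmod_ge0 ?prod1 // hK.
Qed.

End Averages.

(** * Trigonometric polynomials of time-frequency shifts *)

Section Indicator.
Variables (R : realType) (d : nat) (mu : {measure set (d.-tuple R) -> \bar R}).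

Definition ind (A : set (d.-tuple R)) : fn R d := fun x => (\1_A x)%:C.

Lemma csq_ind A x : csq (ind A x) = \1_A x.
Proof.
by rewrite csqE cmodC indicE; case: (_ \in _); rewrite ?normr1 ?normr0 ?expr1n ?expr0n.
Qed.

Lemma ind_sqr A x : ind A x * ind A x = ind A x.
Proof. by rewrite /ind indicE; case: (_ \in _); rewrite ?mulr1 ?mulr0. Qed.

Lemma indJ A x : (ind A x)^* = ind A x.
Proof. exact: conjc_real. Qed.

Lemma cmod_ind A x : cmod (ind A x) <= 1.
Proof. by rewrite cmodC indicE; case: (_ \in _); rewrite ?normr1 ?normr0. Qed.

Lemma cmeas_ind A : measurable A -> cmeas (ind A).
Proof. by move=> mA; apply: cmeas_real; exact: measurable_indic. Qed.

Lemma rint_ind A : measurable A -> (mu A < +oo)%E -> rintegrable mu (\1_A).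
Proof.
move=> mA fA; apply/integrableP; split.
  by apply/measurable_EFinP; exact: measurable_indic.
under eq_integral do rewrite /= ger0_norm //.
by rewrite integral_indic // setIT.
Qed.

Lemma L2_ind A : measurable A -> (mu A < +oo)%E -> L2 mu (ind A).
Proof.
move=> mA fA; apply: (L2_dom _ (rint_ind mA fA)); first exact: cmeas_ind.
by move=> x; rewrite csq_ind.
Qed.

Lemma nsq_ind A : measurable A -> nsq mu (ind A) = fine (mu A).
Proof.
move=> mA; rewrite /nsq /Rintegral; under eq_integral do rewrite csq_ind.
by rewrite integral_indic // setIT.
Qed.

Lemma L2_indM A f : measurable A -> L2 mu f -> L2 mu (fun x => ind A x * f x).
Proof. by move=> mA; apply: (L2M (cmeas_ind mA)) => x; exact: cmod_ind. Qed.

End Indicator.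

(** * Finite sums of shifts: products, coefficient at zero, Gabor averages *)

Section Polynomials.
Variables (R : realType) (d : nat).
Implicit Types (P Q : seq (R[i] * (d.-tuple R * d.-tuple R))) (f g h : fn R d).
Implicit Types (l : d.-tuple R * d.-tuple R).

Local Notation tf_poly := (seq (R[i] * (d.-tuple R * d.-tuple R))).

Definition l0 : d.-tuple R * d.-tuple R := (cst_tuple d 0, cst_tuple d 0).
Definition ladd l l' := (tadd l.1 l'.1, tadd l.2 l'.2).
Definition Ul l f := U l.1 l.2 f.
Definition polyop P : Op R d := fun f x => \sum_(p <- P) p.1 * Ul p.2 f x.
(** A list may repeat a shift, so the coefficient at zero is a sum over all its occurrences. *)
Definition zcoef P : R[i] := \sum_(p <- P) p.1 * (p.2 == l0)%:R.
(** The phase is the cocycle of [UU], which makes [polyop] turn this product into composition. *)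
Definition mulP P Q : tf_poly :=
  [seq (p.1 * q.1 * expi (- dot q.2.2 p.2.1), ladd p.2 q.2) | p <- P, q <- Q].
Definition scaleP (a : R[i]) P : tf_poly := [seq (a * p.1, p.2) | p <- P].

Lemma polyop_mul P Q f : polyop (mulP P Q) f = polyop P (polyop Q f).
Proof.
apply/funext => x; rewrite /polyop big_allpairs_dep /=; apply: eq_bigr => p _.
rewrite /Ul U_sum mulr_sumr; apply: eq_bigr => q _.
rewrite /= UZ UU; ring.
Qed.

Lemma polyop_cat P Q f x : polyop (P ++ Q) f x = polyop P f x + polyop Q f x.
Proof. exact: big_cat. Qed.

Lemma polyop_scale a P f x : polyop (scaleP a P) f x = a * polyop P f x.
Proof.
by rewrite /polyop big_map mulr_sumr; apply: eq_bigr => p _; rewrite /= mulrA.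
Qed.

Lemma zcoef_cat P Q : zcoef (P ++ Q) = zcoef P + zcoef Q.
Proof. exact: big_cat. Qed.

Lemma zcoef_scale a P : zcoef (scaleP a P) = a * zcoef P.
Proof.
by rewrite /zcoef big_map mulr_sumr; apply: eq_bigr => p _; rewrite /= mulrA.
Qed.

Lemma ladd_eq0 l l' : ladd l l' = l0 -> l' = (topp l.1, topp l.2).
Proof.
move=> h; rewrite [l']surjective_pairing; congr (_, _); apply: eq_from_tnth => i.
  have := congr1 (fun z => tnth z.1 i) h; rewrite !tnth_mktuple; lra.
have := congr1 (fun z => tnth z.2 i) h; rewrite !tnth_mktuple; lra.
Qed.

(* If [l + l' = 0], the two commutation phases are equal, since [l' = - l]. *)
Lemma zcoef_mulC P Q : zcoef (mulP P Q) = zcoef (mulP Q P).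
Proof.
rewrite /zcoef !big_allpairs_dep exchange_big /=; apply: eq_bigr => q _.
apply: eq_bigr => p _ /=.
have -> : ladd q.2 p.2 = ladd p.2 q.2 by rewrite /ladd !(taddC (fst q.2)) !(taddC (snd q.2)).
case: eqP => [/ladd_eq0 ->|_]; last by rewrite !mulr0.
by rewrite !mulr1 /= dotNl dotNr (mulrC q.1).
Qed.

Lemma polyopB P f g : polyop P (fun x => f x - g x) = fun x => polyop P f x - polyop P g x.
Proof.
apply/funext => x; rewrite /polyop -sumrB; apply: eq_bigr => p _.
by rewrite /Ul UB mulrBr.
Qed.

Definition norm1 P : R := \sum_(p <- P) cmod p.1.

Lemma norm1_ge0 P : 0 <= norm1 P.
Proof. by apply: sumr_ge0 => p _; exact: cmod_ge0. Qed.

Variable mu : {measure set (d.-tuple R) -> \bar R}.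
Hypothesis leb : is_lebesgue mu.

Lemma L2_Ul l f : L2 mu f -> L2 mu (Ul l f). Proof. exact: L2_U. Qed.

Lemma L2_polyop P f : L2 mu f -> L2 mu (polyop P f).
Proof.
by move=> hf; apply: (@L2_sum _ _ _ _ P (fun p x => p.1 * Ul p.2 f x)) => p _;
  apply: L2Z; exact: L2_Ul.
Qed.

Lemma l2norm_polyop P f : L2 mu f -> l2norm mu (polyop P f) <= norm1 P * l2norm mu f.
Proof.
move=> hf; apply: le_trans (l2norm_sum (F := fun p x => p.1 * Ul p.2 f x) _) _.
  by move=> p _; apply: L2Z; exact: L2_Ul.
rewrite mulr_suml; apply: ler_sum => p _.
by rewrite l2normZ ?l2norm_U //; exact: L2_Ul.
Qed.

Variables (alpha beta : R).

Definition fphase l : d.-tuple R := [tuple - (2 * pi * alpha * tnth l.1 i) | i < d].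
Definition tphase l : d.-tuple R := [tuple beta * tnth l.2 i | i < d].
(** Membership in the adjoint lattice: [chi l] is the character of Z^{2d} by which [Ul l] fails to
    commute with the lattice shifts, and the condition says that it is trivial on the generators. *)
Definition adj l := [forall i, (expi (tnth (fphase l) i) == 1) && (expi (tnth (tphase l) i) == 1)].
Definition chi l (k : d.-tuple int * d.-tuple int) : R[i] :=
  expi (lin (fphase l) k.1 + lin (tphase l) k.2).

Lemma Ul_gab l g k : Ul l (gab alpha beta g k) =
  fun x => chi l k * gab alpha beta (Ul l g) k x.
Proof.
rewrite /Ul /gab U_comm; apply/funext => x; congr (expi _ * _).
rewrite addrC /lin /dot; congr (_ + _).
  by rewrite -sumrN; apply: eq_bigr => i _; rewrite !tnth_mktuple; ring.
by apply: eq_bigr => i _; rewrite !tnth_mktuple; ring.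
Qed.

Lemma L2_gab g k : L2 mu g -> L2 mu (gab alpha beta g k). Proof. exact: L2_U. Qed.

Lemma l2norm_gab g k : L2 mu g -> l2norm mu (gab alpha beta g k) = l2norm mu g.
Proof. exact: l2norm_U. Qed.

Lemma polyop_gab P g k : polyop P (gab alpha beta g k) =
  gab alpha beta (fun x => \sum_(p <- P) (p.1 * chi p.2 k) * Ul p.2 g x) k.
Proof.
rewrite /polyop [RHS]U_sum; apply/funext => x; apply: eq_bigr => p _.
by rewrite Ul_gab UZ mulrA.
Qed.

(** The common shift by [k] disappears by unitarity, so [k] survives only in the characters, whose
    means are known. *)
Lemma inner_polyop_gab P g h k : L2 mu g -> L2 mu h ->
  inner mu (polyop P (gab alpha beta g k)) (gab alpha beta h k) =
  \sum_(p <- P) (p.1 * inner mu (Ul p.2 g) h) * chi p.2 k.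
Proof.
move=> hg hh; rewrite polyop_gab inner_U //; last first.
  by apply: L2_sum => p _; apply: L2Z; exact: L2_Ul.
rewrite inner_suml //; last by move=> p _; apply: L2Z; exact: L2_Ul.
apply: eq_bigr => p _.
by rewrite innerZl; [rewrite mulrAC|exact: L2_Ul|exact: hh].
Qed.

Lemma gabor_avgE g h T M N : gabor_avg mu alpha beta g h T M N =
  avg (fun k => inner mu (T (gab alpha beta g k)) (gab alpha beta h k)) M N.
Proof.
rewrite /gabor_avg boxZ_sum; congr (_ * _); apply: eq_bigr => m _.
exact: boxZ_sum.
Qed.

Lemma dlim_polyop P g h : L2 mu g -> L2 mu h ->
  double_lim (gabor_avg mu alpha beta g h (polyop P))
    (\sum_(p <- P) p.1 * inner mu (Ul p.2 g) h * (adj p.2)%:R).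
Proof.
move=> hg hh; pose a M N := \sum_(p <- P) p.1 * inner mu (Ul p.2 g) h * avg (chi p.2) M N.
apply: (@dlim_eq _ a).
  move=> M N; rewrite gabor_avgE /a -avg_sum; congr avg; apply/funext => k.
  by rewrite inner_polyop_gab.
by apply: dlim_sum => p; exact: dlim_expi.
Qed.

(** Shifts preserve the norm, so Cauchy-Schwarz bounds every term by the same constant, uniformly in
    [M] and [N]. *)
Lemma gabor_avg_close g h S T M N (C : R) : L2 mu g -> L2 mu h -> 0 <= C ->
  (forall f, L2 mu f -> L2 mu (S f)) -> (forall f, L2 mu f -> L2 mu (T f)) ->
  (forall f, L2 mu f -> l2norm mu (fun x => S f x - T f x) <= C * l2norm mu f) ->
  cmod (gabor_avg mu alpha beta g h S M N - gabor_avg mu alpha beta g h T M N) <=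
  C * (l2norm mu g * l2norm mu h).
Proof.
move=> hg hh C0 LS LT ST; rewrite !gabor_avgE avgB; apply: avg_bound => k.
have gk := L2_gab k hg; have hk := L2_gab k hh.
rewrite -innerBl //; [|exact: LS|exact: LT].
apply: le_trans (cauchy_schwarz _ _) _ => //; first by apply: L2B; [exact: LS|exact: LT].
rewrite mulrA l2norm_gab // ler_wpM2r ?l2norm_ge0 //.
by rewrite -(l2norm_gab k hg) ST.
Qed.

End Polynomials.

(** * The trace *)

Section Trace.
Variables (R : realType) (d : nat) (mu : {measure set (d.-tuple R) -> \bar R}).
Hypothesis leb : is_lebesgue mu.
Implicit Types (P Q : seq (R[i] * (d.-tuple R * d.-tuple R))) (f g h : fn R d).
Implicit Types (l : d.-tuple R * d.-tuple R) (S T : Op R d).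

Lemma adj0 (alpha beta : R) : adj alpha beta (l0 R d).
Proof.
by apply/forallP => i; rewrite !tnth_mktuple !mulr0 oppr0 expi0 eqxx.
Qed.

Lemma pi_ge1 : 1 <= pi :> R.
Proof. have := pi_ge2 R; lra. Qed.

(** [B] exceeds every coordinate of [l] in absolute value. For [r B <= 1] all phases then lie
    strictly between [-2 pi] and [2 pi], where [expi_eq1] applies. *)
Lemma adj_small l : exists2 B : R, 0 < B &
  forall r, 0 < r -> r * B <= 1 -> adj r r l -> l = l0 R d.
Proof.
pose B := 1 + \sum_i (`|tnth l.1 i| + `|tnth l.2 i|).
have S0 (i : 'I_d) : 0 <= `|tnth l.1 i| + `|tnth l.2 i| by rewrite addr_ge0.
have B1 i : `|tnth l.1 i| + `|tnth l.2 i| < B.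
  rewrite /B (bigD1 i) //= addrCA ltrDl.
  by rewrite ltr_wpDr // sumr_ge0.
exists B; first by rewrite /B ltr_wpDr // sumr_ge0.
move=> r r0 rB /forallP ha.
have rs i : r * (`|tnth l.1 i| + `|tnth l.2 i|) < 1.
  by apply: lt_le_trans rB; rewrite ltr_pM2l.
have pi1 := pi_ge1.
rewrite [l]surjective_pairing; congr (_, _); apply: eq_from_tnth => i;
  have /andP[/eqP h1 /eqP h2] := ha i; move: h1 h2; rewrite !tnth_mktuple => h1 h2.
  have := expi_eq1 h1; rewrite normrN !normrM (gtr0_norm (pi_gt0 R)) (gtr0_norm r0).
  rewrite normr_nat => h.
  have : r * `|tnth l.1 i| < 1.
    by have := rs i; have := normr_ge0 (tnth l.2 i); rewrite mulrDr; nra.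
  move=> h'; have /h/eqP : 2 * pi * r * `|tnth l.1 i| < 2 * pi.
    by rewrite -mulrA gtr_pMr // mulr_gt0 // pi_gt0.
  rewrite oppr_eq0 mulf_eq0 => /orP[|/eqP //]; rewrite !mulf_eq0 (gt_eqF r0).
  by rewrite (gt_eqF (pi_gt0 R)) pnatr_eq0.
have := expi_eq1 h2; rewrite normrM (gtr0_norm r0) => h.
have /h/eqP : r * `|tnth l.2 i| < 2 * pi.
  have := rs i; have := normr_ge0 (tnth l.1 i); rewrite mulrDr; nra.
by rewrite mulf_eq0 (gt_eqF r0) => /eqP.
Qed.

Lemma adj_small_seq P : exists2 B : R, 0 < B &
  forall r, 0 < r -> r * B <= 1 -> forall p, p \in P -> adj r r p.2 = (p.2 == l0 R d).
Proof.
elim: P => [|p P [B B0 hB]]; first by exists 1.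
have [C C0 hC] := adj_small p.2; exists (Num.max B C); first by rewrite lt_max B0.
move=> r r0 rB q; rewrite inE => /predU1P[->|qP].
  apply/idP/eqP => [|->]; last exact: adj0.
  by apply: hC => //; apply: le_trans rB; rewrite ler_pM2l // le_max lexx orbT.
by apply: hB => //; apply: le_trans rB; rewrite ler_pM2l // le_max lexx.
Qed.

(** On a fine square lattice no frame is required to isolate the zero coefficient: any window, used
    on both sides, detects it with weight [nsq mu g]. *)
Lemma dlim_polyop_small P g : L2 mu g -> exists2 B : R, 0 < B &
  forall r, 0 < r -> r * B <= 1 ->
  double_lim (gabor_avg mu r r g g (polyop P)) (zcoef P * (nsq mu g)%:C).
Proof.
move=> hg; have [B B0 hB] := adj_small_seq P; exists B => // r r0 rB.
have := dlim_polyop leb r r P hg hg; congr double_lim.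
rewrite /zcoef mulr_suml; apply: eq_big_seq => p /(hB r r0 rB) ->.
case: eqP => [->|_]; last by rewrite !mulr0 mul0r.
by rewrite !mulr1 /Ul U0 inner_self.
Qed.

Lemma dlim_bound (a : nat -> nat -> R[i]) z (C : R) :
  (forall M N, cmod (a M N) <= C) -> double_lim a z -> cmod z <= C.
Proof.
move=> aC ha; apply/ler_addgt0Pr => e e0; have [K hK] := ha e e0.
have := hK K K (leqnn _) (leqnn _); rewrite cmodBC => h.
rewrite -[z](subrK (a K K)) addrC; apply: le_trans (cmodD _ _) _.
exact: lerD.
Qed.

Definition unit_cube : set (d.-tuple R) := box (cst_tuple d 0) (cst_tuple d 1).

Lemma mu_unit_cube : mu unit_cube = 1%E.
Proof.
rewrite (mu_box leb) big1 // => i _; rewrite !tnth_mktuple subr0.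
by rewrite max_r.
Qed.

Lemma L2_unit_cube : L2 mu (ind unit_cube).
Proof. by apply: L2_ind; [exact: measurable_box|rewrite mu_unit_cube ltry]. Qed.

Lemma l2norm_unit_cube : l2norm mu (ind unit_cube) = 1.
Proof.
rewrite /l2norm -/(nsq mu _) nsq_ind; last exact: measurable_box.
by rewrite mu_unit_cube /= sqrtr1.
Qed.

Lemma small_step (B : R) : 0 < B -> exists2 r, 0 < r & r * B <= 1.
Proof. by move=> B0; exists B^-1; rewrite ?invr_gt0 // mulVf // gt_eqF. Qed.

Lemma zcoef_bound P (C : R) :
  (forall f, L2 mu f -> l2norm mu (polyop P f) <= C * l2norm mu f) -> cmod (zcoef P) <= C.
Proof.
move=> hC; have hg := L2_unit_cube.
have [B B0 hB] := dlim_polyop_small P hg; have [r r0 rB] := small_step B0.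
have := hB r r0 rB; rewrite -l2norm_sqr l2norm_unit_cube expr1n mulr1.
apply: dlim_bound => M N; rewrite gabor_avgE; apply: avg_bound => k.
have gk := L2_gab leb r r k hg.
apply: le_trans (cauchy_schwarz _ _) _; [exact: L2_polyop|exact: gk|].
rewrite [X in _ * X <= _](l2norm_gab leb) // l2norm_unit_cube mulr1.
by have := hC _ gk; rewrite (l2norm_gab leb) // l2norm_unit_cube mulr1.
Qed.

Definition approx T (e : R) P :=
  forall f, L2 mu f -> l2norm mu (fun x => T f x - polyop P f x) <= e * l2norm mu f.

Definition L2op T := forall f, L2 mu f -> L2 mu (T f).

Lemma polyop_diff P Q f : polyop (P ++ scaleP (-1) Q) f = fun x => polyop P f x - polyop Q f x.
Proof. by apply/funext => x; rewrite polyop_cat polyop_scale mulN1r. Qed.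

(** The difference of [P] and [Q] is again a finite sum, of operator norm at most [e + e']. This is
    the Cauchy property behind both existence and uniqueness of the trace. *)
Lemma approx_zcoef T e e' P Q : L2op T -> approx T e P -> approx T e' Q ->
  cmod (zcoef P - zcoef Q) <= e + e'.
Proof.
move=> LT hP hQ; rewrite -[_ - _](_ : zcoef (P ++ scaleP (-1) Q) = _); last first.
  by rewrite zcoef_cat zcoef_scale mulN1r.
apply: zcoef_bound => f hf; rewrite polyop_diff mulrDl.
have hT := LT f hf; have oP := L2_polyop leb P hf; have oQ := L2_polyop leb Q hf.
apply: le_trans (l2normB oP hT oQ) _.
by rewrite l2normBC; apply: lerD; [exact: hP f hf|exact: hQ f hf].
Qed.

(** One approximating sum for each [e] is enough: by [approx_zcoef] all the others have nearby zero
    coefficients. *)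
Definition is_gamma T z := forall e : R, 0 < e ->
  exists2 P, approx T e P & cmod (zcoef P - z) <= e.

Lemma is_gamma_uniq T z z' : L2op T -> is_gamma T z -> is_gamma T z' -> z = z'.
Proof.
move=> LT hz hz'; apply/eqP; rewrite -subr_eq0; apply/eqP; apply: cmod_le_eq0 => e e0.
have e4 : 0 < e / 4 by rewrite divr_gt0.
have [P aP cP] := hz _ e4; have [Q aQ cQ] := hz' _ e4.
apply: le_trans (cmodB _ _ (zcoef P)) _.
apply: le_trans (lerD (lexx _) (cmodB _ _ (zcoef Q))) _.
have := approx_zcoef LT aP aQ; rewrite [cmod (z - _)]cmodBC; lra.
Qed.

Lemma approx_le T e e' P : e <= e' -> approx T e P -> approx T e' P.
Proof.
by move=> ee hP f hf; apply: le_trans (hP f hf) _; rewrite ler_wpM2r ?l2norm_ge0.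
Qed.

(** The limit is the supremum of the lower bounds [u n - 1 / (n + 1)], each of which lies below
    every [u m + 1 / (m + 1)]; this gives the explicit rate as well. *)
Lemma cauchy_real (u : nat -> R) :
  (forall n m, u n - u m <= n.+1%:R^-1 + m.+1%:R^-1) ->
  exists l : R, forall n, `|u n - l| <= n.+1%:R^-1.
Proof.
move=> hu; pose E := [set u n - n.+1%:R^-1 | n in setT].
have ub m : ubound E (u m + m.+1%:R^-1).
  by move=> _ [n _ <-]; have := hu n m; move: (_^-1) (_^-1) => a b; lra.
exists (sup E) => n; rewrite ler_distlC; apply/andP; split.
  apply: ub_le_sup; [by exists (u 0%N + 1%:R^-1); exact: ub|by exists n].
by apply: ge_sup; [exists (u 0%N - 1%:R^-1); exists 0%N|exact: ub].
Qed.

Lemma is_gamma_ex T : L2op T ->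
  (forall e, 0 < e -> exists P, approx T e P) -> exists z, is_gamma T z.
Proof.
move=> LT hT.
have n0 n : 0 < n.+1%:R^-1 :> R by rewrite invr_gt0.
have [P hP] := choice (fun n => hT _ (n0 n)).
have dP n m : cmod (zcoef (P n) - zcoef (P m)) <= n.+1%:R^-1 + m.+1%:R^-1.
  exact: approx_zcoef LT (hP n) (hP m).
have [a ha] : exists l : R, forall n, `|cRe (zcoef (P n)) - l| <= n.+1%:R^-1.
  apply: (@cauchy_real (fun n => cRe (zcoef (P n)))) => n m.
  apply: le_trans (dP n m); apply: le_trans (cmod_Re _).
  by rewrite !cReIm ler_norm.
have [b hb] : exists l : R, forall n, `|cIm (zcoef (P n)) - l| <= n.+1%:R^-1.
  apply: (@cauchy_real (fun n => cIm (zcoef (P n)))) => n m.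
  apply: le_trans (dP n m); apply: le_trans (cmod_Im _).
  by rewrite !cReIm ler_norm.
(* With this [n] the real and imaginary errors are at most [e / 2] each. *)
exists (a +i* b) => e e0; pose n := Num.truncn (2 / e).
have ne : n.+1%:R^-1 <= e / 2.
  by rewrite invf_ple ?posrE ?divr_gt0 // invf_div ltW // truncnS_gt.
exists (P n); first by apply: approx_le (hP n); apply: le_trans ne _; lra.
apply: le_trans (cmod_ReIm _) _; rewrite !cReIm /=.
have := ha n; have := hb n; move: (_^-1) ne => r ne; lra.
Qed.

Lemma asum_approx c T : is_Asum mu c T -> forall e, 0 < e ->
  exists2 P, approx T e P & zcoef P = c (l0 R d).
Proof.
move=> [cfin hT] e e0.
set S := (\esum_(_ in _) _)%E in cfin.
have S0 : (0 <= S)%E by apply: esum_ge0 => l _; rewrite lee_fin cmod_ge0.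
have Sfin : S \is a fin_num by rewrite ge0_fin_numE.
have [_ [X [Xf _] <-] SX] := ub_ereal_sup_adherent e0 Sfin.
(* Zero is adjoined so that the zero coefficient of the partial sum is exactly that of the
   series. *)
pose X' := X `|` [set l0 R d].
have X'f : finite_set X' by rewrite finite_setU; split=> //; exact: finite_set1.
pose s := finmap.enum_fset (fset_set X').
have ss l : (l \in s) = (l \in X') by exact: in_fset_set.
exists [seq (c l, l) | l <- s]; last first.
  rewrite /zcoef big_map (bigD1_seq (l0 R d)) /= ?finmap.fset_uniq //; last first.
    by rewrite ss inE; right.
  rewrite eqxx mulr1 big1 ?addr0 // => l ln.
  by rewrite (negbTE ln) mulr0.
move=> f hf; apply/ler_addgt0Pr => e' e'0.
have [LTf /(_ e' e'0) [F0 [F0f hF]]] := hT f hf.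
(* [F0] depends on [f] and [e'], whereas the approximating sum over [X'] must not; what lies in [F1]
   outside [X'] is absorbed by the tail of the coefficients. *)
pose F1 := X' `|` F0.
have F1f : finite_set F1 by rewrite finite_setU.
pose g1 : fn R d := fun x => \sum_(l \in F1) c l * U l.1 l.2 f x.
have hg1 : l2norm mu (fun x => T f x - g1 x) <= e' := hF F1 F1f (@subsetUr _ _ _).
pose D := F1 `&` ~` X'.
have Df : finite_set D by apply: finite_setIl.
pose t := finmap.enum_fset (fset_set D).
have g1E x : g1 x = polyop [seq (c l, l) | l <- s] f x + \sum_(l <- t) c l * Ul l f x.
  rewrite /g1 (fsbigID X') // /F1; congr (_ + _); last by rewrite fsbig_finite.
  by rewrite (setIidr (@subsetUl _ _ _)) fsbig_finite // /polyop big_map.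
have Lop := L2_polyop leb [seq (c l, l) | l <- s] hf.
have Lcl l : L2 mu (fun x => c l * Ul l f x) by apply: L2Z; exact: L2_Ul.
have Lt : L2 mu (fun x => \sum_(l <- t) c l * Ul l f x).
  by apply: (@L2_sum _ _ _ _ t (fun l x => c l * Ul l f x)) => l _.
have Lg1 : L2 mu g1 by rewrite (funext g1E); exact: L2D.
have ct : \sum_(l <- t) cmod (c l) <= e.
  (* [X] already carries all but [e] of the total mass [S], and [D] is disjoint from it. *)
  have XDf : finite_set (X `|` D) by rewrite finite_setU.
  have : (\sum_(l \in X `|` D) (cmod (c l))%:E <= S)%E.
    by apply: esum_ge; exists (X `|` D) => //; split.
  rewrite fsbigU //=; last by move=> l [Xl [_ nX]]; case: nX; left.
  have SX' : fine S - e < \sum_(l \in X) cmod (c l).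
    by rewrite -lte_fin EFinB fineK // -fsumEFin.
  rewrite !fsumEFin // -EFinD -(fineK Sfin) lee_fin.
  by rewrite [X in _ + X <= _]fsbig_finite // -/t; lra.
apply: le_trans (l2normB LTf Lg1 Lop) _; rewrite addrC; apply: lerD => //.
under eq_fun do rewrite g1E addrC addKr.
apply: le_trans (l2norm_sum (F := fun l x => c l * Ul l f x) _) _ => //.
apply: le_trans (_ : (\sum_(l <- t) cmod (c l)) * l2norm mu f <= _); last first.
  by rewrite ler_wpM2r ?l2norm_ge0.
rewrite mulr_suml; apply: ler_sum => l _.
by rewrite l2normZ ?l2norm_U //; exact: L2_Ul.
Qed.

Lemma inA_approx T : inA mu T -> forall e, 0 < e -> exists P, approx T e P.
Proof.
move=> [LT hT] e e0; have e2 : 0 < e / 2 by rewrite divr_gt0.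
have [c [S [cS hS]]] := hT _ e2; have [P hP _] := asum_approx cS e2.
exists P => f hf; have LS : L2 mu (S f) by case: (cS.2 f hf).
apply: le_trans (l2normB (LT f hf) LS (L2_polyop leb P hf)) _.
by rewrite (splitr e) mulrDl; apply: lerD; [exact: hS f hf|exact: hP f hf].
Qed.

(** The value 0 is only a default: for [inA mu T] the set is a singleton, by [is_gamma_ex] and
    [is_gamma_uniq]. *)
Definition gamma T : R[i] := xget 0 [set z | is_gamma T z].

Lemma gammaE T z : L2op T -> is_gamma T z -> gamma T = z.
Proof.
move=> LT hz; apply: (is_gamma_uniq LT _ hz).
by apply: (@xgetPex _ 0 [set z' | is_gamma T z']); exists z.
Qed.

Lemma gammaP T : inA mu T -> is_gamma T (gamma T).
Proof.
move=> AT; apply: (@xgetPex _ 0 [set z | is_gamma T z]).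
by apply: is_gamma_ex; [exact: AT.1|exact: inA_approx].
Qed.

Lemma gamma_asum c T : is_Asum mu c T -> gamma T = c (l0 R d).
Proof.
move=> cT; apply: gammaE => [f hf|e e0]; first by case: (cT.2 f hf).
have [P hP cP] := asum_approx cT e0.
by exists P => //; rewrite cP subrr cmod0 ltW.
Qed.

Lemma gamma_id : gamma id = 1.
Proof.
apply: gammaE => // e e0; exists [:: (1, l0 R d)].
  move=> f hf; rewrite [X in l2norm mu X](_ : _ = fun=> 0).
    by rewrite l2norm0 mulr_ge0 ?l2norm_ge0 // ltW.
  by apply/funext => x; rewrite /polyop big_seq1 /Ul U0 mul1r subrr.
by rewrite /zcoef big_seq1 eqxx mulr1 subrr cmod0 ltW.
Qed.

Lemma gamma_lin S T (a b : R[i]) : inA mu S -> inA mu T ->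
  gamma (fun f x => a * S f x + b * T f x) = a * gamma S + b * gamma T.
Proof.
move=> AS AT; have [LS _] := AS; have [LT _] := AT.
apply: gammaE => [f hf|e e0].
  by apply: L2D; apply: L2Z; [exact: LS|exact: LT].
have c0 : 0 < cmod a + cmod b + 1.
  by have := cmod_ge0 a; have := cmod_ge0 b; lra.
have [e' e'0 e'e] : exists2 e', 0 < e' & cmod a * e' + cmod b * e' <= e.
  exists (e / (cmod a + cmod b + 1)); first exact: divr_gt0.
  rewrite -mulrDl mulrCA -[leRHS]mulr1 ler_pM2l // ler_pdivrMr // mul1r.
  by rewrite lerDl.
have [P hP cP] := gammaP AS e'0; have [Q hQ cQ] := gammaP AT e'0.
exists (scaleP a P ++ scaleP b Q).
  move=> f hf; have hS := LS f hf; have hT := LT f hf.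
  have oP := L2_polyop leb P hf; have oQ := L2_polyop leb Q hf.
  rewrite [X in l2norm mu X](_ : _ = fun x => a * (S f x - polyop P f x) +
      b * (T f x - polyop Q f x)); last first.
    by apply/funext => x; rewrite polyop_cat !polyop_scale; ring.
  apply: le_trans (l2normD _ _) _; [by apply: L2Z; exact: L2B..|].
  rewrite !l2normZ; [|exact: L2B..].
  apply: le_trans (lerD (ler_wpM2l (cmod_ge0 a) (hP f hf))
    (ler_wpM2l (cmod_ge0 b) (hQ f hf))) _.
  by rewrite !mulrA -mulrDl ler_wpM2r ?l2norm_ge0.
rewrite zcoef_cat !zcoef_scale.
rewrite [X in cmod X](_ : _ = a * (zcoef P - gamma S) + b * (zcoef Q - gamma T)); last by ring.
apply: le_trans (cmodD _ _) _; rewrite [cmod (a * _)]cmodM [cmod (b * _)]cmodM.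
apply: le_trans e'e.
exact: lerD (ler_wpM2l (cmod_ge0 a) cP) (ler_wpM2l (cmod_ge0 b) cQ).
Qed.

Lemma inA_bounded T : inA mu T -> exists2 C : R, 0 <= C &
  forall f, L2 mu f -> l2norm mu (T f) <= C * l2norm mu f.
Proof.
move=> AT; have [LT _] := AT; have [P hP] := inA_approx AT ltr01.
exists (1 + norm1 P); first by rewrite addr_ge0 ?norm1_ge0.
move=> f hf; apply: le_trans (l2norm_le_add (LT f hf) (L2_polyop leb P hf)) _.
by rewrite mulrDl; apply: lerD; [exact: hP f hf|exact: l2norm_polyop].
Qed.

(** Split the error as [(S - P) T + P (T - Q)]; being [e]-close to [S], the sum [P] has norm at most
    [CS + e]. *)
Lemma approx_comp S T e CS CT P Q : L2op S -> L2op T -> 0 <= e -> 0 <= CS ->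
  (forall f, L2 mu f -> l2norm mu (S f) <= CS * l2norm mu f) ->
  (forall f, L2 mu f -> l2norm mu (T f) <= CT * l2norm mu f) ->
  approx S e P -> approx T e Q ->
  approx (S \o T) (e * (CT + (CS + e))) (mulP P Q).
Proof.
move=> LS LT e0 CS0 hCS hCT hP hQ f hf; rewrite polyop_mul /=.
have hT := LT f hf; have oQ := L2_polyop leb Q hf; have hTQ := L2B hT oQ.
apply: le_trans (l2normB (LS _ hT) (L2_polyop leb P hT) (L2_polyop leb P oQ)) _.
rewrite mulrDr mulrDl; apply: lerD.
  by apply: le_trans (hP _ hT) _; rewrite -mulrA ler_wpM2l // hCT.
rewrite -polyopB; apply: le_trans (l2norm_le_add (L2_polyop leb P hTQ) (LS _ hTQ)) _.
rewrite l2normBC; apply: le_trans (lerD (hP _ hTQ) (hCS _ hTQ)) _.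
rewrite -mulrDl addrC [e * _]mulrC -mulrA ler_wpM2l ?hQ //.
by rewrite addr_ge0.
Qed.

Lemma approx_comp_small S T : inA mu S -> inA mu T -> forall e, 0 < e ->
  exists P Q, [/\ approx S e P, approx T e Q, approx (S \o T) e (mulP P Q) &
    approx (T \o S) e (mulP Q P)].
Proof.
move=> AS AT e e0; have [LS _] := AS; have [LT _] := AT.
have [CS CS0 hCS] := inA_bounded AS; have [CT CT0 hCT] := inA_bounded AT.
(* The bound [r <= 1] absorbs the quadratic term of [approx_comp] into the summand 1 of
   [CS + CT + 1]. *)
pose r := Num.min 1 (Num.min e (e / (CS + CT + 1))).
have K0 : 0 < CS + CT + 1 by rewrite ltr_wpDl // addr_ge0.
have r0 : 0 < r by rewrite !lt_min ltr01 e0 divr_gt0.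
have r1 : r <= 1 by rewrite ge_min lexx.
have re : r <= e by rewrite !ge_min lexx orbT.
have rK : r * (CS + CT + 1) <= e by rewrite -ler_pdivlMr // !ge_min lexx !orbT.
have [P hP] := inA_approx AS r0; have [Q hQ] := inA_approx AT r0.
exists P, Q; split; [exact: approx_le re hP|exact: approx_le re hQ|..].
  apply: approx_le (approx_comp LS LT (ltW r0) CS0 hCS hCT hP hQ).
  by apply: le_trans rK; rewrite ler_pM2l //; lra.
apply: approx_le (approx_comp LT LS (ltW r0) CT0 hCT hCS hQ hP).
by apply: le_trans rK; rewrite ler_pM2l //; lra.
Qed.

(** Existence of the trace only asks for approximating finite sums, and products of those of the
    factors provide them. *)
Lemma inA_comp_gammaP S T : inA mu S -> inA mu T ->
  is_gamma (S \o T) (gamma (S \o T)).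
Proof.
move=> AS AT; apply: (@xgetPex _ 0 [set z | is_gamma _ z]).
apply: is_gamma_ex => [f hf|e e0]; first by apply: AS.1; exact: AT.1.
by have [P [Q [_ _ h _]]] := approx_comp_small AS AT e0; exists (mulP P Q).
Qed.

Lemma gammaC S T : inA mu S -> inA mu T -> gamma (S \o T) = gamma (T \o S).
Proof.
move=> AS AT; have LTS : L2op (T \o S) by move=> f hf; apply: AT.1; exact: AS.1.
have LST : L2op (S \o T) by move=> f hf; apply: AS.1; exact: AT.1.
apply/esym; apply: gammaE => // e e0; have e4 : 0 < e / 4 by rewrite divr_gt0.
have [P [Q [_ _ h1 h2]]] := approx_comp_small AS AT e4.
exists (mulP Q P); first by apply: approx_le h2; lra.
have [P' h' c'] := inA_comp_gammaP AS AT e4.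
(* The sums approximating the two compositions have equal zero coefficients, so both can be compared
   with the trace of [S \o T]. *)
rewrite -zcoef_mulC; apply: le_trans (cmodB _ _ (zcoef P')) _.
have := approx_zcoef LST h1 h'; lra.
Qed.

End Trace.

(** * Almost periods *)

Section Returns.
Variables (R : realType) (d : nat).
Implicit Types (l : d.-tuple R * d.-tuple R) (k : d.-tuple int * d.-tuple int).

Definition kpairs M N : seq (d.-tuple int * d.-tuple int) :=
  [seq (m, n) | m <- boxseq d M, n <- boxseq d N].

Lemma kpairs_uniq M N : uniq (kpairs M N).
Proof. by apply: allpairs_uniq; rewrite ?boxseq_uniq // => -[? ?] [? ?]. Qed.

Definition isub (m m' : d.-tuple int) : d.-tuple int :=
  [tuple tnth m i - tnth m' i | i < d].

(** Only the corner [[0, M]^d] is used for the pigeonhole, because differences of its points stay in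
    [[-M, M]^d]. *)
Definition nat_tuple M (f : {ffun 'I_d -> 'I_M.+1}) : d.-tuple int :=
  [tuple (f i : nat)%:Z | i < d].

Lemma nat_tuple_inj M : injective (@nat_tuple M).
Proof.
move=> f g h; apply/ffunP => i; apply: val_inj.
by have := congr1 (fun t => tnth t i) h; rewrite !tnth_mktuple => -[].
Qed.

Lemma nat_tuple_sub M (f g : {ffun 'I_d -> 'I_M.+1}) :
  isub (nat_tuple f) (nat_tuple g) \in boxseq d M.
Proof.
rewrite mem_boxseq; apply/forallP => i; rewrite !tnth_mktuple.
by have := ltn_ord (f i); have := ltn_ord (g i); move: (nat_of_ord _) (nat_of_ord _) => a b; lia.
Qed.

Lemma isub_inj m : injective (isub^~ m).
Proof.
move=> x y h; apply: eq_from_tnth => i.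
by have := congr1 (fun t => tnth t i) h; rewrite !tnth_mktuple => /addIr.
Qed.

Lemma lin_isub (a : d.-tuple R) m m' : lin a (isub m m') = lin a m - lin a m'.
Proof.
by rewrite /lin -sumrB; apply: eq_bigr => i _; rewrite tnth_mktuple intrB mulrBr.
Qed.

(** Since [chi] is multiplicative, two points with nearby values yield an almost period, namely
    their difference. *)
Lemma chi_isub (alpha beta : R) l k k' :
  cmod (chi alpha beta l (isub k.1 k'.1, isub k.2 k'.2) - 1) =
  cmod (chi alpha beta l k - chi alpha beta l k').
Proof.
have -> : chi alpha beta l k =
    chi alpha beta l (isub k.1 k'.1, isub k.2 k'.2) * chi alpha beta l k'.
  by rewrite /chi /= -expiD !lin_isub; congr expi; ring.
rewrite -[X in _ = cmod (_ - X)]mul1r -mulrBl [RHS]cmodM.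
by rewrite [X in _ * X]cmod_expi mulr1.
Qed.

(** Take [y] in a largest fibre, which is at least as large as the average one. *)
Lemma pigeonhole (X C : finType) (f : X -> C) (x0 : X) :
  exists y, (#|{: X}| <= #|{: C}| * #|[pred x | f x == f y]|)%N.
Proof.
pose F y := #|[pred x | f x == f y]|.
have [y _ ymax] := @arg_maxnP _ x0 xpredT F isT.
exists y; rewrite -sum1_card (partition_big f predT) //=.
apply: leq_trans (_ : \sum_(c : C) F y <= _)%N; last by rewrite sum_nat_const.
apply: leq_sum => c _; rewrite sum1_card.
have [/existsP[z /eqP <-]|] := boolP [exists z, f z == c]; first exact: ymax.
rewrite negb_exists => /forallP h; rewrite eq_card0 // => x.
by rewrite !inE /=; exact: negbTE (h x).
Qed.

(** Cells of length [1 / K] in [[-1, 1]]; the right endpoint has a cell of its own, hence [2 K + 1]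
    values. *)
Definition digit (K : nat) (c : R) : 'I_(2 * K).+1 := inord (Num.truncn ((1 + c) * K%:R)).

Lemma digit_close (K : nat) (c c' : R) : `|c| <= 1 -> `|c'| <= 1 -> (0 < K)%N ->
  digit K c = digit K c' -> `|c - c'| <= K%:R^-1.
Proof.
rewrite !ler_norml => /andP[c1 c2] /andP[c3 c4] K0.
have K1 : 0 < K%:R :> R by rewrite ltr0n.
have g (t : R) : -1 <= t -> 0 <= (1 + t) * K%:R.
  by move=> t1; apply: mulr_ge0; rewrite ?ler0n //; lra.
have h (t : R) : -1 <= t -> t <= 1 -> (Num.truncn ((1 + t) * K%:R) < (2 * K).+1)%N.
  move=> t1 t2; rewrite (truncn_lt_nat _ (g _ t1)).
  rewrite -addn1 natrD natrM; apply: le_lt_trans (_ : 2 * K%:R < _).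
    by rewrite ler_pM2r //; lra.
  by rewrite ltrDl.
move=> /(congr1 val); rewrite /= !inordK ?h // => e.
have /andP[a1 a2] := truncn_itv (g _ c1); have /andP[b1 b2] := truncn_itv (g _ c3).
rewrite e in a1 a2; move: a1 a2 b1 b2; rewrite -natr1; set n := (Num.truncn _)%:R => *.
have : `|(c - c') * K%:R| <= 1 by rewrite ler_norml; apply/andP; split; lra.
by rewrite -ler_norml normrM (gtr0_norm K1) -ler_pdivlMr // mul1r.
Qed.

Lemma returns_dense (ls : seq (d.-tuple R * d.-tuple R)) (eta : R) : 0 < eta ->
  exists2 C : nat, (0 < C)%N & forall alpha beta M N, exists rs,
  [/\ uniq rs, {subset rs <= kpairs M N},
    forall k l, k \in rs -> l \in ls -> cmod (chi alpha beta l k - 1) <= eta &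
    ((2 * M + 1) ^ d * (2 * N + 1) ^ d <= C * size rs)%N].
Proof.
move=> eta0; pose K := (Num.truncn (2 / eta)).+1.
have Keta : K%:R^-1 + K%:R^-1 <= eta :> R.
  have : 2 / eta < K%:R by rewrite truncnS_gt.
  rewrite ltr_pdivrMr // => h; have K0 : 0 < K%:R :> R by rewrite ltr0n.
  by rewrite -(ler_pM2r K0) mulrDl mulVf ?gt_eqF //; lra.
pose D := ('I_(2 * K).+1 * 'I_(2 * K).+1)%type.
pose C0 := #|{ffun 'I_(size ls) -> D}|.
(* The powers of 2 pay for passing from the full box to its corner, and [C0] counts the cells;
   neither involves the lattice or the size of the box. *)
exists (2 ^ d * 2 ^ d * C0)%N.
  by rewrite !muln_gt0 !expn_gt0 /= /C0 card_ffun expn_gt0 card_prod !card_ord.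
move=> alpha beta M N.
pose X := ({ffun 'I_d -> 'I_M.+1} * {ffun 'I_d -> 'I_N.+1})%type.
pose pt (x : X) := (nat_tuple x.1, nat_tuple x.2).
pose z (x : X) (j : 'I_(size ls)) := chi alpha beta (nth (l0 R d) ls j) (pt x).
pose cell (x : X) : {ffun 'I_(size ls) -> D} :=
  [ffun j => (digit K (cRe (z x j)), digit K (cIm (z x j)))].
have [y hy] := pigeonhole cell ([ffun=> ord0], [ffun=> ord0]).
pose sb (x : X) := (isub (pt x).1 (pt y).1, isub (pt x).2 (pt y).2).
have sb_inj : injective sb.
  move=> [x1 x2] [u1 u2] h; congr (_, _).
    exact: nat_tuple_inj (isub_inj (congr1 fst h)).
  exact: nat_tuple_inj (isub_inj (congr1 snd h)).
exists [seq sb x | x <- enum [pred x | cell x == cell y]]; split.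
- by rewrite map_inj_uniq ?enum_uniq.
- by move=> _ /mapP[x _ ->]; apply/allpairsP; exists (sb x); split => //;
    exact: nat_tuple_sub.
- move=> _ l /mapP[x + ->] lls; rewrite mem_enum inE => /eqP/ffunP exy.
  pose j := Ordinal (etrans (index_mem l ls) lls).
  have lE : l = nth (l0 R d) ls j by rewrite nth_index.
  rewrite (chi_isub _ _ _ (pt x) (pt y)) lE -/(z x j) -/(z y j).
  have := exy j; rewrite !ffunE => -[e1 e2].
  have c1 u : cmod (z u j) <= 1 by rewrite cmod_expi.
  apply: le_trans (cmod_ReIm _) _; rewrite !cReIm; apply: le_trans Keta.
  have r1 u := le_trans (cmod_Re _) (c1 u).
  have i1 u := le_trans (cmod_Im _) (c1 u).
  exact: lerD (digit_close (r1 _) (r1 _) _ e1) (digit_close (i1 _) (i1 _) _ e2).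
- rewrite size_map -cardE -!mulnA.
  apply: leq_trans (_ : (2 * M.+1) ^ d * (2 * N.+1) ^ d <= _)%N.
    have mono a b : (a <= b)%N -> (a ^ d <= b ^ d)%N.
      by move=> ab; elim: (d) => // k ih; rewrite !expnS leq_mul.
    by apply: leq_mul; apply: mono; lia.
  rewrite !expnMn mulnACA -mulnA leq_mul2l; apply/orP; right.
  have hX : #|{: X}| = (M.+1 ^ d * N.+1 ^ d)%N by rewrite card_prod !card_ffun !card_ord.
  by rewrite leq_mul2l; apply/orP; right; rewrite -hX; exact: hy.
Qed.

End Returns.

(** * Positivity and faithfulness *)

Section Faithful.
Variables (R : realType) (d : nat) (mu : {measure set (d.-tuple R) -> \bar R}).
Hypothesis leb : is_lebesgue mu.
Implicit Types (P Q : seq (R[i] * (d.-tuple R * d.-tuple R))) (f g h : fn R d).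
Implicit Types (S T : Op R d).

Definition ravg (phi : d.-tuple int * d.-tuple int -> R) M N : R :=
  (((2 * M + 1) ^ d * (2 * N + 1) ^ d)%N%:R)^-1 * \sum_(k <- kpairs d M N) phi k.

Lemma avg_real (phi : d.-tuple int * d.-tuple int -> R) M N :
  avg (fun k => (phi k)%:C) M N = (ravg phi M N)%:C.
Proof.
by rewrite /avg /ravg [RHS](rmorphM (real_complex R)) (fmorphV (real_complex R))
  (rmorph_nat (real_complex R)) (rmorph_sum (real_complex R)) big_allpairs.
Qed.

Lemma ravg_ge0 (phi : d.-tuple int * d.-tuple int -> R) M N :
  (forall k, 0 <= phi k) -> 0 <= ravg phi M N.
Proof. by move=> h; rewrite mulr_ge0 ?invr_ge0 ?ler0n ?sumr_ge0. Qed.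

Lemma ravg_returns (phi : d.-tuple int * d.-tuple int -> R) M N (C : nat) (c : R) rs :
  (0 < C)%N -> 0 <= c -> (forall k, 0 <= phi k) ->
  uniq rs -> {subset rs <= kpairs d M N} -> (forall k, k \in rs -> c <= phi k) ->
  ((2 * M + 1) ^ d * (2 * N + 1) ^ d <= C * size rs)%N ->
  c / C%:R <= ravg phi M N.
Proof.
move=> C0 c0 phi0 urs srs hc hsz.
have n0 : 0 < ((2 * M + 1) ^ d * (2 * N + 1) ^ d)%N%:R :> R.
  by rewrite ltr0n muln_gt0 !expn_gt0 !addn1.
rewrite /ravg [leRHS]mulrC ler_pdivlMr // mulrAC ler_pdivrMr ?ltr0n //.
apply: le_trans (_ : c * (C * size rs)%:R <= _).
  by rewrite ler_wpM2l // ler_nat.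
rewrite natrM mulrA [c * _]mulrC -mulrA [leRHS]mulrC ler_wpM2l //.
rewrite mulr_natr -[X in _ *+ X]count_predT -iter_addr_0 -big_const_seq.
apply: le_trans (_ : \sum_(k <- rs) phi k <= _).
  by rewrite !big_seq; apply: ler_sum.
rewrite (perm_big [seq k <- kpairs d M N | k \in rs]); last first.
  apply: uniq_perm => //; first by rewrite filter_uniq ?kpairs_uniq.
  by move=> k; rewrite mem_filter; case: (boolP (k \in rs)) => // /srs ->.
rewrite big_filter big_mkcond; apply: ler_sum => k _.
by case: ifP.
Qed.

Lemma gabor_avg_adjoint (r : R) f T T' M N : L2 mu f -> L2op mu T -> L2op mu T' ->
  adjoint mu T T' -> gabor_avg mu r r f f (T' \o T) M N =
  (ravg (fun k => nsq mu (T (gab r r f k))) M N)%:C.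
Proof.
move=> hf LT LT' adjT; rewrite gabor_avgE -avg_real; congr avg; apply/funext => k.
have fk := L2_gab leb r r k hf; have Tk := LT _ fk.
rewrite -innerJ; [|exact: fk|exact: LT'].
by rewrite -adjT // inner_self; exact: conjc_real.
Qed.

(** The step [r] depends on the finite sum [P], hence on [e]: each precision needs its own lattice,
    and no single lattice is claimed to work for all [e]. *)
Lemma gamma_mean T T' : inA mu T -> inA mu T' -> adjoint mu T T' ->
  forall f, L2 mu f -> forall e, 0 < e -> exists r M N,
  cmod (gamma mu (T' \o T) * (nsq mu f)%:C -
    (ravg (fun k => nsq mu (T (gab r r f k))) M N)%:C) <= e.
Proof.
move=> AT AT' adjT f hf e e0; have [LT _] := AT; have [LT' _] := AT'.
have LTT : L2op mu (T' \o T) by move=> g hg; apply: LT'; exact: LT.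
have n0 := nsq_ge0 mu f.
have e30 : 0 < e / 3 by rewrite divr_gt0.
have [e' e'0 e'e] : exists2 e', 0 < e' & e' * nsq mu f <= e / 3.
  exists (e / 3 / (nsq mu f + 1)); first by rewrite !divr_gt0 // ltr_wpDl.
  rewrite mulrAC ler_pdivrMr ?ltr_wpDl // ler_pM2l //; lra.
have [P hP cP] := inA_comp_gammaP leb AT' AT e'0.
have [B B0 hB] := dlim_polyop_small leb P hf; have [r r0 rB] := small_step B0.
have [K hK] := hB r r0 rB _ e30; exists r, K, K.
rewrite -(gabor_avg_adjoint r K K hf LT LT' adjT).
apply: le_trans (cmodB _ _ (zcoef P * (nsq mu f)%:C)) _.
rewrite -mulrBl cmodM cmodC (ger0_norm n0) cmodBC.
have h1 : cmod (zcoef P - gamma mu (T' \o T)) * nsq mu f <= e / 3.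
  by apply: le_trans e'e; rewrite ler_wpM2r.
have h2 := hK K K (leqnn _) (leqnn _); rewrite cmodBC in h2.
have h3 := cmodB (zcoef P * (nsq mu f)%:C) (gabor_avg mu r r f f (T' \o T) K K)
  (gabor_avg mu r r f f (polyop P) K K).
have h4 : cmod (gabor_avg mu r r f f (polyop P) K K -
    gabor_avg mu r r f f (T' \o T) K K) <= e / 3.
  rewrite cmodBC; apply: le_trans (_ : e' * (l2norm mu f * l2norm mu f) <= _).
    by apply: gabor_avg_close => //; [exact: ltW|move=> g; exact: L2_polyop].
  by rewrite -expr2 l2norm_sqr.
move: (cmod _) (cmod _) (cmod _) (cmod _) h1 h2 h3 h4 => *; lra.
Qed.

Lemma gamma_ge0 T T' : inA mu T -> inA mu T' -> adjoint mu T T' ->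
  0 <= gamma mu (T' \o T).
Proof.
move=> AT AT' adjT; set z := gamma mu _.
have h e : 0 < e -> exists2 r : R, 0 <= r & cmod (z - r%:C) <= e.
  move=> e0; have := gamma_mean AT AT' adjT (L2_unit_cube leb) e0.
  rewrite -l2norm_sqr l2norm_unit_cube // expr1n mulr1 => -[r [M [N hr]]].
  by eexists; last exact: hr; apply: ravg_ge0 => k; exact: nsq_ge0.
rewrite lecE; apply/andP; split.
  rewrite -normr_eq0 eq_le normr_ge0 andbT; apply/ler_addgt0Pr => e e0.
  have [r r0 hr] := h e e0; rewrite add0r; apply: le_trans hr.
  by apply: le_trans (cmod_Im _); rewrite !cReIm /= subr0.
apply/ler_addgt0Pr => e e0; have [r r0 hr] := h e e0.
have := le_trans (cmod_Re _) hr; rewrite !cReIm /= ler_norml => /andP[h1 h2]; lra.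
Qed.

Lemma gamma_faithful T T' : inA mu T -> inA mu T' -> adjoint mu T T' ->
  gamma mu (T' \o T) = 0 -> forall f, L2 mu f -> {ae mu, forall x, T f x = 0}.
Proof.
move=> AT AT' adjT g0 f hf; have [LT _] := AT; have Tf := LT f hf.
apply: (l2norm_le_eq0 Tf) => e e0; rewrite leNgt; apply/negP => ec.
have c0 : 0 < l2norm mu (T f) by exact: lt_trans ec.
set c := l2norm mu (T f) in c0; set n := l2norm mu f.
have n0 : 0 <= n by exact: l2norm_ge0.
(* Error budget: [T] is replaced by [P] twice, at the cost of [c / 8] each, and the shift is
   commuted past [P] at the cost of [c / 4]; of [c] there remains [c / 2]. *)
have [ep ep0 epn] : exists2 ep, 0 < ep & ep * n <= c / 8.
  exists (c / 8 / (n + 1)); first by rewrite !divr_gt0 // ltr_wpDl.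
  rewrite mulrAC ler_pdivrMr ?ltr_wpDl // ler_pM2l ?divr_gt0 //; lra.
have [P hP] := inA_approx leb AT ep0.
have P0 : 0 <= norm1 P * n by rewrite mulr_ge0 ?norm1_ge0.
have [eta eta0 etan] : exists2 eta, 0 < eta & eta * (norm1 P * n) <= c / 4.
  exists (c / 4 / (norm1 P * n + 1)); first by rewrite !divr_gt0 // ltr_wpDl.
  rewrite mulrAC ler_pdivrMr ?ltr_wpDl // ler_pM2l ?divr_gt0 //; lra.
have [C C0 hC] := returns_dense [seq p.2 | p <- P] eta0.
(* Moving the shift by [k] past [P] multiplies each coefficient by a character value close to 1, so
   [P] almost commutes with the shift. *)
have key r k : (forall p, p \in P -> cmod (chi r r p.2 k - 1) <= eta) ->
    c / 2 <= l2norm mu (T (gab r r f k)).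
  move=> hk; have fk := L2_gab leb r r k hf.
  have h1 := hP _ fk; rewrite l2norm_gab // -/n in h1.
  have h2 := l2norm_le_add (L2_polyop leb P fk) (LT _ fk); rewrite l2normBC in h2.
  have LU p : L2 mu (Ul p.2 f) by exact: L2_Ul.
  have Ls (a : R[i] * (d.-tuple R * d.-tuple R) -> R[i]) :
      L2 mu (fun x => \sum_(p <- P) a p * Ul p.2 f x).
    by apply: (@L2_sum _ _ _ _ P (fun p x => a p * Ul p.2 f x)) => p _; exact: L2Z.
  have Lc := Ls (fun p => p.1 * chi r r p.2 k).
  have Lp := Ls (fun p => p.1).
  have h3 : l2norm mu (polyop P (gab r r f k)) =
      l2norm mu (fun x => \sum_(p <- P) p.1 * chi r r p.2 k * Ul p.2 f x).
    by rewrite polyop_gab l2norm_gab.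
  have h4 := l2norm_le_add Lp Lc.
  have h5 := l2norm_le_add Tf (L2_polyop leb P hf); have h6 := hP f hf.
  have h7 : l2norm mu (fun x => \sum_(p <- P) p.1 * Ul p.2 f x -
      \sum_(p <- P) p.1 * chi r r p.2 k * Ul p.2 f x) <= eta * (norm1 P * n).
    under eq_fun do rewrite -sumrB.
    apply: le_trans (l2norm_sum (F := fun p x => p.1 * Ul p.2 f x -
      p.1 * chi r r p.2 k * Ul p.2 f x) _) _.
      by move=> p _; apply: L2B; exact: L2Z.
    rewrite mulrCA mulr_suml big_seq [leRHS]big_seq; apply: ler_sum => p pP.
    rewrite [X in l2norm mu X](_ : _ = fun x => (p.1 * (1 - chi r r p.2 k)) * Ul p.2 f x).
      rewrite l2normZ // l2norm_U // cmodM -/n -mulrA; apply: ler_wpM2l; first exact: cmod_ge0.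
      by apply: ler_wpM2r => //; rewrite cmodBC; exact: hk.
    by apply/funext => x; rewrite mulrBr mulr1 mulrBl.
  have h8 : l2norm mu (polyop P f) <= eta * (norm1 P * n) + l2norm mu (polyop P (gab r r f k)).
    by rewrite h3; apply: le_trans h4 _; rewrite lerD2r.
  rewrite -/n in h6; rewrite -/c in h5.
  move: (l2norm mu _) (l2norm mu _) (l2norm mu (T (gab r r f k))) (l2norm mu _)
    h1 h2 h5 h6 h8 => *; lra.
(* Lower bound for every mean: at least one point in [C] contributes [(c / 2)^2]. It involves
   neither [r] nor [M] and [N], so [gamma_mean] may be used with precision [del / 2]. *)
pose del := (c / 2) ^+ 2 / C%:R.
have del0 : 0 < del by rewrite divr_gt0 ?exprn_gt0 ?ltr0n // divr_gt0.
have del20 : 0 < del / 2 by exact: divr_gt0.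
have [r [M [N]]] := gamma_mean AT AT' adjT hf del20.
rewrite g0 mul0r sub0r cmodN cmodC => hr.
have [rs [urs srs hrs hsz]] := hC r r M N.
have : del <= ravg (fun k => nsq mu (T (gab r r f k))) M N.
  apply: (ravg_returns C0 _ _ urs srs _ hsz) => [||k krs].
  - exact: sqr_ge0.
  - by move=> k; exact: nsq_ge0.
  - rewrite -l2norm_sqr ler_sqr ?nnegrE ?l2norm_ge0 //; last by rewrite ltW // divr_gt0.
    by apply: key => p pP; apply: hrs => //; exact: map_f.
have := le_trans (ler_norm _) hr; clear g0; move: (ravg _ M N) => x *; lra.
Qed.

End Faithful.

(** * Integrals of characters over a cube *)

Section CharacterIntegrals.
Variables (R : realType) (d : nat) (mu : {measure set (d.-tuple R) -> \bar R}).
Hypothesis leb : is_lebesgue mu.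
Implicit Types (w x : d.-tuple R).

Definition cube (b : R) : set (d.-tuple R) := box (cst_tuple d 0) (cst_tuple d b).

Lemma cubeP b x : cube b x <-> forall i, 0 <= tnth x i < b.
Proof. by split=> h i; have := h i; rewrite !tnth_mktuple. Qed.

Lemma measurable_cube b : measurable (cube b). Proof. exact: measurable_box. Qed.

Lemma mu_cube b : 0 <= b -> mu (cube b) = (b ^+ d)%:E.
Proof.
move=> b0; rewrite (mu_box leb) (eq_bigr (fun=> b)) ?prodr_const ?card_ord // => i _.
by rewrite !tnth_mktuple subr0 max_r.
Qed.

Lemma mu_cube_fin b : (mu (cube b) < +oo)%E.
Proof. by rewrite (mu_box leb) ltry. Qed.

Lemma L2_cube b : L2 mu (ind (cube b)).
Proof. by apply: L2_ind; [exact: measurable_cube|exact: mu_cube_fin]. Qed.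

Lemma cintg_indM A (h : fn R d) (C : R) : measurable A -> (mu A < +oo)%E ->
  cmeas h -> (forall x, cmod (h x) <= C) -> cintegrable mu (fun x => ind A x * h x).
Proof.
move=> mA fA mh hC.
apply: (cintg_dom (v := fun x => C * \1_A x)).
- by apply: cmeasM => //; exact: cmeas_ind.
- exact: rintZ (rint_ind mA fA).
- move=> x; rewrite cmodM cmodC indicE mulrC.
  by case: (_ \in _); rewrite ?normr1 ?normr0 ?mulr1 ?mulr0.
Qed.

Lemma indU (A B : set (d.-tuple R)) x : A `&` B = set0 ->
  ind (A `|` B) x = ind A x + ind B x.
Proof.
move=> AB; rewrite /ind -(rmorphD (real_complex R)); congr (real_complex R _).
rewrite !indicE in_setU; have [xA|xA] := boolP (x \in A); rewrite /= ?add0r //.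
rewrite memNset ?addr0 // => xB; suff : (A `&` B) x by rewrite AB.
by split=> //; exact: set_mem.
Qed.

Definition delta_tuple (i : 'I_d) (s : R) : d.-tuple R :=
  [tuple if j == i then s else 0 | j < d].

Lemma dot_delta w i s : dot w (delta_tuple i s) = tnth w i * s.
Proof.
rewrite /dot (bigD1 i) //= tnth_mktuple eqxx big1 ?addr0 // => j ji.
by rewrite tnth_mktuple (negbTE ji) mulr0.
Qed.

(* The cube is cut along [x_i = s]; translating one of the two pieces by a
   period shows that the integral is invariant under a translation by [s]
   along the [i]-th axis, which also multiplies it by a phase. *)
Lemma cint_char0 b w i : 0 < b -> tnth w i != 0 -> expi (b * tnth w i) = 1 ->
  cint mu (fun x => ind (cube b) x * expi (dot w x)) = 0.
Proof.
move=> b0 wi per; set I := cint _ _.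
(* Any cut in []0, b[] with a nontrivial phase would do; here [s] times the frequency has modulus
   below 1. *)
pose s := b / (1 + b * `|tnth w i|).
have wi0 : 0 < `|tnth w i| by rewrite normr_gt0.
have K0 : 0 < 1 + b * `|tnth w i| by rewrite ltr_pwDl // mulr_ge0 ?ltW.
have s0 : 0 < s by exact: divr_gt0.
have sb : s < b.
  by rewrite ltr_pdivrMr // mulrDr mulr1 ltrDl !mulr_gt0.
have sw : expi (s * tnth w i) != 1.
  apply/eqP => /expi_eq1; rewrite normrM (gtr0_norm s0) => h.
  have : s * `|tnth w i| < 2 * pi.
    have : s * `|tnth w i| < 1 by rewrite /s mulrAC ltr_pdivrMr // mul1r ltrDr.
    have := pi_ge2 R; lra.
  by move=> /h/eqP; rewrite mulf_eq0 (gt_eqF s0) (negbTE wi).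
pose S : set (d.-tuple R) := [set x | s <= tnth x i].
pose A := cube b `&` S; pose B := cube b `\` S.
have mi : measurable_fun setT (fun x : d.-tuple R => tnth x i) by exact: measurable_tnth.
have mS : measurable S.
  rewrite [X in measurable X](_ : _ = (fun x => tnth x i) @^-1` `[s, +oo[%classic).
    by rewrite -[X in measurable X]setTI; apply: mi => //; exact: measurable_itv.
  by apply/seteqP; split => x /=; rewrite in_itv /= andbT.
have mA : measurable A by apply: measurableI => //; exact: measurable_cube.
have mB : measurable B by apply: measurableD => //; exact: measurable_cube.
have fA : (mu A < +oo)%E.
  by apply: le_lt_trans (mu_cube_fin b); apply: le_measure; rewrite ?inE //;
    [exact: measurable_cube|exact: subIsetl].
have fB : (mu B < +oo)%E.
  by apply: le_lt_trans (mu_cube_fin b); apply: le_measure; rewrite ?inE //;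
    [exact: measurable_cube|exact: subDsetl].
pose ew x := expi (dot w x).
have mew : cmeas ew by exact: cmeas_char.
have ew1 x : cmod (ew x) <= 1 by rewrite cmod_expi.
have iA := cintg_indM mA fA mew ew1; have iB := cintg_indM mB fB mew ew1.
have IE : I = cint mu (fun x => ind A x * ew x) + cint mu (fun x => ind B x * ew x).
  rewrite /I -cintD //; congr cint; apply/funext => x; rewrite -mulrDl; congr (_ * _).
  rewrite -indU; first by rewrite /A /B setUIDK.
  by rewrite -subset0 => y [[_ sy] [_ nsy]].
have iC := cintg_indM (measurable_cube b) (mu_cube_fin b) mew ew1.
have IE2 : I = expi (- (s * tnth w i)) * I.
  rewrite {1}/I -(cint_tsub leb (delta_tuple i s)); last exact: cintg_meas iC.
  rewrite [in RHS]IE -[cint mu (fun x => ind B x * ew x)](cint_tsub leb (delta_tuple i b));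
    last exact: cintg_meas iB.
  have iB' := cintg_tsub leb (delta_tuple i b) iB.
  rewrite -cintD // -cintZ; last exact: cintgD.
  congr cint; apply/funext => x.
  rewrite dotBr dot_delta addrC expiD [tnth w i * s]mulrC mulrCA; congr (_ * _).
  have -> : ew (tsub x (delta_tuple i b)) = ew x.
    by rewrite /ew dotBr dot_delta expiD [tnth w i * b]mulrC -expiJ per rmorph1 mulr1.
  rewrite -mulrDl; congr (_ * _).
  rewrite -[ind (cube b) _]/(ind ((fun x => tsub x (delta_tuple i s)) @^-1` cube b) x).
  rewrite -[ind B _]/(ind ((fun x => tsub x (delta_tuple i b)) @^-1` B) x).
  have dlt j y c : tnth (tsub y (delta_tuple i c)) j = tnth y j - (if j == i then c else 0).
    by rewrite !tnth_mktuple.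
  rewrite -indU; last first.
    rewrite -subset0 => y [[/cubeP yb _] [/cubeP yb' _]].
    have := yb i; have := yb' i; rewrite dlt eqxx => /andP[h1 h2] /andP[h3 h4]; lra.
  congr ind; apply/seteqP; split => y /=.
    move=> /cubeP yb; have := yb i; rewrite dlt eqxx => /andP[h1 h2].
    have [yi|yi] := ltP (tnth y i) b; [left|right]; split.
    - apply/cubeP => j; have := yb j; rewrite dlt; case: eqP => [-> _|_]; last by rewrite subr0.
      by rewrite yi andbT; lra.
    - by rewrite /S /=; lra.
    - apply/cubeP => j; have := yb j; rewrite !dlt; case: eqP => [-> _|//].
      by apply/andP; split; lra.
    - by rewrite /S /= dlt eqxx; apply/negP; rewrite -ltNge; lra.
  move=> [[/cubeP yb /= sy]|[/cubeP yb /negP]].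
    apply/cubeP => j; have := yb j; rewrite dlt; case: eqP => [-> /andP[h1 h2]|_]; last by rewrite subr0.
    by rewrite /S /= in sy; apply/andP; split; lra.
  rewrite /S /= -ltNge dlt eqxx => ys; apply/cubeP => j; have := yb j; rewrite !dlt.
  by case: eqP => [-> /andP[h1 h2]|//]; apply/andP; split; lra.
have : (1 - expi (- (s * tnth w i))) * I = 0 by rewrite mulrBl mul1r -IE2 subrr.
move=> /eqP; rewrite mulf_eq0 => /orP[|/eqP //].
rewrite subr_eq0 => /eqP e; move/negP: sw; case; apply/eqP.
by rewrite -[expi _]mulr1 [X in _ * X]e expiN1.
Qed.

End CharacterIntegrals.

(** * Density of the exponentials in L2 of a cube *)

Section Density.
Variables (R : realType) (d : nat) (mu : {measure set (d.-tuple R) -> \bar R}).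
Hypothesis leb : is_lebesgue mu.
Implicit Types (w x : d.-tuple R) (u v : fn R d).

Lemma l2_dominated (u_ : nat -> fn R d) u (w : d.-tuple R -> R) :
  L2 mu u -> (forall n, L2 mu (u_ n)) -> rintegrable mu w ->
  (forall n x, csq (u x - u_ n x) <= w x) ->
  (forall x, (fun n => csq (u x - u_ n x)) @ \oo --> 0) ->
  forall e, 0 < e -> exists n, l2norm mu (fun x => u x - u_ n x) <= e.
Proof.
move=> Lu Lun iw hw hcv e e0.
have md n : measurable_fun setT (fun x => csq (u x - u_ n x)).
  by apply: cmeas_csq; apply: L2_meas; exact: L2B (Lun n).
have cv0 x : setT x -> ((csq (u x - u_ n x))%:E @[n --> \oo] --> 0%E)%classic.
  by move=> _; apply: cvg_EFin; [exact: nearW|exact: hcv].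
have hw' x (n : nat) : setT x -> (`|(csq (u x - u_ n x))%:E| <= (w x)%:E)%E.
  by move=> _; rewrite lee_fin ger0_norm ?csq_ge0.
have [_ _] := @dominated_convergence _ _ _ mu setT measurableT
  (fun n x => (csq (u x - u_ n x))%:E) (fun=> 0%E) (EFin \o w)
  (fun n => (measurable_EFinP _ _).2 (md n)) (measurable_cst _)
  (aeW _ cv0) iw (aeW _ (fun x n => hw' x n)).
rewrite integral0 => /fine_cvgP[_ /cvgrPdist_le /(_ (e ^+ 2))].
rewrite exprn_gt0 // => /(_ isT)[N _ /(_ N (leqnn N))] /= h; exists N.
rewrite -ler_sqr ?nnegrE ?l2norm_ge0 ?(ltW e0) // l2norm_sqr.
by rewrite sub0r normrN in h; exact: le_trans (ler_norm _) h.
Qed.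

Lemma l2_mul_limit (phi_ : nat -> d.-tuple R -> R) (phi : d.-tuple R -> R) u (C : R) :
  L2 mu u -> (forall n, measurable_fun setT (phi_ n)) -> measurable_fun setT phi ->
  (forall n x, `|phi_ n x| <= C) -> (forall x, phi_ n x @[n --> \oo] --> phi x) ->
  forall e, 0 < e ->
  exists n, l2norm mu (fun x => (phi x)%:C * u x - (phi_ n x)%:C * u x) <= e.
Proof.
move=> Lu mn mphi hC hcv.
have C0 : 0 <= C by apply: le_trans (hC 0%N (cst_tuple d 0)).
have hC' x : `|phi x| <= C.
  by apply: (ler_cvg_to (cvg_norm (hcv x)) (cvg_cst C)); exact: nearW.
have Lmul (f : d.-tuple R -> R) : measurable_fun setT f -> (forall x, `|f x| <= C) ->
    L2 mu (fun x => (f x)%:C * u x).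
  move=> mf fC; apply: (@L2M _ _ _ u (fun x => (f x)%:C) C _ _ Lu); first exact: cmeas_real.
  by move=> x; rewrite cmodC.
have eqx n x : (phi x)%:C * u x - (phi_ n x)%:C * u x = (phi x - phi_ n x)%:C * u x.
  by rewrite -mulrBl -(rmorphB (real_complex R)).
move=> e e0; apply: (@l2_dominated _ _ (fun x => (2 * C) ^+ 2 * csq (u x))) => //.
- exact: Lmul.
- by move=> n; exact: Lmul.
- by apply: rintZ; case/L2P: Lu.
- move=> n x; rewrite eqx csqM ler_wpM2r ?csq_ge0 // csqE cmodC.
  rewrite ler_sqr ?nnegrE ?normr_ge0 ?mulr_ge0 //; apply: le_trans (ler_normB _ _) _.
  by rewrite mulr_natl mulr2n lerD.
move=> x; under eq_fun do rewrite eqx csqM csqE cmodC real_normK ?num_real // expr2.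
have h0 : phi x - phi_ n x @[n --> \oo] --> (0 : R).
  have h := cvgB (cvg_cst (phi x)) (hcv x); rewrite subrr in h; exact: h.
have h := cvgM (cvgM h0 h0) (cvg_cst (csq (u x))); rewrite !mul0r in h; exact: h.
Qed.

Variable alpha : R.
Hypothesis alpha0 : 0 < alpha.

Let Q : set (d.-tuple R) := cube alpha^-1.

Definition freq (m : d.-tuple int) : d.-tuple R :=
  [tuple 2 * pi * alpha * (tnth m i)%:~R | i < d].
Definition em m x : R[i] := expi (dot (freq m) x).
Definition trigp (p : seq (R[i] * d.-tuple int)) x := \sum_(q <- p) q.1 * em q.2 x.

Lemma emD m m' x : em m x * em m' x = em [tuple tnth m i + tnth m' i | i < d] x.
Proof.
rewrite /em -expiD -dotDl; congr (expi (dot _ _)).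
by apply: eq_from_tnth => i; rewrite !tnth_mktuple intrD; ring.
Qed.

Lemma L2_Qtrigp p : L2 mu (fun x => ind Q x * trigp p x).
Proof.
under eq_fun do rewrite mulr_sumr.
apply: (@L2_sum _ _ _ _ p (fun q x => ind Q x * (q.1 * em q.2 x))) => q _.
under eq_fun do rewrite mulrCA [ind Q _ * _]mulrC.
by apply: L2Z; apply: L2_char; exact: L2_cube.
Qed.

(** L2 of the cube is realized by functions vanishing pointwise off [Q], so that a multiplier
    matters only through its values on [Q]. *)
Definition trig_closure u := [/\ L2 mu u, (forall x, ~ Q x -> u x = 0) &
  forall e, 0 < e -> exists p, l2norm mu (fun x => u x - ind Q x * trigp p x) <= e].

Lemma trig_closureD u v : trig_closure u -> trig_closure v -> trig_closure (fun x => u x + v x).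
Proof.
move=> [Lu u0 hu] [Lv v0 hv]; split; first exact: L2D.
  by move=> x nx; rewrite u0 // v0 // addr0.
move=> e e0; have e2 : 0 < e / 2 by rewrite divr_gt0.
have [p hp] := hu _ e2; have [q hq] := hv _ e2; exists (p ++ q).
rewrite [X in l2norm mu X](_ : _ = fun x => (u x - ind Q x * trigp p x) +
    (v x - ind Q x * trigp q x)).
  apply: le_trans (l2normD _ _) _; [exact: L2B (L2_Qtrigp _)..|].
  by rewrite (splitr e) lerD.
by apply/funext => x; rewrite /trigp big_cat /= mulrDr opprD addrACA.
Qed.

Lemma trig_closureZ (a : R[i]) u : trig_closure u -> trig_closure (fun x => a * u x).
Proof.
move=> [Lu u0 hu]; split; first exact: L2Z.
  by move=> x nx; rewrite u0 // mulr0.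
move=> e e0; have c0 : 0 < cmod a + 1 by rewrite ltr_wpDl ?cmod_ge0.
have [p hp] := hu _ (divr_gt0 e0 c0); exists [seq (a * q.1, q.2) | q <- p].
rewrite [X in l2norm mu X](_ : _ = fun x => a * (u x - ind Q x * trigp p x)).
  rewrite l2normZ; last exact: L2B (L2_Qtrigp _).
  apply: le_trans (ler_wpM2l (cmod_ge0 a) hp) _.
  rewrite mulrCA; apply: ler_piMr; first exact: ltW.
  by rewrite ler_pdivrMr // mul1r lerDl.
apply/funext => x; rewrite /trigp big_map mulrBr mulrCA; congr (_ - _ * _).
by rewrite mulr_sumr; apply: eq_bigr => q _; rewrite mulrA.
Qed.

Lemma trig_closure_em m u : trig_closure u -> trig_closure (fun x => em m x * u x).
Proof.
move=> [Lu u0 hu]; split; first exact: L2_char.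
  by move=> x nx; rewrite u0 // mulr0.
move=> e /hu[p hp]; exists [seq (q.1, [tuple tnth m i + tnth q.2 i | i < d]) | q <- p].
rewrite [X in l2norm mu X](_ : _ = fun x => em m x * (u x - ind Q x * trigp p x)).
  rewrite /l2norm; under eq_fun do rewrite csqM csq_expi mul1r; exact: hp.
apply/funext => x; rewrite /trigp big_map mulrBr mulrCA; congr (_ - _ * _).
by rewrite mulr_sumr; apply: eq_bigr => q _; rewrite -emD mulrCA.
Qed.

Lemma trig_closure_lim u : L2 mu u -> (forall x, ~ Q x -> u x = 0) ->
  (forall e, 0 < e -> exists2 v, trig_closure v & l2norm mu (fun x => u x - v x) <= e) -> trig_closure u.
Proof.
move=> Lu u0 hu; split=> // e e0; have e2 : 0 < e / 2 by rewrite divr_gt0.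
have [v [Lv v0 hv] uv] := hu _ e2; have [p hp] := hv _ e2; exists p.
apply: le_trans (l2normB Lu Lv (L2_Qtrigp p)) _.
by rewrite (splitr e) lerD.
Qed.

Lemma trig_closure_ind : trig_closure (ind Q).
Proof.
split; first exact: L2_cube.
  by move=> x nx; rewrite /ind indicE memNset.
move=> e e0; exists [:: (1, [tuple 0 | _ < d])].
rewrite [X in l2norm mu X](_ : _ = fun=> 0); first by rewrite l2norm0 ltW.
apply/funext => x; rewrite /trigp big_seq1 mul1r /em.
rewrite (_ : freq _ = cst_tuple d 0) ?dot0l ?expi0 ?mulr1 ?subrr //.
by apply: eq_from_tnth => i; rewrite !tnth_mktuple mulr0.
Qed.

(* Multipliers form an algebra closed under bounded pointwise limits, so the
   sets whose indicator is a multiplier form a sigma-algebra. *)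
Definition multiplier (phi : d.-tuple R -> R) :=
  forall u, trig_closure u -> trig_closure (fun x => (phi x)%:C * u x).

Lemma multiplier_ext phi psi : (forall x, Q x -> phi x = psi x) ->
  multiplier phi -> multiplier psi.
Proof.
move=> h hphi u Vu; have [_ u0 _] := Vu.
rewrite (_ : (fun x => _) = fun x => (phi x)%:C * u x); first exact: hphi.
apply/funext => x; have [qx|qx] := pselect (Q x); first by rewrite h.
by rewrite u0 // !mulr0.
Qed.

Lemma multiplier_cst c : multiplier (fun=> c).
Proof. by move=> u Vu; exact: trig_closureZ. Qed.

Lemma multiplierD phi psi : multiplier phi -> multiplier psi ->
  multiplier (fun x => phi x + psi x).
Proof.
move=> h1 h2 u Vu; have := trig_closureD (h1 _ Vu) (h2 _ Vu); congr trig_closure.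
by apply/funext => x; rewrite (rmorphD (real_complex R)) mulrDl.
Qed.

Lemma multiplierM phi psi : multiplier phi -> multiplier psi ->
  multiplier (fun x => phi x * psi x).
Proof.
move=> h1 h2 u Vu; have := h1 _ (h2 _ Vu); congr trig_closure.
by apply/funext => x; rewrite (rmorphM (real_complex R)) mulrA.
Qed.

Lemma multiplierB phi psi : multiplier phi -> multiplier psi ->
  multiplier (fun x => phi x - psi x).
Proof.
move=> h1 h2; have := multiplierD h1 (multiplierM (multiplier_cst (-1)) h2).
by under eq_fun do rewrite mulN1r.
Qed.

Lemma multiplier_lim (phi_ : nat -> d.-tuple R -> R) (phi : d.-tuple R -> R) (C : R) :
  (forall n, measurable_fun setT (phi_ n)) -> measurable_fun setT phi ->
  (forall n x, `|phi_ n x| <= C) -> (forall x, phi_ n x @[n --> \oo] --> phi x) ->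
  (forall n, multiplier (phi_ n)) -> multiplier phi.
Proof.
move=> mn mphi hC hcv hm u Vu; have [Lu u0 _] := Vu.
have hC' x : `|phi x| <= C.
  by apply: (ler_cvg_to (cvg_norm (hcv x)) (cvg_cst C)); exact: nearW.
apply: trig_closure_lim.
- apply: (@L2M _ _ _ u (fun x => (phi x)%:C) C _ _ Lu); first exact: cmeas_real.
  by move=> x; rewrite cmodC.
- by move=> x nx; rewrite u0 // mulr0.
- move=> e e0; have [n hn] := l2_mul_limit Lu mn mphi hC hcv e0.
  by exists (fun x => (phi_ n x)%:C * u x); [exact: hm|].
Qed.

(** The cosine is half the sum of two exponentials of opposite frequency along the [i]-th axis; [s]
    only changes their coefficients by phases. *)
Lemma multiplier_cos i (s : R) :
  multiplier (fun x => cos (2 * pi * alpha * (tnth x i - s))).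
Proof.
pose m : d.-tuple int := [tuple if j == i then 1 else 0 | j < d].
pose m' : d.-tuple int := [tuple if j == i then -1 else 0 | j < d].
pose t := 2 * pi * alpha * s.
move=> u Vu.
have := trig_closureD (trig_closureZ (expi (- t) / 2) (trig_closure_em m Vu)) (trig_closureZ (expi t / 2) (trig_closure_em m' Vu)).
congr trig_closure; apply/funext => x.
have fE (z : int) : dot (freq [tuple if j == i then z else 0 | j < d]) x =
    2 * pi * alpha * z%:~R * tnth x i.
  rewrite /dot (bigD1 i) //= !tnth_mktuple eqxx big1 ?addr0 // => j ji.
  by rewrite !tnth_mktuple (negbTE ji) mulr0 mul0r.
rewrite /em !fE !mulrA -mulrDl; congr (_ * _).
rewrite mulrAC -expiD [X in _ + X]mulrAC -expiD -mulrDl.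
set y := 2 * pi * alpha * (tnth x i - s).
have -> : - t + 2 * pi * alpha * 1%:~R * tnth x i = y by rewrite /t /y; ring.
have -> : t + 2 * pi * alpha * (-1)%:~R * tnth x i = - y by rewrite /t /y; ring.
apply: (mulIf (x := 2)); first by rewrite pnatr_eq0.
rewrite divfK ?pnatr_eq0 //; apply: complex_eqP; rewrite !cReIm /= ?cosN ?sinN; ring.
Qed.

End Density.

(** * A polynomial iteration converging to the sign *)

Section SignIteration.
Variable R : realType.
Implicit Types t : R.

(** The Newton-Schulz iteration for the sign. Being polynomial, it keeps multipliers multipliers. *)
Definition sign_step t : R := (3 * t - t ^+ 3) / 2.

Lemma sign_stepN t : sign_step (- t) = - sign_step t.
Proof. by rewrite /sign_step; ring. Qed.

Lemma iter_sign_stepN n t : iter n sign_step (- t) = - iter n sign_step t.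
Proof. by elim: n => //= n ->; rewrite sign_stepN. Qed.

Lemma sign_step_bound t : `|t| <= 1 -> `|sign_step t| <= 1.
Proof.
rewrite !ler_norml => /andP[h1 h2].
have s1 := sqr_ge0 (t - 1); have s2 := sqr_ge0 (t + 1).
(* These two products are [2 (1 - sign_step t)] and [2 (1 + sign_step t)]. *)
have p1 : 0 <= (t - 1) ^+ 2 * (t + 2) by apply: mulr_ge0 => //; lra.
have p2 : 0 <= (t + 1) ^+ 2 * (2 - t) by apply: mulr_ge0 => //; lra.
by apply/andP; split; rewrite /sign_step; move: p1 p2; rewrite !expr2 !exprS !expr0 => p1 p2; lra.
Qed.

Lemma iter_sign_step_bound n t : `|t| <= 1 -> `|iter n sign_step t| <= 1.
Proof. by move=> t1; elim: n => //= n; exact: sign_step_bound. Qed.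

(* [1 - sign_step s = (1 - s) (1 - s) (s + 2) / 2], and the last two factors
   multiply to at most [1 - s / 2]. *)
Lemma iter_sign_step_pos n t : 0 < t -> t <= 1 ->
  t <= iter n sign_step t <= 1 /\ 1 - iter n sign_step t <= (1 - t / 2) ^+ n.
Proof.
move=> t0 t1; elim: n => [|n [/andP[h1 h2] h3]] /=.
  by rewrite expr0 lexx t1; split=> //; lra.
set s := iter n sign_step t in h1 h2 h3 *.
have e1 : 1 - sign_step s = (1 - s) * ((1 - s) * (s + 2) / 2) by rewrite /sign_step; field.
have f0 : 0 <= (1 - s) * (s + 2) / 2.
  by rewrite divr_ge0 // mulr_ge0 //; lra.
have f1 : (1 - s) * (s + 2) / 2 <= 1 - t / 2.
  have := sqr_ge0 s; rewrite expr2 => ss; lra.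
have f2 : 1 - sign_step s <= 1 - s.
  by rewrite e1 ler_piMr //; lra.
split; first by apply/andP; split; [|rewrite -subr_ge0 e1 mulr_ge0 //]; lra.
rewrite e1 exprSr; apply: ler_pM => //; lra.
Qed.

Lemma cvg_geom_le (u : nat -> R) (l q : R) : 0 <= q -> q < 1 ->
  (forall n, `|l - u n| <= q ^+ n) -> u n @[n --> \oo] --> l.
Proof.
move=> q0 q1 h; apply/cvgrPdist_le => e e0.
have : (fun n => q ^+ n : R) n @[n --> \oo] --> (0 : R).
  by apply: cvg_expr; rewrite ger0_norm.
move=> /cvgrPdist_le /(_ e e0); apply: filterS => n.
rewrite sub0r normrN ger0_norm ?exprn_ge0 //; exact: le_trans.
Qed.

Lemma iter_sign_step_cvg t : `|t| <= 1 -> iter n sign_step t @[n --> \oo] --> Num.sg t.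
Proof.
have pos s : 0 < s -> s <= 1 -> iter n sign_step s @[n --> \oo] --> (1 : R).
  move=> s0 s1; apply: (@cvg_geom_le _ _ (1 - s / 2)); [lra|lra|move=> n].
  have [/andP[_ h2] h3] := iter_sign_step_pos n s0 s1.
  by rewrite ger0_norm // subr_ge0.
rewrite ler_norml => /andP[h1 h2]; have [t0|t0|<-] := ltgtP 0 t.
- by rewrite gtr0_sg //; exact: pos.
- have Nt0 : 0 < - t by rewrite oppr_gt0.
  have Nt1 : - t <= 1 by lra.
  rewrite ltr0_sg //; have h := cvgN (pos _ Nt0 Nt1).
  rewrite (_ : (fun n => _) = fun n => - iter n sign_step (- t)); first exact: h.
  by apply/funext => n; rewrite iter_sign_stepN opprK.
- rewrite sgr0; have it n : iter n sign_step 0 = 0 :> R.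
    by elim: n => //= n ->; rewrite /sign_step mulr0 expr0n subr0 mul0r.
  by under eq_fun do rewrite it; exact: cvg_cst.
Qed.

End SignIteration.

(** * Indicators of measurable sets as multipliers *)

Section AllOfL2.
Variables (R : realType) (d : nat) (mu : {measure set (d.-tuple R) -> \bar R}).
Hypothesis leb : is_lebesgue mu.
Implicit Types (w x : d.-tuple R) (u v : fn R d).
Variable alpha : R.
Hypothesis alpha0 : 0 < alpha.

Let Q : set (d.-tuple R) := cube alpha^-1.
Local Notation multiplier := (multiplier mu alpha).
Local Notation trig_closure := (trig_closure mu alpha).

Lemma multiplier_sg (psi : d.-tuple R -> R) (K : R) : measurable_fun setT psi ->
  (forall x, `|psi x| <= K) -> multiplier psi -> multiplier (fun x => Num.sg (psi x)).
Proof.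
move=> mpsi hK hpsi.
have K0 : 0 <= K by apply: le_trans (hK (cst_tuple d 0)).
(* Rescaling into [[-1, 1]], where the iteration converges, leaves the sign unchanged; [K + 1] is
   used because [K] may vanish. *)
pose phi x := (K + 1)^-1 * psi x.
have K1 : 0 < K + 1 by rewrite ltr_wpDl.
have mphi : measurable_fun setT phi by apply: measurable_funM.
have phi1 x : `|phi x| <= 1.
  have Ki : 0 < (K + 1)^-1 by rewrite invr_gt0.
  rewrite /phi normrM (gtr0_norm Ki) mulrC ler_pdivrMr // mul1r.
  by apply: le_trans (hK x) _; rewrite lerDl.
have msm n : measurable_fun setT (fun x => iter n (@sign_step R) (phi x)).
  elim: n => //= n ih; apply: measurable_funM => //; apply: measurable_funB.
    exact: measurable_funM.
  exact: measurable_funX.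
have hphi : multiplier phi := multiplierM (multiplier_cst leb _) hpsi.
have sgE x : Num.sg (psi x) = Num.sg (phi x).
  by rewrite /phi sgrM [Num.sg _^-1]gtr0_sg ?mul1r // invr_gt0.
have -> : (fun x => Num.sg (psi x)) = (fun x => Num.sg (phi x)) by exact/funext.
have cv x := iter_sign_step_cvg (phi1 x).
have msg : measurable_fun setT (fun x => Num.sg (phi x)).
  by apply: (measurable_fun_cvg (h := fun n x => iter n (@sign_step R) (phi x))) => // x _; exact: cv.
apply: (multiplier_lim leb msm msg (C := 1) _ cv); first by move=> n x; exact: iter_sign_step_bound.
elim=> [|n ih]; first exact: hphi.
have h1 := multiplierM (multiplier_cst leb (alpha := alpha) 3) ih.
have h2 := multiplierM ih (multiplierM ih ih).
have h3 := multiplierM (multiplierB leb h1 h2) (multiplier_cst leb (alpha := alpha) 2^-1).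
by apply: multiplier_ext h3 => x _; rewrite /sign_step /=; ring.
Qed.

Definition mult_set (A : set (d.-tuple R)) := measurable A /\ multiplier (\1_A).

(** With [s] the sign of [psi], the indicator is [(s^2 + s) / 2]. *)
Lemma mult_set_pos (psi : d.-tuple R -> R) (K : R) : measurable_fun setT psi ->
  (forall x, `|psi x| <= K) -> multiplier psi -> mult_set [set x | 0 < psi x].
Proof.
move=> mpsi hK hpsi; split.
  rewrite [X in measurable X](_ : _ = psi @^-1` `]0, +oo[%classic).
    by rewrite -[X in measurable X]setTI; apply: mpsi => //; exact: measurable_itv.
  by apply/seteqP; split => x /=; rewrite in_itv /= andbT.
have hs := multiplier_sg mpsi hK hpsi.
have := multiplierM (multiplierD leb (multiplierM hs hs) hs) (multiplier_cst leb (alpha := alpha) 2^-1).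
congr multiplier; apply/funext => x; rewrite indicE.
have [p|p|p] := ltgtP 0 (psi x).
- by rewrite mem_set // gtr0_sg // mulr1 -mulr2n mulfV.
- by rewrite memNset ?ltr0_sg //= ?mulrNN ?mulr1 ?addrN ?mul0r // lt_gtF.
- by rewrite memNset -?p ?sgr0 ?mulr0 ?addr0 ?mul0r //= -p ltxx.
Qed.

Lemma mult_setC A : mult_set A -> mult_set (~` A).
Proof.
move=> [mA hA]; split; first exact: measurableC.
have := multiplierB leb (multiplier_cst leb (alpha := alpha) 1) hA.
apply: multiplier_ext => x _; rewrite !indicE in_setC.
by case: (x \in A); rewrite ?subrr ?subr0.
Qed.

Lemma mult_setI A B : mult_set A -> mult_set B -> mult_set (A `&` B).
Proof.
move=> [mA hA] [mB hB]; split; first exact: measurableI.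
by apply: multiplier_ext (multiplierM hA hB) => x _; rewrite indicI.
Qed.

Lemma mult_setU A B : mult_set A -> mult_set B -> mult_set (A `|` B).
Proof.
by move=> hA hB; rewrite -[_ `|` _]setCK setCU; apply: mult_setC; apply: mult_setI;
  exact: mult_setC.
Qed.

Lemma mult_set0 : mult_set set0.
Proof.
split; first exact: measurable0.
by apply: multiplier_ext (multiplier_cst leb 0) => x _; rewrite indic0.
Qed.

Lemma mult_set_sigma : sigma_algebra setT mult_set.
Proof.
split=> [|A hA|F hF]; [exact: mult_set0|by rewrite setTD; exact: mult_setC|].
pose G n := \big[setU/set0]_(k < n) F k.
have hG n : mult_set (G n).
  by apply: big_ind => [||k _]; [exact: mult_set0|exact: mult_setU|exact: hF].
split; first by apply: bigcupT_measurable => n; exact: (hF n).1.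
apply: (@multiplier_lim _ _ _ leb _ (fun n => \1_(G n)) _ 1).
- by move=> n; apply: measurable_indic; exact: (hG n).1.
- by apply: measurable_indic; apply: bigcupT_measurable => n; exact: (hF n).1.
- by move=> n x; rewrite indicE; case: (_ \in _); rewrite ?normr1 ?normr0.
- move=> x; have [[k _ Fk]|nF] := pselect ((\bigcup_n F n) x).
    rewrite [X in _ --> X](_ : _ = 1); last first.
      by rewrite indicE mem_set //; exists k.
    apply: cvg_near_cst; exists k.+1 => // n /= kn; rewrite indicE mem_set //.
    by rewrite /G -bigcup_mkord; exists k.
  rewrite [X in _ --> X](_ : _ = 0); last by rewrite indicE memNset.
  apply: cvg_near_cst; exists 0%N => // n _; rewrite indicE memNset //.
  by rewrite /G -bigcup_mkord => -[k _ Fk]; apply: nF; exists k.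
- by move=> n; exact: (hG n).2.
Qed.

Lemma cos_lt1 (y : R) : 0 < y -> y < 2 * pi -> cos y < 1.
Proof.
move=> y0 yp; rewrite lt_neqAle cos_le1 andbT; apply/eqP => c1.
have s0 : sin y = 0.
  have := cos2Dsin2 y; rewrite c1 expr1n => h; apply/eqP.
  by rewrite -sqrf_eq0; apply/eqP; lra.
have := @expi_eq1 R y; rewrite /expi c1 s0 (gtr0_norm y0) => /(_ erefl yp) y1.
by rewrite y1 ltxx in y0.
Qed.

(** For [0 < c < 1 / alpha], the cosine centred at [c / 2] exceeds its value at the endpoints
    exactly when [0 < x_i < c], which is [psi > 0] on the cube. Its complement still contains the
    face [x_i = 0], which the condition [phi > 0] removes. *)
Lemma mult_ray i (c : R) : mult_set [set x | c <= tnth x i].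
Proof.
have mi : measurable_fun setT (fun x : d.-tuple R => tnth x i) by exact: measurable_tnth.
have mray : measurable [set x : d.-tuple R | c <= tnth x i].
  rewrite [X in measurable X](_ : _ = (fun x => tnth x i) @^-1` `[c, +oo[%classic).
    by rewrite -[X in measurable X]setTI; apply: mi => //; exact: measurable_itv.
  by apply/seteqP; split => x /=; rewrite in_itv /= andbT.
split=> //.
have [c0|c0] := leP c 0.
  apply: multiplier_ext (multiplier_cst leb 1) => x /cubeP/(_ i)/andP[x0 _].
  by rewrite indicE mem_set //=; exact: le_trans x0.
have [ca|ca] := leP alpha^-1 c.
  apply: multiplier_ext (multiplier_cst leb 0) => x /cubeP/(_ i)/andP[_ x0].
  by rewrite indicE memNset //=; apply/negP; rewrite -ltNge; exact: lt_le_trans ca.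
have mcos s : measurable_fun setT (fun x : d.-tuple R => cos (2 * pi * alpha * (tnth x i - s))).
  apply: (@measurableT_comp _ _ _ _ _ _ (@cos R) setT
    (fun x : d.-tuple R => 2 * pi * alpha * (tnth x i - s))).
    by apply: continuous_measurable_fun; exact: continuous_cos.
  by apply: measurable_funM => //; exact: measurable_funB.
have cos1 y : `|cos y| <= 1 :> R by rewrite ler_norml cos_geN1 cos_le1.
pose psi (x : d.-tuple R) := cos (2 * pi * alpha * (tnth x i - c / 2)) - cos (pi * alpha * c).
pose phi (x : d.-tuple R) := 1 - cos (2 * pi * alpha * (tnth x i - 0)).
have h1 : mult_set [set x | 0 < psi x].
  apply: (@mult_set_pos _ 2); first exact: measurable_funB.
    by move=> x; apply: le_trans (ler_normB _ _) _; apply: lerD.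
  exact: (multiplierB leb (multiplier_cos leb i (c / 2)) (multiplier_cst leb (cos (pi * alpha * c)))).
have h2 : mult_set [set x | 0 < phi x].
  apply: (@mult_set_pos _ 2); first exact: measurable_funB.
    by move=> x; apply: le_trans (ler_normB _ _) _; rewrite normr1; apply: lerD.
  exact: (multiplierB leb (multiplier_cst leb 1) (multiplier_cos leb i 0)).
have [_ h3] := mult_setI (mult_setC h1) h2.
apply: multiplier_ext h3 => x /cubeP/(_ i)/andP[x0 xa]; rewrite !indicE; congr ((nat_of_bool _)%:R).
set y := tnth x i in x0 xa *.
have pi0 := pi_gt0 R.
have ai : alpha * alpha^-1 = 1 by rewrite mulfV // gt_eqF.
have ac : alpha * c < 1 by rewrite -ai ltr_pM2l.
have ay : alpha * y < 1 by rewrite -ai ltr_pM2l.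
have ac0 : 0 < alpha * c by exact: mulr_gt0.
have ay0 : 0 <= alpha * y by rewrite mulr_ge0 // ltW.
have psiE : psi x = 2 * (sin (pi * (alpha * y)) * sin (pi * (alpha * (c - y)))).
  rewrite /psi -/y.
  have -> : 2 * pi * alpha * (y - c / 2) =
    pi * (alpha * y) - pi * (alpha * (c - y)) by field.
  have -> : pi * alpha * c = pi * (alpha * y) + pi * (alpha * (c - y)) by ring.
  by rewrite cosB cosD; ring.
have sgt0 (t : R) : 0 < t -> t < 1 -> 0 < sin (pi * t).
  by move=> t0 t1; apply: sin_gt0_pi; rewrite mulr_gt0 //= gtr_pMr.
apply/idP/idP; rewrite !inE /=.
  move=> [psi0 phi0]; rewrite leNgt; apply/negP => yc; apply: psi0.
  have y0 : 0 < y.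
    rewrite lt_neqAle x0 andbT; apply/eqP => y0; move: phi0.
    by rewrite /phi -/y -y0 subr0 mulr0 cos0 subrr ltxx.
  rewrite psiE mulr_gt0 // mulr_gt0 // sgt0 ?mulr_gt0 ?subr_gt0 //.
  by apply: lt_le_trans (_ : alpha * c <= 1); rewrite ?ltr_pM2l ?ltrBlDr ?ltrDl // ltW.
move=> cy; have y0 : 0 < y by exact: lt_le_trans cy.
split; last first.
  rewrite /phi -/y subr_gt0 subr0; apply: cos_lt1; first by rewrite !mulr_gt0.
  by rewrite -mulrA gtr_pMr // mulr_gt0.
apply/negP; rewrite -leNgt psiE pmulr_rle0 // pmulr_rle0; last first.
  by apply: sgt0 => //; exact: mulr_gt0.
have [->|cny] := eqVneq c y; first by rewrite subrr !mulr0 sin0.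
rewrite -oppr_ge0 -sinN -mulrN -mulrN opprB ltW // sgt0 //.
  by rewrite mulr_gt0 // subr_gt0 lt_neqAle cny.
by apply: lt_trans ay; rewrite ltr_pM2l // ltrBlDr ltrDl.
Qed.

Lemma mult_set_all A : measurable A -> mult_set A.
Proof. by apply: tuple_sigma_ind; [exact: mult_set_sigma|exact: mult_ray]. Qed.

End AllOfL2.

(** * Parseval's identity on a cube *)

Lemma boxseq_cover (d : nat) (s : seq (d.-tuple int)) : exists K, forall M, (K <= M)%N ->
  {subset s <= boxseq d M}.
Proof.
elim: s => [|m s [K hK]]; first by exists 0%N.
pose k := (\sum_i `|tnth m i|)%N.
exists (maxn K k) => M; rewrite geq_max => /andP[KM kM] x.
rewrite inE => /predU1P[->|xs]; last exact: hK.
rewrite mem_boxseq; apply/forallP => i.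
have : (`|tnth m i| <= k)%N by rewrite /k (bigD1 i) //= leq_addr.
lia.
Qed.

Import HBNNSimple.

Section Parseval.
Variables (R : realType) (d : nat) (mu : {measure set (d.-tuple R) -> \bar R}).
Hypothesis leb : is_lebesgue mu.
Implicit Types (w x : d.-tuple R) (u v : fn R d).
Variable alpha : R.
Hypothesis alpha0 : 0 < alpha.

Let Q : set (d.-tuple R) := cube alpha^-1.
Local Notation multiplier := (multiplier mu alpha).
Local Notation trig_closure := (trig_closure mu alpha).
Local Notation em := (em alpha).

Lemma multiplier_nnsfun (g : {nnsfun (d.-tuple R) >-> R}) : multiplier g.
Proof.
have := fimfunE g => gE.
pose s := finmap.enum_fset (fset_set (range g)).
have gE' x : g x = \sum_(y <- s) y * \1_(g @^-1` [set y]) x.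
  by rewrite gE fsbig_finite.
have h t : multiplier (fun x => \sum_(y <- t) y * \1_(g @^-1` [set y]) x).
  elim: t => [|y t ih].
    by apply: multiplier_ext (multiplier_cst leb 0) => x _; rewrite big_nil.
  have hy : multiplier (\1_(g @^-1` [set y])).
    by have [] := mult_set_all leb alpha0 (measurable_sfunP g (measurable_set1 y)).
  apply: multiplier_ext (multiplierD leb (multiplierM (multiplier_cst leb y) hy) ih) => x _.
  by rewrite big_cons.
by apply: multiplier_ext (h s) => x _; rewrite gE'.
Qed.

(** Simple functions increasing to [v] are multipliers; applied to the indicator of [Q] they
    converge in L2, dominated by [v^2]. *)
Lemma trig_closure_real_ge0 (v : d.-tuple R -> R) : (forall x, 0 <= v x) ->
  L2 mu (fun x => (v x)%:C) -> trig_closure (fun x => ind Q x * (v x)%:C).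
Proof.
move=> v0 Lv; have [[mv _] iv] := (L2P _ _).1 Lv.
have [g [gn gv]] := approximation measurableT
  ((measurable_EFinP _ _).2 mv : measurable_fun setT (EFin \o v)) (fun x _ => v0 x).
have gcv x : (g n x) @[n --> \oo] --> v x.
  by have /fine_cvgP[_] := gv x I.
have gle n x : g n x <= v x.
  rewrite -(cvg_lim _ (gcv x)) //; apply: nondecreasing_cvgn_le; last exact/cvg_ex/(ex_intro _ (v x)).
  by move=> a b ab; have /lefP := gn a b ab.
apply: trig_closure_lim => //.
- by apply: L2_indM => //; exact: measurable_cube.
- by move=> x nx; rewrite /ind indicE memNset // mul0r.
move=> e e0.
have Vn n : trig_closure (fun x => (g n x)%:C * ind Q x).
  by apply: multiplier_nnsfun; exact: trig_closure_ind.
have eqx n x : csq (ind Q x * (v x)%:C - (g n x)%:C * ind Q x) =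
    (v x - g n x) * (v x - g n x) * \1_Q x.
  rewrite [X in csq (X - _)]mulrC -mulrBl -(rmorphB (real_complex R)) csqM csq_ind.
  by rewrite csqE cmodC real_normK ?num_real // expr2.
have [n hn] : exists n, l2norm mu (fun x => ind Q x * (v x)%:C - (g n x)%:C * ind Q x) <= e.
  apply: (l2_dominated _ _ iv) => //.
  - by apply: L2_indM => //; exact: measurable_cube.
  - by move=> n; have [] := Vn n.
  - move=> n x; rewrite eqx [leRHS]csqE cmodC real_normK ?num_real // -expr2.
    have h : (v x - g n x) ^+ 2 <= v x ^+ 2.
      rewrite ler_sqr ?nnegrE ?subr_ge0 // gerBl //.
    by rewrite indicE; case: (_ \in _); rewrite ?mulr1 ?mulr0 ?sqr_ge0.
  - move=> x; under eq_fun do rewrite eqx.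
    have h0 : v x - g n x @[n --> \oo] --> (0 : R).
      have h := cvgB (cvg_cst (v x)) (gcv x); rewrite subrr in h; exact: h.
    have h := cvgM (cvgM h0 h0) (cvg_cst (\1_Q x : R)); rewrite !mul0r in h; exact: h.
by exists (fun x => (g n x)%:C * ind Q x).
Qed.

Lemma trig_closure_all u : L2 mu u -> trig_closure (fun x => ind Q x * u x).
Proof.
move=> Lu; have [[m1 m2] iu] := (L2P _ _).1 Lu.
pose pos (f : d.-tuple R -> R) x := Num.max (f x) 0.
have Vpos (f : d.-tuple R -> R) : measurable_fun setT f -> (forall x, `|f x| <= cmod (u x)) ->
    trig_closure (fun x => ind Q x * (pos f x)%:C).
  move=> mf fu; apply: trig_closure_real_ge0; first by move=> x; rewrite le_max lexx orbT.
  apply: (L2_dom _ iu).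
    by apply: cmeas_real; exact: measurable_maxr.
  move=> x; rewrite !csqE cmodC ler_sqr ?nnegrE ?cmod_ge0 //.
  apply: le_trans (fu x); rewrite /pos /Num.max; case: ifP => // _.
  by rewrite normr0.
have Vf (f : d.-tuple R -> R) : measurable_fun setT f -> (forall x, `|f x| <= cmod (u x)) ->
    trig_closure (fun x => ind Q x * (f x)%:C).
  move=> mf fu; have mNf : measurable_fun setT (fun x => - f x) by exact: measurableT_comp.
  have h1 := Vpos f mf fu.
  have h2 : trig_closure (fun x => ind Q x * (pos (fun x => - f x) x)%:C).
    by apply: Vpos => // x; rewrite normrN.
  have := trig_closureD leb h1 (trig_closureZ leb (-1) h2); congr trig_closure; apply/funext => x.
  rewrite mulN1r -mulrBr -(rmorphB (real_complex R)); congr (_ * (real_complex R _)).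
  by rewrite /pos /Num.max; case: (ltP (f x) 0) => a; case: (ltP (- f x) 0) => b; lra.
have h1 := Vf _ m1 (fun x => cmod_Re (u x)).
have h2 := Vf _ m2 (fun x => cmod_Im (u x)).
have := trig_closureD leb h1 (trig_closureZ leb (0 +i* 1) h2); congr trig_closure; apply/funext => x.
rewrite mulrCA -mulrDr; congr (_ * _); apply: complex_eqP; rewrite !cReIm /=; ring.
Qed.

Definition Qem m : fn R d := fun x => ind Q x * em m x.

Lemma L2_Qem m : L2 mu (Qem m).
Proof.
rewrite /Qem; under eq_fun do rewrite mulrC.
by apply: L2_char; exact: L2_cube.
Qed.

(** Distinct frequencies differ in some coordinate by a nonzero multiple of [2 pi alpha], for which
    the side [1 / alpha] is a period. *)
Lemma inner_Qem m m' : inner mu (Qem m) (Qem m') = (m == m')%:R * ((alpha ^+ d)^-1)%:C.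
Proof.
have aV0 : 0 < alpha^-1 by rewrite invr_gt0.
have -> : inner mu (Qem m) (Qem m') =
    cint mu (fun x => ind Q x * expi (dot (tsub (freq alpha m) (freq alpha m')) x)).
  congr cint; apply/funext => x; rewrite cconjM indJ mulrACA ind_sqr expiJ -expiD.
  by congr (_ * expi _); rewrite ![dot _ x]dotC dotBr.
have [->|mm'] := eqVneq m m'.
  rewrite mul1r (_ : tsub _ _ = cst_tuple d 0); last first.
    by apply: eq_from_tnth => i; rewrite !tnth_mktuple subrr.
  under eq_fun do rewrite dot0l expi0 mulr1.
  rewrite -(_ : inner mu (ind Q) (ind Q) = cint mu (ind Q)); last first.
    by congr cint; apply/funext => x; rewrite indJ ind_sqr.
  rewrite inner_self nsq_ind; last exact: measurable_cube.
  by rewrite (mu_cube leb) ?ltW //= exprVn.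
have [i mi] : exists i, tnth m i != tnth m' i.
  apply/existsP; rewrite -negb_forall; apply: contra mm' => /forallP h.
  by apply/eqP; apply: eq_from_tnth => i; apply/eqP.
have wi : tnth (tsub (freq alpha m) (freq alpha m')) i =
    2 * pi * alpha * (tnth m i - tnth m' i)%:~R.
  by rewrite !tnth_mktuple intrB; ring.
rewrite mul0r; apply: (cint_char0 leb (i := i) aV0).
  rewrite wi; apply: mulf_neq0; last by rewrite intr_eq0 subr_eq0.
  by rewrite gt_eqF // !mulr_gt0 // pi_gt0.
rewrite wi (_ : alpha^-1 * _ = 2 * pi * (tnth m i - tnth m' i)%:~R).
  by apply: expi_int; exact: expi_2pi.
by field; rewrite gt_eqF.
Qed.

(** The orthogonal projection onto the exponentials of index in the box; [alpha ^+ d] normalizes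
    their squared norm. *)
Definition fproj M u : fn R d := fun x =>
  \sum_(m <- boxseq d M) ((alpha ^+ d)%:C * inner mu u (Qem m)) * Qem m x.

Lemma L2_fproj M u : L2 mu (fproj M u).
Proof.
apply: (@L2_sum _ _ _ _ (boxseq d M)
  (fun m x => ((alpha ^+ d)%:C * inner mu u (Qem m)) * Qem m x)) => m _.
by apply: L2Z; exact: L2_Qem.
Qed.

Lemma inner_fproj M u v : L2 mu v -> inner mu (fproj M u) v =
  (alpha ^+ d)%:C * \sum_(m <- boxseq d M) inner mu u (Qem m) * inner mu (Qem m) v.
Proof.
move=> Lv; rewrite inner_suml //; last by move=> m _; apply: L2Z; exact: L2_Qem.
rewrite mulr_sumr; apply: eq_bigr => m _.
by rewrite innerZl ?mulrA //; exact: L2_Qem.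
Qed.

Lemma fproj_orth M u m : L2 mu u -> m \in boxseq d M ->
  inner mu (fun x => u x - fproj M u x) (Qem m) = 0.
Proof.
move=> Lu mM; have LE := L2_Qem m.
rewrite innerBl //; last exact: L2_fproj.
rewrite inner_fproj // (bigD1_seq m) ?boxseq_uniq //= inner_Qem eqxx mul1r.
rewrite big1 ?addr0 => [|k km]; last by rewrite inner_Qem (negbTE km) mul0r mulr0.
rewrite mulrCA -(rmorphM (real_complex R)) mulfV ?mulr1 ?subrr //.
by rewrite expf_neq0 // gt_eqF.
Qed.

(** The residual is orthogonal both to the projection and to the polynomial, so its squared norm is
    its inner product with [u - p]; Cauchy-Schwarz concludes. *)
Lemma fproj_best M u p : L2 mu u -> {subset [seq q.2 | q <- p] <= boxseq d M} ->
  l2norm mu (fun x => u x - fproj M u x) <=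
  l2norm mu (fun x => u x - ind Q x * trigp alpha p x).
Proof.
move=> Lu pM; have LS := L2_fproj M u; have Lp := L2_Qtrigp leb alpha p.
have LuS := L2B Lu LS; have Lup := L2B Lu Lp.
have oS : inner mu (fun x => u x - fproj M u x) (fproj M u) = 0.
  rewrite inner_sumr //; last by move=> m _; apply: L2Z; exact: L2_Qem.
  rewrite big_seq big1 // => m mM; rewrite innerZr //; last exact: L2_Qem.
  by rewrite fproj_orth // mulr0.
have op : inner mu (fun x => u x - fproj M u x) (fun x => ind Q x * trigp alpha p x) = 0.
  rewrite [X in inner mu _ X](_ : _ = fun x => \sum_(q <- p) q.1 * Qem q.2 x); last first.
    apply/funext => x; rewrite mulr_sumr; apply: eq_bigr => q _; exact: mulrCA.
  rewrite inner_sumr //; last by move=> q _; apply: L2Z; exact: L2_Qem.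
  rewrite big_seq big1 // => q qp; rewrite innerZr //; last exact: L2_Qem.
  by rewrite fproj_orth ?mulr0 // pM // map_f.
have e : (nsq mu (fun x => u x - fproj M u x))%:C =
    inner mu (fun x => u x - fproj M u x) (fun x => u x - ind Q x * trigp alpha p x).
  by rewrite -inner_self [LHS]innerBr // [RHS]innerBr // oS op.
have := cauchy_schwarz LuS Lup; rewrite -e cmodC ger0_norm ?nsq_ge0 //.
rewrite -l2norm_sqr expr2; set y := l2norm mu _.
have [y0|y0] := eqVneq y 0; first by rewrite y0 l2norm_ge0.
have y1 : 0 < y by rewrite lt_neqAle eq_sym y0 l2norm_ge0.
by rewrite ler_pM2l.
Qed.

Lemma fourier_limit u v : L2 mu u -> (forall x, ~ Q x -> u x = 0) -> L2 mu v ->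
  forall e, 0 < e -> exists K, forall M, (K <= M)%N ->
  cmod ((alpha ^+ d)%:C * \sum_(m <- boxseq d M) inner mu u (Qem m) * inner mu (Qem m) v -
    inner mu u v) <= e.
Proof.
move=> Lu u0 Lv e e0.
have n0 : 0 < l2norm mu v + 1 by rewrite ltr_wpDl ?l2norm_ge0.
have [_ _ hp] := trig_closure_all Lu.
have [p] := hp _ (divr_gt0 e0 n0).
rewrite [X in l2norm mu X](_ : _ = fun x => u x - ind Q x * trigp alpha p x); last first.
  apply/funext => x; congr (_ - _); have [qx|qx] := pselect (Q x).
    by rewrite /ind indicE mem_set // mul1r.
  by rewrite u0 // mulr0.
move=> hpe; have [K hK] := boxseq_cover [seq q.2 | q <- p].
exists K => M KM; rewrite -inner_fproj // -innerBl //; last exact: L2_fproj.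
apply: le_trans (cauchy_schwarz _ Lv) _; first by apply: L2B => //; exact: L2_fproj.
rewrite l2normBC; apply: le_trans (ler_wpM2r (l2norm_ge0 mu v) (le_trans (fproj_best Lu (hK M KM)) hpe)) _.
by rewrite mulrAC ler_pdivrMr // ler_wpM2l ?lerDl // ltW.
Qed.

End Parseval.

(** * The Wexler-Raz identity *)

Section WexlerRaz.
Variables (R : realType) (d : nat) (mu : {measure set (d.-tuple R) -> \bar R}).
Hypothesis leb : is_lebesgue mu.
Variables (alpha beta : R) (g gt : fn R d).
Hypotheses (alpha0 : 0 < alpha) (beta0 : 0 < beta) (ab1 : alpha * beta <= 1).
Hypotheses (Lg : L2 mu g) (Lgt : L2 mu gt).

Let P : set (d.-tuple R) := cube beta.
Let Q : set (d.-tuple R) := cube alpha^-1.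

Definition bt (n : d.-tuple int) : d.-tuple R := [tuple beta * (tnth n i)%:~R | i < d].

Lemma gabE (h : fn R d) m n x :
  gab alpha beta h (m, n) x = em alpha m x * h (tsub x (bt n)).
Proof. by []. Qed.

Lemma PsubQ : P `<=` Q.
Proof.
move=> x /cubeP h; apply/cubeP => i; have /andP[-> h2] := h i; apply: lt_le_trans h2 _.
by rewrite -[leRHS]mul1r ler_pdivlMr // mulrC.
Qed.

Lemma indPQ x : ind P x * ind Q x = ind P x.
Proof.
rewrite /ind -(rmorphM (real_complex R)); congr (real_complex R _); rewrite !indicE.
have [xP|xP] := boolP (x \in P); last by rewrite mul0r.
by rewrite mem_set ?mulr1 //; apply: PsubQ; exact: set_mem.
Qed.

Definition tile (N : nat) x : R := \sum_(n <- boxseq d N) \1_P (tadd x (bt n)).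

(** The index that carries [x] into [P] by addition of [bt n], hence the minus sign. *)
Definition cell_of x : d.-tuple int := [tuple - Num.floor (tnth x i / beta) | i < d].

Lemma indic_tile x n : \1_P (tadd x (bt n)) = (n == cell_of x)%:R :> R.
Proof.
rewrite indicE; congr ((nat_of_bool _)%:R); apply/idP/eqP.
  rewrite inE => /cubeP h; apply: eq_from_tnth => i; rewrite tnth_mktuple.
  have := h i; rewrite !tnth_mktuple => /andP[h1 h2].
  suff -> : Num.floor (tnth x i / beta) = - tnth n i by rewrite opprK.
  apply: floor_def; rewrite ler_pdivlMr // ltr_pdivrMr // intrD mulrNz.
  apply/andP; split; rewrite 1?mulrDl mulNr [_%:~R * _]mulrC; lra.
move=> ->; rewrite inE; apply/cubeP => i; rewrite !tnth_mktuple mulrNz.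
have /andP[h1 h2] := floor_itv (tnth x i / beta).
rewrite ler_pdivlMr // in h1; rewrite ltr_pdivrMr // intrD mulrDl mul1r in h2.
by rewrite mulrN mulrC; apply/andP; split; lra.
Qed.

Lemma tileE N x : tile N x = (cell_of x \in boxseq d N)%:R.
Proof.
rewrite /tile; under eq_bigr do rewrite indic_tile.
have [xN|xN] := boolP (_ \in _).
  rewrite (bigD1_seq (cell_of x)) ?boxseq_uniq //= eqxx big1 ?addr0 // => n /negbTE ->.
  by [].
by rewrite big_seq big1 // => n nN; case: eqP => // e; rewrite -e nN in xN.
Qed.

Lemma measurable_tadd (t : d.-tuple R) : measurable_fun setT (fun x => tadd x t).
Proof. by under eq_fun do rewrite -tsubN; exact: measurable_tsub. Qed.

Lemma measurable_tile N : measurable_fun setT (tile N).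
Proof.
apply: measurable_sum => n.
apply: (@measurableT_comp _ _ _ _ _ _ (\1_P : _ -> R) setT (fun x => tadd x (bt n))).
  by apply: measurable_indic; exact: measurable_cube.
exact: measurable_tadd.
Qed.

Lemma tile_limit u N0 : L2 mu u -> forall e, 0 < e -> exists2 N, (N0 <= N)%N &
  l2norm mu (fun x => u x - (tile N x)%:C * u x) <= e.
Proof.
move=> Lu e e0.
(* The sequence starts at [N0], since dominated convergence is only asked for one index and that
   index must be at least [N0]. *)
have [n] : exists n, l2norm mu (fun x => (1 : R)%:C * u x - (tile (n + N0) x)%:C * u x) <= e.
  apply: (@l2_mul_limit _ _ _ (fun n => tile (n + N0)) (fun=> 1) u 1) => //.
  - by move=> n; exact: measurable_tile.
  - by move=> n x; rewrite tileE; case: (_ \in _); rewrite ?normr1 ?normr0.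
  - move=> x; have [K hK] := boxseq_cover [:: cell_of x].
    apply: cvg_near_cst; exists K => // n /= Kn.
    by rewrite tileE hK ?mem_head // (leq_trans Kn) // leq_addr.
by under eq_fun do rewrite mul1r; move=> h; exists (n + N0)%N => //; rewrite leq_addl.
Qed.

Variable l : d.-tuple R * d.-tuple R.
Hypothesis al : adj alpha beta l.

Let t := l.1.
Let w := l.2.

Let ew x : R[i] := expi (dot w x).

(** The two halves of the adjoint-lattice condition give this periodicity and that of
    [em_period]. *)
Lemma ew_period n x : ew (tsub x (bt n)) = ew x.
Proof.
rewrite /ew dotBr expiD -expiJ (_ : expi (dot w (bt n)) = 1) ?rmorph1 ?mulr1 //.
rewrite expi_sum big1 // => i _; rewrite tnth_mktuple mulrCA mulrA; apply: expi_int.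
by have /forallP/(_ i)/andP[_ /eqP] := al; rewrite tnth_mktuple.
Qed.

Lemma em_period m x : em alpha m (tsub x t) = em alpha m x.
Proof.
rewrite /em dotBr expiD -expiJ (_ : expi (dot (freq alpha m) t) = 1) ?rmorph1 ?mulr1 //.
rewrite expi_sum big1 // => i _; rewrite tnth_mktuple mulrAC; apply: expi_int.
have /forallP/(_ i)/andP[/eqP + _] := al; rewrite tnth_mktuple => h.
by rewrite -[X in expi X]opprK -expiJ h rmorph1.
Qed.

(** The test functions share out [l]: [f] carries the modulation by [w], and [h], the indicator of
    [P - t], the translation by [t]. *)
Let f : fn R d := fun x => ind P x * ew x.
Let h : fn R d := fun x => ind P (tadd x t).

Lemma L2_f : L2 mu f.
Proof.
rewrite /f; under eq_fun do rewrite mulrC.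
by apply: L2_char; exact: L2_cube.
Qed.

Lemma L2_h : L2 mu h.
Proof.
rewrite /h; under eq_fun do rewrite -tsubN.
by apply: L2_tsub => //; exact: L2_cube.
Qed.

(** For fixed [n], the frame coefficients of [f] and the products of the frame with [h] are, as [m]
    varies, Fourier coefficients on [Q] of [un n] and, up to conjugation, of [vn n]. *)
Definition un n : fn R d := fun x => ind P x * (ew x * (gt (tsub x (bt n)))^*).
Definition vn n : fn R d := fun x => ind P x * (g (tsub (tsub x t) (bt n)))^*.

Lemma L2_conj u : L2 mu u -> L2 mu (fun x => (u x)^*).
Proof.
move=> Lu; have [mu_ iu] := (L2P mu u).1 Lu.
apply: (L2_dom _ iu) => [|x]; first exact: cmeasJ.
by rewrite !csqE cmodJ.
Qed.

Lemma L2_un n : L2 mu (un n).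
Proof.
apply: L2_indM; first exact: measurable_cube.
by apply: L2_char; apply: L2_conj; exact: L2_tsub.
Qed.

Lemma L2_vn n : L2 mu (vn n).
Proof.
apply: L2_indM; first exact: measurable_cube.
apply: L2_conj; apply: (L2_tsub leb t (f := fun x => g (tsub x (bt n)))).
exact: L2_tsub.
Qed.

Lemma inner_f_gab m n : inner mu f (gab alpha beta gt (m, n)) = inner mu (un n) (Qem alpha m).
Proof.
congr cint; apply/funext => x; rewrite gabE /f /un /Qem !cconjM indJ.
by rewrite -{1}(indPQ x); ring.
Qed.

Lemma inner_gab_h m n : inner mu (gab alpha beta g (m, n)) h = inner mu (Qem alpha m) (vn n).
Proof.
have Lgk : L2 mu (gab alpha beta g (m, n)) by exact: L2_gab.
rewrite /inner -(cint_tsub leb t); last exact: cintg_meas (L2_mul Lgk L2_h).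
congr cint; apply/funext => x; rewrite gabE /h /vn /Qem em_period cconjM !indJ conjCK.
rewrite (_ : tadd (tsub x t) t = x); last first.
  by apply: eq_from_tnth => i; rewrite !tnth_mktuple subrK.
by rewrite -{1}(indPQ x); ring.
Qed.

(** Translating by [bt n] moves [P] onto its tile of index [n] and undoes the shifts of both
    windows; the modulation is unaffected by [ew_period]. *)
Lemma inner_un_vn n : inner mu (un n) (vn n) =
  inner mu (fun x => ind P (tadd x (bt n)) * Ul l g x) gt.
Proof.
have LUg : L2 mu (Ul l g) by exact: L2_Ul.
have Lind : L2 mu (fun x => ind P (tadd x (bt n)) * Ul l g x).
  apply: (L2M (m := fun x => ind P (tadd x (bt n))) (C := 1)) => //.
    apply: (cmeas_comp (h := ind P) (s := fun x => tadd x (bt n))).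
      exact: measurable_tadd.
    by apply: cmeas_ind; exact: measurable_cube.
  by move=> x; exact: cmod_ind.
rewrite /inner -[RHS](cint_tsub leb (bt n)); last exact: cintg_meas (L2_mul Lind Lgt).
congr cint; apply/funext => x; rewrite /un /vn /Ul /U.
rewrite (_ : tadd (tsub x (bt n)) (bt n) = x); last first.
  by apply: eq_from_tnth => i; rewrite !tnth_mktuple subrK.
rewrite -[expi _]/(ew (tsub x (bt n))) ew_period cconjM indJ conjCK.
by rewrite -/t !tsub_tsub (taddC t) -[in RHS](ind_sqr P x); ring.
Qed.

Lemma sum_un_vn N : \sum_(n <- boxseq d N) inner mu (un n) (vn n) =
  inner mu (fun x => (tile N x)%:C * Ul l g x) gt.
Proof.
under eq_bigr do rewrite inner_un_vn.
rewrite -inner_suml //; last first.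
  move=> n _.
  apply: (L2M (m := fun x => ind P (tadd x (bt n))) (C := 1)).
  - apply: (cmeas_comp (h := ind P) (s := fun x => tadd x (bt n))).
      exact: measurable_tadd.
    by apply: cmeas_ind; exact: measurable_cube.
  - by move=> x; exact: cmod_ind.
  - exact: L2_Ul.
congr inner; apply/funext => x.
by rewrite -mulr_suml /tile (rmorph_sum (real_complex R)).
Qed.

(** If [t] is nonzero, some coordinate of it is a nonzero multiple of [1 / alpha >= beta], so [P]
    and [P - t] are disjoint. If [t = 0] and [w] is nonzero, a nontrivial character is integrated
    over its period [P]. Otherwise the volume of [P] remains. *)
Lemma inner_f_h : inner mu f h = (beta ^+ d)%:C * (l == l0 R d)%:R.
Proof.
have [tz|/eqP tz] := eqVneq t (cst_tuple d 0); last first.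
  have -> : (l == l0 R d) = false by apply/eqP => ll; apply: tz; rewrite /t ll.
  rewrite mulr0 -[RHS](cint0 mu); congr cint; apply/funext => x; rewrite /f /h indJ.
  have [xP|xP] := pselect (P x); last by rewrite /ind indicE memNset // !mul0r.
  rewrite [X in _ * X](_ : _ = 0) ?mulr0 // /ind indicE memNset //.
  move=> /cubeP htx; apply: tz; apply: eq_from_tnth => i; rewrite tnth_mktuple.
  have /forallP/(_ i)/andP[/eqP hi _] := al; rewrite tnth_mktuple in hi.
  have pi0 := pi_gt0 R.
  have := expi_eq1 hi; rewrite normrN !normrM (gtr0_norm pi0) (gtr0_norm alpha0) normr_nat.
  move=> hl; have : 2 * pi * alpha * `|tnth t i| < 2 * pi.
    rewrite -mulrA gtr_pMr ?mulr_gt0 //; apply: lt_le_trans ab1; rewrite ltr_pM2l //.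
    have := htx i; rewrite tnth_mktuple; have := (cubeP _ _).1 xP i.
    by move=> /andP[a1 a2] /andP[b1 b2]; rewrite ltr_norml; apply/andP; split; lra.
  move=> /hl/eqP; rewrite oppr_eq0 !mulf_eq0 (gt_eqF alpha0) (gt_eqF pi0) pnatr_eq0.
  by move=> /eqP.
have hE x : f x * (h x)^* = ind P x * ew x.
  rewrite /f /h indJ tz mulrAC (_ : tadd x _ = x) ?ind_sqr //.
  by apply: eq_from_tnth => i; rewrite !tnth_mktuple addr0.
rewrite /inner (funext hE).
have [wz|wz] := eqVneq w (cst_tuple d 0).
  have -> : l == l0 R d by rewrite [l]surjective_pairing -/t -/w tz wz.
  rewrite mulr1 /ew wz; under eq_fun do rewrite dot0l expi0 mulr1 -ind_sqr -{2}indJ.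
  rewrite -[cint _ _]/(inner mu (ind P) (ind P)) inner_self nsq_ind; last exact: measurable_cube.
  by rewrite (mu_cube leb) //= ltW.
have -> : (l == l0 R d) = false by apply/eqP => ll; move/eqP: wz; apply; rewrite /w ll.
have [i wi] : exists i, tnth w i != 0.
  apply/existsP; rewrite -negb_forall; apply: contra wz => /forallP hw.
  by apply/eqP; apply: eq_from_tnth => i; rewrite tnth_mktuple; apply/eqP.
rewrite mulr0; apply: (cint_char0 leb (i := i) beta0 wi).
by have /forallP/(_ i)/andP[_ /eqP] := al; rewrite tnth_mktuple.
Qed.

Lemma fourier_sum (s : seq (d.-tuple int)) : forall e, 0 < e -> exists K, forall M, (K <= M)%N ->
  cmod ((alpha ^+ d)%:C * \sum_(n <- s) \sum_(m <- boxseq d M)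
     inner mu (un n) (Qem alpha m) * inner mu (Qem alpha m) (vn n) -
   \sum_(n <- s) inner mu (un n) (vn n)) <= e.
Proof.
elim: s => [|n s ih] e e0.
  by exists 0%N => M _; rewrite !big_nil mulr0 subrr cmod0 ltW.
have e2 : 0 < e / 2 by exact: divr_gt0.
have [K1 h1] := ih _ e2.
have un0 x : ~ Q x -> un n x = 0.
  move=> nQ; rewrite /un /ind indicE memNset ?mul0r // => /PsubQ; exact.
have [K2 h2] := fourier_limit leb alpha0 (L2_un n) un0 (L2_vn n) e2.
exists (maxn K1 K2) => M; rewrite geq_max => /andP[M1 M2].
rewrite !big_cons mulrDr opprD addrACA (splitr e).
by apply: le_trans (cmodD _ _) _; apply: lerD; [exact: h2|exact: h1].
Qed.

Lemma inner_frame_sum M N : \sum_(k \in [set` kpairs d M N])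
    (inner mu f (gab alpha beta gt k) * inner mu (gab alpha beta g k) h) =
  \sum_(n <- boxseq d N) \sum_(m <- boxseq d M)
     inner mu (un n) (Qem alpha m) * inner mu (Qem alpha m) (vn n).
Proof.
rewrite -fsbig_seq ?kpairs_uniq // big_allpairs exchange_big /=.
apply: eq_bigr => n _; apply: eq_bigr => m _.
by rewrite inner_f_gab inner_gab_h.
Qed.

Lemma finite_kpairs (F0 : set (d.-tuple int * d.-tuple int)) : finite_set F0 ->
  exists K, forall M N, (K <= M)%N -> (K <= N)%N -> F0 `<=` [set` kpairs d M N].
Proof.
move=> F0f; pose s := finmap.enum_fset (fset_set F0).
have [K1 h1] := boxseq_cover [seq k.1 | k <- s].
have [K2 h2] := boxseq_cover [seq k.2 | k <- s].
exists (maxn K1 K2) => M N; rewrite !geq_max => /andP[M1 _] /andP[_ N2] k Fk /=.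
have ks : k \in s by rewrite in_fset_set ?inE.
apply/allpairsP; exists k; split; last by case: k {Fk ks}.
  by apply: h1 => //; exact: map_f.
by apply: h2 => //; exact: map_f.
Qed.

Lemma wexler_raz :
  HasSumL2 mu (fun k x => inner mu f (gab alpha beta gt k) * gab alpha beta g k x) f ->
  inner mu (Ul l g) gt = ((alpha * beta) ^+ d)%:C * (l == l0 R d)%:R.
Proof.
move=> [_ hsum].
(* Both sides are the value of one double sum: the frame expansion of [f] tested against [h], and
   its evaluation by Parseval in [m] and tiling in [n]. *)
suff e : (alpha ^+ d)%:C * inner mu f h = inner mu (Ul l g) gt.
  by rewrite -e inner_f_h mulrA -(rmorphM (real_complex R)) -exprMn.
have LUg : L2 mu (Ul l g) by exact: L2_Ul.
apply/eqP; rewrite -subr_eq0; apply/eqP; apply: cmod_le_eq0 => e e0.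
have e3 : 0 < e / 3 by exact: divr_gt0.
have ad0 : 0 < alpha ^+ d by rewrite exprn_gt0.
have nh0 : 0 < l2norm mu h + 1 by rewrite ltr_wpDl ?l2norm_ge0.
have ng0 : 0 < l2norm mu gt + 1 by rewrite ltr_wpDl ?l2norm_ge0.
have e1 : 0 < e / 3 / (alpha ^+ d * (l2norm mu h + 1)) by rewrite divr_gt0 ?mulr_gt0.
have [F0 [F0f hF0]] := hsum _ e1.
have [K0 hK0] := finite_kpairs F0f.
(* [N] is fixed first, large enough for the tiling and for [F0]; [M] follows, since the Fourier
   error depends on the finite set of indices [n]. *)
have [N N0 hN] := tile_limit K0 LUg (divr_gt0 e3 ng0).
have [K1 hK1] := fourier_sum (boxseq d N) e3.
pose M := maxn K0 K1.
have F0k : F0 `<=` [set` kpairs d M N] by apply: hK0; rewrite ?leq_maxl.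
have kf : finite_set [set` kpairs d M N] by exact: finite_seq.
have hF := hF0 _ kf F0k.
pose S x := \sum_(k \in [set` kpairs d M N]) inner mu f (gab alpha beta gt k) * gab alpha beta g k x.
have SE x : S x = \sum_(k <- kpairs d M N) inner mu f (gab alpha beta gt k) * gab alpha beta g k x.
  by rewrite /S -fsbig_seq ?kpairs_uniq.
have LS : L2 mu S.
  rewrite (funext SE); apply: (@L2_sum _ _ _ _ (kpairs d M N)
    (fun k x => inner mu f (gab alpha beta gt k) * gab alpha beta g k x)) => k _.
  by apply: L2Z; exact: L2_gab.
have Sh : inner mu S h = \sum_(n <- boxseq d N) \sum_(m <- boxseq d M)
     inner mu (un n) (Qem alpha m) * inner mu (Qem alpha m) (vn n).
  rewrite -inner_frame_sum -fsbig_seq ?kpairs_uniq // (funext SE) inner_suml //; last first.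
  - by move=> k _; apply: L2Z; exact: L2_gab.
  - exact: L2_h.
  by apply: eq_bigr => k _; rewrite innerZl //; [exact: L2_gab|exact: L2_h].
have b1 : cmod ((alpha ^+ d)%:C * inner mu f h - (alpha ^+ d)%:C * inner mu S h) <= e / 3.
  rewrite -mulrBr cmodM cmodC (gtr0_norm ad0) -innerBl //; [|exact: L2_f|exact: L2_h].
  apply: le_trans (_ : alpha ^+ d * (e / 3 / (alpha ^+ d * (l2norm mu h + 1)) *
      (l2norm mu h + 1)) <= _); last first.
    by rewrite le_eqVlt; apply/orP; left; apply/eqP; field; rewrite !gt_eqF.
  rewrite ler_pM2l //; apply: le_trans (cauchy_schwarz (L2B L2_f LS) L2_h) _.
  apply: ler_pM; rewrite ?l2norm_ge0 //.
  by rewrite lerDl.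
have b2 := hK1 M (leq_maxr _ _); rewrite -Sh sum_un_vn in b2.
have b3 : cmod (inner mu (fun x => (tile N x)%:C * Ul l g x) gt - inner mu (Ul l g) gt) <= e / 3.
  have LtU : L2 mu (fun x => (tile N x)%:C * Ul l g x).
    apply: (L2M (m := fun x => (tile N x)%:C) (C := 1)) LUg.
      by apply: cmeas_real; exact: measurable_tile.
    by move=> x; rewrite cmodC tileE; case: (_ \in _); rewrite ?normr1 ?normr0.
  rewrite -innerBl //; apply: le_trans (cauchy_schwarz (L2B LtU LUg) Lgt) _.
  rewrite l2normBC; apply: le_trans (ler_wpM2r (l2norm_ge0 mu gt) hN) _.
  by rewrite mulrAC ler_pdivrMr // ler_pM2l // lerDl.
apply: le_trans (cmodB _ _ _) _; apply: le_trans (lerD b1 (cmodB _ _ _)) _.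
apply: le_trans (lerD (lexx _) (lerD b2 b3)) _.
lra.
Qed.

End WexlerRaz.

(** * The theorem *)

Lemma gabor_limit (R : realType) (d : nat) (mu : {measure set (d.-tuple R) -> \bar R})
  (leb : is_lebesgue mu) (alpha beta : R) (g gt : fn R d) (T : Op R d) :
  0 < alpha -> 0 < beta -> alpha * beta <= 1 ->
  dual_gabor_frame mu alpha beta g gt -> inA mu T ->
  double_lim (fun M N => ((alpha * beta) ^+ d)^-1%:C * gabor_avg mu alpha beta g gt T M N)
             (gamma mu T).
Proof.
move=> alpha0 beta0 ab1 [[Lg _] [Lgt _] hsum] AT; have [LT _] := AT.
have c0 : 0 < (alpha * beta) ^+ d by rewrite exprn_gt0 ?mulr_gt0.
apply: dlim_close => e e0.
(* By [gabor_avg_close], an operator error [e'] moves the normalized averages by at most [e' K],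
   whatever [M] and [N]. *)
pose K := ((alpha * beta) ^+ d)^-1 * (l2norm mu g * l2norm mu gt).
have K0 : 0 <= K by rewrite !mulr_ge0 ?l2norm_ge0 // invr_ge0 ltW.
pose e' := Num.min e (e / (K + 1)).
have K1 : 0 < K + 1 by rewrite ltr_wpDl.
have e'0 : 0 < e' by rewrite lt_min e0 divr_gt0.
have [P hP cP] := gammaP leb AT e'0.
have lim := dlimZ ((alpha * beta) ^+ d)^-1%:C (dlim_polyop leb alpha beta P Lg Lgt).
exists (fun M N => ((alpha * beta) ^+ d)^-1%:C * gabor_avg mu alpha beta g gt (polyop P) M N).
exists (zcoef P); split.
- move: lim; congr double_lim; rewrite /zcoef mulr_sumr; apply: eq_bigr => p _.
  (* Zero belongs to the adjoint lattice, so off it both sides vanish; on it the Wexler-Raz factor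
     cancels the normalization. *)
  have [al|al] := boolP (adj alpha beta p.2); last first.
    rewrite !mulr0; case: eqP => [pl|_]; last by rewrite mulr0.
    by rewrite pl adj0 in al.
  rewrite mulr1 (wexler_raz leb alpha0 beta0 ab1 Lg Lgt al); last exact: hsum (L2_f leb beta p.2).
  rewrite mulrCA; congr (_ * _); rewrite mulrA -(rmorphM (real_complex R)) mulVf ?mul1r //.
  by rewrite gt_eqF.
- by apply: le_trans cP _; rewrite ge_min lexx.
- move=> M N; rewrite -mulrBr cmodM cmodC ger0_norm; last by rewrite invr_ge0 ltW.
  have h := gabor_avg_close leb alpha beta M N Lg Lgt (ltW e'0) LT (@L2_polyop _ _ _ leb P) hP.
  have cV : 0 <= ((alpha * beta) ^+ d)^-1 by rewrite invr_ge0 ltW.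
  apply: le_trans (ler_wpM2l cV h) _; rewrite mulrCA -/K.
  apply: le_trans (_ : e / (K + 1) * K <= _).
    by rewrite ler_wpM2r // ge_min lexx orbT.
  by rewrite mulrAC ler_pdivrMr // ler_pM2l // lerDl.
Qed.

Theorem theorem4 (R : realType) (d : nat) (mu : {measure set (d.-tuple R) -> \bar R}) :
  is_lebesgue mu ->
  exists gamma : Op R d -> R[i],
    (* the normalized limit exists for every T in A and equals gamma T,
       whatever alpha, beta, g, gt are *)
    (forall (alpha beta : R) (g gt : fn R d),
       0 < alpha -> 0 < beta -> alpha * beta <= 1 ->
       dual_gabor_frame mu alpha beta g gt ->
       forall T : Op R d, inA mu T ->
         double_lim (fun M N => ((alpha * beta) ^+ d)^-1%:C * gabor_avg mu alpha beta g gt T M N)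
                    (gamma T)) /\
    (* gamma (sum c_l U_l) = c_0 *)
    (forall c (T : Op R d), is_Asum mu c T -> gamma T = c ([tuple (0 : R) | _ < d], [tuple (0 : R) | _ < d])) /\
    (* gamma is a faithful tracial state on A *)
    gamma id = 1 /\
    (forall (S T : Op R d) (a b : R[i]), inA mu S -> inA mu T ->
       gamma (fun f x => a * S f x + b * T f x) = a * gamma S + b * gamma T) /\
    (forall S T : Op R d, inA mu S -> inA mu T -> gamma (S \o T) = gamma (T \o S)) /\
    (forall T T' : Op R d, inA mu T -> inA mu T' -> adjoint mu T T' ->
       0 <= gamma (T' \o T) /\
       (gamma (T' \o T) = 0 -> forall f, L2 mu f -> {ae mu, forall x, T f x = 0})).
Proof.
move=> leb; exists (gamma mu); split; [|split; [|split; [|split; [|split]]]].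
- by move=> alpha beta g gt alpha0 beta0 ab1 hd T AT; exact: gabor_limit.
- by move=> c T; exact: gamma_asum.
- exact: gamma_id.
- by move=> S T a b; exact: gamma_lin.
- by move=> S T; exact: gammaC.
- move=> T T' AT AT' adjT; split; first exact: gamma_ge0.
  exact: gamma_faithful.
Qed.
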